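(* Let $c_{2d}<c_{2d-1}<\dots<c_1$ be real, $d\ge3$, and consider the compactified hyperelliptic curve $\mu^2=\prod_{j=1}^{2d}(z-c_j)$ with its two points at infinity $\infty^\pm$ ($\mu\sim\pm z^d$). With an appropriate choice of a canonical homology basis for this curve (and an appropriate path of integration from $\infty^-$ to $\infty^+$), the Abel map based at $\infty^-$ and the frequencies $f_j$ are related by $$\pm\big(\mathcal A_{\infty^-}(\infty^+)\big)_j=f_j,\qquad j=1,\dots,d-1.$$
   Context: $\mathcal A_{\infty^-}(\infty^+)=\int_{\infty^-}^{\infty^+}\omega$, where $\omega=(\omega_1,\dots,\omega_{d-1})^t$ are the holomorphic differentials normalized by $\oint_{\mathbf a_j}\omega_k=\delta_{jk}$; it is a vector modulo the period lattice. Let $E=[c_{2d},c_{2d-1}]\cup\dots\cup[c_2,c_1]$. Let $\eta$ be the differential of the third kind on the curve with simple poles at $\infty^\pm$ with residues $\pm1$ and $\int_{c_{2j+1}}^{c_{2j}}\eta=0$ for $j=1,\dots,d-1$. The equilibrium measure is $\mathcal M_E([c_{2k},c_{2k-1}])=\frac1\pi\int_{c_{2k}}^{c_{2k-1}}|\eta|$, and the frequencies are $f_j=\sum_{k=d+1-j}^d\mathcal M_E([c_{2k},c_{2k-1}])$, $j=1,\dots,d-1$. *)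

(* Defs.v *)
(* Stdlib reals + Coquelicot. *)
From Stdlib Require Import Reals ZArith List.
From Coquelicot Require Import Coquelicot.
Import ListNotations.

Set Implicit Arguments.
Unset Strict Implicit.

Local Open Scope C_scope.

(** ** The curve mu^2 = Q(z), Q(z) = prod_{j=1}^{2d} (z - c_j)

    Branch points are c 1 > c 2 > ... > c (2d); the value c 0 is never used. *)

Fixpoint monic_of_roots (l : list R) (z : C) : C :=
  match l with
  | [] => 1
  | r :: l' => (z - RtoC r) * monic_of_roots l' z
  end.

Fixpoint monic_of_roots' (l : list R) (z : C) : C :=
  match l with
  | [] => 0
  | r :: l' => monic_of_roots l' z + (z - RtoC r) * monic_of_roots' l' z
  end.

Definition branch_list (d : nat) (c : nat -> R) : list R :=
  map c (seq 1 (2 * d)).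

Definition branch_poly (d : nat) (c : nat -> R) : C -> C :=
  monic_of_roots (branch_list d c).

(** The derivative of [branch_poly]. *)
Definition branch_poly' (d : nat) (c : nat -> R) : C -> C :=
  monic_of_roots' (branch_list d c).

Definition on_curve (d : nat) (c : nat -> R) (p : C * C) : Prop :=
  snd p * snd p = branch_poly d c (fst p).

(** Punctured neighbourhoods, on the compactified curve, of the point at
    infinity near which mu ~ eps z^d, for eps = 1 or eps = -1. *)
Definition at_infty (d : nat) (c : nat -> R) (eps : R) (P : C * C -> Prop) : Prop :=
  exists M delta : R, (0 < delta)%R /\
    forall p : C * C, on_curve d c p ->
      (M < Cmod (fst p))%R ->
      (Cmod (snd p / Cpow (fst p) d - RtoC eps) < delta)%R -> P p.

(** ** Differentials

    The affine curve is smooth, its coordinate ring is C[z] + C[z] mu, and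
    dz/mu generates its regular differentials.  So a meromorphic differential
    of the compactified curve with no pole outside the two points at infinity
    is (A(z) + B(z) mu) dz/mu with A, B in C[z].  Polynomials are coefficient
    lists, constant coefficient first. *)

Fixpoint peval (l : list C) (z : C) : C :=
  match l with
  | [] => 0
  | a :: l' => a + z * peval l' z
  end.

Record abelian_differential := AbelianDifferential { dA : list C; dB : list C }.

Definition factor (w : abelian_differential) (p : C * C) : C :=
  peval (dA w) (fst p) + peval (dB w) (fst p) * snd p.

Definition dz_coef (w : abelian_differential) (p : C * C) : C :=
  factor w p / snd p.

(** In the local coordinate 1/z at infinity, dz = - z^2 d(1/z). *)
Definition dzinv_coef (w : abelian_differential) (p : C * C) : C :=
  - (dz_coef w p * (fst p * fst p)).

Definition holomorphic (d : nat) (c : nat -> R) (w : abelian_differential) : Prop :=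
  forall eps : R, eps = 1%R \/ eps = (-1)%R ->
    exists l : C, filterlim (dzinv_coef w) (at_infty d c eps) (locally l).

(** Simple poles exactly at the two points at infinity, with residue eps at
    the point where mu ~ eps z^d. *)
Definition third_kind (d : nat) (c : nat -> R) (w : abelian_differential) : Prop :=
  forall eps : R, eps = 1%R \/ eps = (-1)%R ->
    filterlim (fun p => dzinv_coef w p * / fst p)
      (at_infty d c eps) (locally (RtoC eps)).

(** Value on a vector (vz, vmu) tangent to the affine curve at p.  At a branch
    point, 2 mu dmu = Q'(z) dz gives dz/mu = 2 dmu/Q'(z). *)
Definition apply_form (d : nat) (c : nat -> R) (w : abelian_differential) (p v : C * C) : C :=
  factor w p *
  (if Ceq_dec (snd p) 0 then 2 * snd v / branch_poly' d c (fst p) else fst v / snd p).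

(** ** Curves, loops and cycles *)

Record curve (d : nat) (c : nat -> R) := Curve {
  point : R -> C * C;
  velocity : R -> C * C;
  point_on_curve : forall t, on_curve d c (point t);
  is_derive_z : forall t,
    is_derive (V := C_R_NormedModule) (fun s => fst (point s)) t (fst (velocity t));
  is_derive_mu : forall t,
    is_derive (V := C_R_NormedModule) (fun s => snd (point s)) t (snd (velocity t));
  continuous_vz : forall t,
    continuous (U := C_R_NormedModule) (fun s => fst (velocity s)) t;
  continuous_vmu : forall t,
    continuous (U := C_R_NormedModule) (fun s => snd (velocity s)) t
}.

Record loop (d : nat) (c : nat -> R) := Loop {
  loop_curve :> curve d c;
  loop_periodic : forall t, point loop_curve (t + 1)%R = point loop_curve t
}.

Definition pullback (d : nat) (c : nat -> R) (w : abelian_differential)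
    (g : curve d c) (t : R) : C :=
  apply_form d c w (point g t) (velocity g t).

Definition loop_int (d : nat) (c : nat -> R) (w : abelian_differential) (g : loop d c) : C :=
  RInt (V := C_R_CompleteNormedModule) (pullback w g) 0 1.

(** Finite formal sums of loops with integer coefficients. *)
Definition cycle (d : nat) (c : nat -> R) := list (Z * loop d c).

Definition cycle_int (d : nat) (c : nat -> R) (w : abelian_differential) (A : cycle d c) : C :=
  fold_right (fun kg s => RtoC (IZR (fst kg)) * loop_int w (snd kg) + s) 0 A.

(** Homology is that of the compactified curve; every class is represented by
    loops avoiding the points at infinity.  Two cycles are homologous when all
    closed differentials have equal integrals over them; on a compact Riemann
    surface the closed differentials are, up to exact ones, the sums of a
    holomorphic and an antiholomorphic one. *)
Definition homologous (d : nat) (c : nat -> R) (A B : cycle d c) : Prop :=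
  forall w, holomorphic d c w -> cycle_int w A = cycle_int w B.

Definition cycle_scale (d : nat) (c : nat -> R) (k : Z) (A : cycle d c) : cycle d c :=
  map (fun kg => ((k * fst kg)%Z, snd kg)) A.

(** sum_{j=1}^{g} (m_j a_j + n_j b_j). *)
Definition cycle_comb (d : nat) (c : nat -> R) (g : nat) (a b : nat -> cycle d c)
    (m n : nat -> Z) : cycle d c :=
  flat_map (fun j => cycle_scale (m j) (a j) ++ cycle_scale (n j) (b j)) (seq 1 g).

(** ** Intersection numbers *)

(** Im <v, w>.  Tangent vectors at one point of the curve lie in a complex
    line, w = lambda v, and this is |v|^2 Im lambda: positive iff (v, w) is a
    positively oriented real basis of the tangent plane. *)
Definition orient (v w : C * C) : R :=
  Im (Cconj (fst v) * fst w + Cconj (snd v) * snd w).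

Definition Zsign (x : R) : Z :=
  if Rlt_dec 0 x then 1%Z else if Rlt_dec x 0 then (-1)%Z else 0%Z.

Definition transversal_count (d : nat) (c : nat -> R) (g h : loop d c) (n : Z) : Prop :=
  exists l : list (R * R),
    NoDup l /\
    (forall s t : R, In (s, t) l <->
       (0 <= s < 1)%R /\ (0 <= t < 1)%R /\ point g s = point h t) /\
    (forall s t : R, In (s, t) l -> orient (velocity g s) (velocity h t) <> 0%R) /\
    n = fold_right Z.add 0%Z
          (map (fun st => Zsign (orient (velocity g (fst st)) (velocity h (snd st)))) l).

(** The intersection form is alternating, hence the value 0 for two copies of
    one loop. *)
Definition loop_intersection (d : nat) (c : nat -> R) (g h : loop d c) (n : Z) : Prop :=
  (g = h /\ n = 0%Z) \/ transversal_count g h n.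

(** The bilinear extension, for cycles in general position. *)
Definition intersection (d : nat) (c : nat -> R) (A B : cycle d c) (n : Z) : Prop :=
  exists N : loop d c -> loop d c -> Z,
    (forall kg lh, In kg A -> In lh B ->
       loop_intersection (snd kg) (snd lh) (N (snd kg) (snd lh))) /\
    n = fold_right Z.add 0%Z
          (map (fun x => (fst (fst x) * fst (snd x)
                          * N (snd (fst x)) (snd (snd x)))%Z)
             (list_prod A B)).

Definition kronecker (i j : nat) : Z := if Nat.eqb i j then 1%Z else 0%Z.

Definition homology_basis (d : nat) (c : nat -> R) (a b : nat -> cycle d c) : Prop :=
  (forall A : cycle d c, exists m n : nat -> Z,
     homologous A (cycle_comb (d - 1) a b m n)) /\
  (forall m n : nat -> Z, homologous (cycle_comb (d - 1) a b m n) [] ->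
     forall j, (1 <= j <= d - 1)%nat -> m j = 0%Z /\ n j = 0%Z).

Definition canonical_homology_basis (d : nat) (c : nat -> R)
    (a b : nat -> cycle d c) : Prop :=
  homology_basis a b /\
  forall i j, (1 <= i <= d - 1)%nat -> (1 <= j <= d - 1)%nat ->
    intersection (a i) (a j) 0%Z /\
    intersection (b i) (b j) 0%Z /\
    intersection (a i) (b j) (kronecker i j).

(** ** Normalized differentials and the Abel map *)

Definition normalized (d : nat) (c : nat -> R) (a : nat -> cycle d c)
    (omega : nat -> abelian_differential) : Prop :=
  forall k, (1 <= k <= d - 1)%nat ->
    holomorphic d c (omega k) /\
    forall j, (1 <= j <= d - 1)%nat ->
      cycle_int (omega k) (a j) = RtoC (IZR (kronecker j k)).

Definition from_infty_minus_to_infty_plus (d : nat) (c : nat -> R)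
    (g : curve d c) : Prop :=
  filterlim (point g) (Rbar_locally m_infty) (at_infty d c (-1)%R) /\
  filterlim (point g) (Rbar_locally p_infty) (at_infty d c 1).

(** v j is the integral of omega j along g, for j = 1, ..., d-1. *)
Definition is_abel_image (d : nat) (c : nat -> R) (omega : nat -> abelian_differential)
    (g : curve d c) (v : nat -> C) : Prop :=
  forall j, (1 <= j <= d - 1)%nat ->
    is_RInt_gen (V := C_R_NormedModule) (pullback (omega j) g)
      (Rbar_locally m_infty) (Rbar_locally p_infty) (v j).

(** ** Equilibrium measure and frequencies *)

(** A point of the curve over the real number x, with mu = sqrt(Q(x)) or
    mu = i sqrt(-Q(x)); recall that [sqrt] is 0 on negative reals. *)
Definition over_real (d : nat) (c : nat -> R) (x : R) : C * C :=
  (RtoC x, (sqrt (Re (branch_poly d c (RtoC x))), sqrt (- Re (branch_poly d c (RtoC x))))).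

Definition gap_normalized (d : nat) (c : nat -> R) (eta : abelian_differential) : Prop :=
  forall j, (1 <= j <= d - 1)%nat ->
    is_RInt_gen (V := C_R_NormedModule)
      (fun x => dz_coef eta (over_real d c x))
      (at_right (c (2 * j + 1)%nat)) (at_left (c (2 * j)%nat)) (RtoC 0).

(** M_E([c_{2k}, c_{2k-1}]). *)
Definition equilibrium_measure (d : nat) (c : nat -> R) (eta : abelian_differential)
    (k : nat) : R :=
  (/ PI * RInt_gen (V := R_CompleteNormedModule)
            (fun x => Cmod (dz_coef eta (over_real d c x)))
            (at_right (c (2 * k)%nat)) (at_left (c (2 * k - 1)%nat)))%R.

Definition frequency (d : nat) (c : nat -> R) (eta : abelian_differential) (j : nat) : R :=
  sum_n_m (G := R_AbelianMonoid) (equilibrium_measure d c eta) (d + 1 - j) d.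

(* Main.v *)
Require Import Defs.
From Stdlib Require Import Reals ZArith List.
From Stdlib Require Import Lra Lia Psatz Bool Classical IndefiniteDescription.
From Stdlib Require FinFun.
From Coquelicot Require Import Coquelicot.

(** Let Q be the branch polynomial.  The bands [c_{2k}, c_{2k-1}] and the gaps
    [c_{2k+1}, c_{2k}] are the intervals between consecutive branch points.

    The identity is a case of Riemann's reciprocity law for a differential of
    the first kind and one of the third kind, and the homology basis is the
    classical one made of the ovals of the curve over bands and gaps.  As
    homology classes are determined by their periods, all of it can be deduced
    from primitives on one chart around each branch point.  With w = mu / sqrt(Q(z)/(z - c_j)), where the root is cut
    along the real axis outside (c_{j+1}, c_{j-1}), one has z = c_j + w^2 and
    f dz/mu becomes a holomorphic form on a star-shaped domain of the w-plane;
    it has a primitive, obtained by integration along segments ([prim_deriv]),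
    whose increments are the integrals along curves inside the chart
    ([curve_chart]).

    Homology.  The primitives of two adjacent charts are odd in w, and up to
    sign their derivatives agree, so that they differ by a half period, the
    integral from one branch point to the next.  Following a loop through the
    charts, one collects half periods; a parity argument shows that each occurs
    an even number of times, so that integrals over loops are integer
    combinations of the full periods ([loop_integral]).  The ovals over bands
    and gaps realize these periods ([oval_integral]).  Two consecutive ovals
    meet in one branch point, where they are transversal, and other ovals are
    disjoint.  The sum of the periods over all bands is 0 by the behaviour at
    infinity.  Hence a_j, the oval over the j-th gap from the left, and b_j, the
    sum with negative sign of the ovals over the j leftmost bands, form a
    canonical basis ([ovals_canonical]).  Its independence, and the existence
    of the normalized differentials, come from a count of zeros: a real
    polynomial f of degree at most d - 2 for which the periods of f dz/mu over
    d - 1 of the intervals vanish has a root in each of them, so it is 0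
    ([vanishing_half_periods]).

    The identity.  The same count shows that the normalized differentials
    omega_k = f dz/mu have real f, and that eta = A dz/mu with A real of
    leading coefficient -1, having exactly one zero in every gap.  On the bands
    eta therefore equals pi times the equilibrium density up to constant
    phases, and its integral over the k leftmost bands is - i pi f_k
    ([tail_frequency]).  Let F be the primitive of omega_k that vanishes at
    c_1.  Cauchy's theorem for F eta on the upper half-plane ([reciprocity])
    compares the half-circle at infinity, which yields F(infinity) times the
    residue, with the real axis, which yields products of half periods.  All
    of these are real or zero except the half period 1/2 of omega_k over its
    gap, multiplied by the integral of eta over the bands to the left of that
    gap.  So F(infinity) = f_k / 2 ([endpoint_value]).  The path from infinity
    minus to infinity plus is the part of the curve over [c_1, + infinity); its
    halves are exchanged by the hyperelliptic involution, and both contribute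
    F(infinity) ([path_integral_value]).  This gives the identity with sign
    +. *)

Local Open Scope C_scope.

(** * Limits and derivatives of complex functions *)

Lemma RtoC_m1 : RtoC (-1) = - (1).
Proof. rewrite <- RtoC_opp. reflexivity. Qed.

Lemma RtoC_neq0 (x : R) : x <> 0%R -> RtoC x <> 0.
Proof. intros H E. now apply RtoC_inj in E. Qed.

Definition clim {T} (F : (T -> Prop) -> Prop) (f : T -> C) (l : C) : Prop :=
  forall eps : R, (0 < eps)%R -> F (fun x => (Cmod (f x - l) < eps)%R).

Section Limits.
Context {T : Type} {F : (T -> Prop) -> Prop} {FF : Filter F}.

Lemma clim_ext_loc (f g : T -> C) l :
  F (fun x => f x = g x) -> clim F f l -> clim F g l.
Proof.
  intros H Hf eps He. generalize (filter_and _ _ H (Hf eps He)).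
  apply filter_imp. intros x [E K]. now rewrite <- E.
Qed.

Lemma clim_ext (f g : T -> C) l : (forall x, f x = g x) -> clim F f l -> clim F g l.
Proof. intros H. apply clim_ext_loc. now apply filter_forall. Qed.

Lemma clim_eq (f : T -> C) (a b : C) : a = b -> clim F f a -> clim F f b.
Proof. now intros ->. Qed.

Lemma clim_const (a : C) : clim F (fun _ => a) a.
Proof.
  intros eps He. apply filter_forall. intros _.
  replace (a - a) with (RtoC 0) by ring. now rewrite Cmod_0.
Qed.

Lemma clim_plus (f g : T -> C) a b :
  clim F f a -> clim F g b -> clim F (fun x => f x + g x) (a + b).
Proof.
  intros Hf Hg eps He.
  assert (He2 : (0 < eps / 2)%R) by lra.
  generalize (filter_and _ _ (Hf _ He2) (Hg _ He2)).
  apply filter_imp. intros x [K1 K2].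
  replace (f x + g x - (a + b)) with ((f x - a) + (g x - b)) by ring.
  eapply Rle_lt_trans; [apply Cmod_triangle | lra].
Qed.

Lemma clim_opp (f : T -> C) a : clim F f a -> clim F (fun x => - f x) (- a).
Proof.
  intros Hf eps He. generalize (Hf eps He). apply filter_imp. intros x K.
  replace (- f x - - a) with (- (f x - a)) by ring. now rewrite Cmod_opp.
Qed.

Lemma clim_minus (f g : T -> C) a b :
  clim F f a -> clim F g b -> clim F (fun x => f x - g x) (a - b).
Proof. intros Hf Hg. apply clim_plus; [exact Hf | now apply clim_opp]. Qed.

Lemma clim_mult (f g : T -> C) a b :
  clim F f a -> clim F g b -> clim F (fun x => f x * g x) (a * b).
Proof.
  intros Hf Hg eps He.
  set (K := (Cmod a + Cmod b + 1)%R).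
  assert (HK : (1 <= K)%R) by (unfold K; generalize (Cmod_ge_0 a) (Cmod_ge_0 b); lra).
  set (e := Rmin 1 (eps / (2 * K))).
  assert (He' : (0 < e)%R).
  { unfold e. apply Rmin_glb_lt; [lra|]. apply Rdiv_lt_0_compat; lra. }
  assert (Hs : (e * K <= eps / 2)%R).
  { apply Rle_trans with (eps / (2 * K) * K)%R.
    - apply Rmult_le_compat_r; [lra | apply Rmin_r].
    - right. field. lra. }
  generalize (filter_and _ _ (Hf e He') (Hg e He')).
  apply filter_imp. intros x [K1 K2].
  replace (f x * g x - a * b) with ((f x - a) * (g x - b) + (f x - a) * b + a * (g x - b)) by ring.
  eapply Rle_lt_trans; [apply Cmod_triangle|].
  eapply Rle_lt_trans; [apply Rplus_le_compat_r, Cmod_triangle|].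
  rewrite !Cmod_mult.
  assert (E1 : (e <= 1)%R) by apply Rmin_l.
  generalize (Cmod_ge_0 a) (Cmod_ge_0 b) (Cmod_ge_0 (f x - a)) (Cmod_ge_0 (g x - b)).
  unfold K in *. nra.
Qed.

Lemma clim_neq0 (f : T -> C) (a : C) : a <> 0 -> clim F f a -> F (fun x => f x <> 0).
Proof.
  intros Ha Hf. generalize (Hf (Cmod a) (proj1 (Cmod_gt_0 a) Ha)).
  apply filter_imp. intros x K E. rewrite E in K.
  replace (0 - a) with (- a) in K by ring. rewrite Cmod_opp in K. lra.
Qed.

Lemma clim_inv (f : T -> C) (a : C) : a <> 0 -> clim F f a -> clim F (fun x => / f x) (/ a).
Proof.
  intros Ha Hf eps He.
  assert (Pa := proj1 (Cmod_gt_0 a) Ha).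
  set (e := Rmin (Cmod a / 2) (eps * Cmod a * Cmod a / 2)).
  assert (He' : (0 < e)%R).
  { apply Rmin_glb_lt; [lra|]. assert (0 < eps * Cmod a)%R by nra. nra. }
  generalize (filter_and _ _ (Hf e He') (clim_neq0 f a Ha Hf)).
  apply filter_imp. intros x [K N].
  replace (/ f x - / a) with (- (f x - a) / (f x * a)) by (field; tauto).
  rewrite Cmod_div by (apply Cmult_neq_0; auto).
  rewrite Cmod_opp, Cmod_mult.
  assert (B : (Cmod a / 2 < Cmod (f x))%R).
  { assert (Cmod a <= Cmod (f x) + Cmod (f x - a))%R.
    { replace a with (f x + - (f x - a)) at 1 by ring.
      eapply Rle_trans; [apply Cmod_triangle|]. rewrite Cmod_opp. lra. }
    assert (e <= Cmod a / 2)%R by apply Rmin_l. lra. }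
  assert (e <= eps * Cmod a * Cmod a / 2)%R by apply Rmin_r.
  apply Rlt_div_l; [nra|].
  eapply Rlt_le_trans; [exact K|]. eapply Rle_trans; [exact H|].
  assert (0 < eps * Cmod a)%R by nra. nra.
Qed.

Lemma clim_div (f g : T -> C) (a b : C) : b <> 0 ->
  clim F f a -> clim F g b -> clim F (fun x => f x / g x) (a / b).
Proof. intros Hb Hf Hg. apply clim_mult; [exact Hf | now apply clim_inv]. Qed.

Lemma clim_pow (f : T -> C) a n : clim F f a -> clim F (fun x => f x ^ n) (a ^ n).
Proof.
  intros Hf. induction n; simpl; [apply clim_const | now apply clim_mult].
Qed.

Lemma clim_squeeze (f : T -> C) (g : T -> C) l :
  F (fun x => (Cmod (f x - l) <= Cmod (g x))%R) -> clim F g 0 -> clim F f l.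
Proof.
  intros H Hg eps He. generalize (filter_and _ _ H (Hg eps He)).
  apply filter_imp. intros x [K1 K2].
  replace (g x - 0) with (g x) in K2 by ring. lra.
Qed.
End Limits.

Lemma clim_unique {T} {F : (T -> Prop) -> Prop} {FF : ProperFilter F} (f : T -> C) a b :
  clim F f a -> clim F f b -> a = b.
Proof.
  intros Ha Hb. destruct (Ceq_dec a b) as [E|N]; [exact E|exfalso].
  assert (P : (0 < Cmod (a - b))%R).
  { apply Cmod_gt_0. intros E. apply N. replace a with (a - b + b) by ring. rewrite E. ring. }
  assert (P2 : (0 < Cmod (a - b) / 2)%R) by lra.
  destruct (filter_ex _ (filter_and _ _ (Ha _ P2) (Hb _ P2))) as [x [K1 K2]].
  assert (Cmod (a - b) <= Cmod (f x - a) + Cmod (f x - b))%R; [|lra].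
  replace (a - b) with (- (f x - a) + (f x - b)) by ring.
  eapply Rle_trans; [apply Cmod_triangle|]. rewrite Cmod_opp. lra.
Qed.

Lemma clim_comp {T U} {F : (T -> Prop) -> Prop} {G : (U -> Prop) -> Prop}
  (u : T -> U) (f : U -> C) l :
  filterlim u F G -> clim G f l -> clim F (fun x => f (u x)) l.
Proof. intros H Hf eps He. exact (H _ (Hf eps He)). Qed.

Lemma clim_filterlim {T} (F : (T -> Prop) -> Prop) {FF : Filter F} (f : T -> C) (l : C) :
  clim F f l <-> filterlim f F (@locally C_UniformSpace l).
Proof.
  split.
  - intros H P [eps HP]. change (F (fun x => P (f x))). generalize (H eps (cond_pos eps)). apply filter_imp.
    intros x K. apply HP. apply C_NormedModule_mixin_compat1. exact K.
  - intros H eps He.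
    assert (P : (0 < eps / sqrt 2)%R) by (apply Rdiv_lt_0_compat; [lra | apply sqrt_lt_R0; lra]).
    apply (H (fun y => (Cmod (y - l) < eps)%R)). exists (mkposreal _ P). intros y Hy.
    generalize (C_NormedModule_mixin_compat2 l y (mkposreal _ P) Hy). simpl.
    replace (sqrt 2 * (eps / sqrt 2))%R with eps; [tauto|].
    field. apply Rgt_not_eq, sqrt_lt_R0. lra.
Qed.

Definition cnear (z : C) (P : C -> Prop) : Prop :=
  exists delta : R, (0 < delta)%R /\ forall u, (Cmod (u - z) < delta)%R -> P u.

#[global] Instance cnear_proper z : ProperFilter (cnear z).
Proof.
  constructor.
  - intros P [d [Hd H]]. exists z. apply H. replace (z - z) with (RtoC 0) by ring. now rewrite Cmod_0.
  - constructor.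
    + exists 1%R. split; [lra | trivial].
    + intros P Q [d1 [H1 K1]] [d2 [H2 K2]]. exists (Rmin d1 d2). split.
      * now apply Rmin_glb_lt.
      * intros u Hu. generalize (Rmin_l d1 d2) (Rmin_r d1 d2). intros. split; [apply K1 | apply K2]; lra.
    + intros P Q H [d [Hd K]]. exists d. split; [exact Hd|]. intros u Hu. auto.
Qed.

Lemma cnear_here z P : cnear z P -> P z.
Proof.
  intros [d [Hd H]]. apply H. replace (z - z) with (RtoC 0) by ring. now rewrite Cmod_0.
Qed.

Lemma clim_id z : clim (cnear z) (fun u => u) z.
Proof. intros eps He. exists eps. split; auto. Qed.

Definition ccont (f : C -> C) (z : C) : Prop := clim (cnear z) f (f z).

Lemma clim_ccont {T} {F : (T -> Prop) -> Prop} {FF : Filter F} (u : T -> C) (f : C -> C) l :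
  clim F u l -> ccont f l -> clim F (fun x => f (u x)) (f l).
Proof.
  intros Hu Hf eps He. destruct (Hf eps He) as [d [Hd K]].
  generalize (Hu d Hd). apply filter_imp. intros x Hx. now apply K.
Qed.

Lemma clim_cnear {T} {F : (T -> Prop) -> Prop} {FF : Filter F} (u : T -> C) (P : C -> Prop) l :
  clim F u l -> cnear l P -> F (fun x => P (u x)).
Proof.
  intros Hu [d [Hd K]]. generalize (Hu d Hd). apply filter_imp. intros x Hx. now apply K.
Qed.

(** Caratheodory's form of complex differentiability: the difference quotient
    extends continuously to z.  In this form the rules of calculus, and the
    chain rule for real curves below, are limit rules for products. *)
Definition cderiv (f : C -> C) (z l : C) : Prop :=
  exists phi : C -> C, cnear z (fun u => f u - f z = phi u * (u - z)) /\
    phi z = l /\ ccont phi z.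

Lemma cderiv_cont f z l : cderiv f z l -> ccont f z.
Proof.
  intros [phi [H [E K]]]. unfold ccont.
  apply (clim_ext_loc (fun u => phi u * (u - z) + f z)).
  - revert H. apply filter_imp. intros u Hu. rewrite <- Hu. ring.
  - apply (clim_eq _ (phi z * (z - z) + f z)); [ring|].
    apply clim_plus; [|apply clim_const]. apply clim_mult; [exact K|].
    apply clim_minus; [apply clim_id | apply clim_const].
Qed.

Lemma cderiv_ext_loc f g z l :
  cnear z (fun u => f u = g u) -> cderiv f z l -> cderiv g z l.
Proof.
  intros H [phi [K [E P]]]. exists phi. split; [|tauto].
  assert (H0 := cnear_here _ _ H). simpl in H0.
  generalize (filter_and _ _ H K). apply filter_imp. intros u [A B]. now rewrite <- A, <- H0.
Qed.

Lemma cderiv_ext f g z l : (forall u, f u = g u) -> cderiv f z l -> cderiv g z l.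
Proof. intros H. apply cderiv_ext_loc. now apply filter_forall. Qed.

Lemma cderiv_eq f z l l' : l = l' -> cderiv f z l -> cderiv f z l'.
Proof. now intros ->. Qed.

Lemma cderiv_const a z : cderiv (fun _ => a) z 0.
Proof.
  exists (fun _ => 0). split; [|split; [reflexivity | apply clim_const]].
  apply filter_forall. intros u. ring.
Qed.

Lemma cderiv_id z : cderiv (fun u => u) z 1.
Proof.
  exists (fun _ => 1). split; [|split; [reflexivity | apply clim_const]].
  apply filter_forall. intros u. ring.
Qed.

Lemma cderiv_plus f g z a b :
  cderiv f z a -> cderiv g z b -> cderiv (fun u => f u + g u) z (a + b).
Proof.
  intros [p [Hp [Ep Kp]]] [q [Hq [Eq Kq]]]. exists (fun u => p u + q u).
  split; [|split; [now rewrite Ep, Eq | now apply clim_plus]].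
  generalize (filter_and _ _ Hp Hq). apply filter_imp. intros u [A B].
  replace (f u + g u - (f z + g z)) with ((f u - f z) + (g u - g z)) by ring.
  rewrite A, B. ring.
Qed.

Lemma cderiv_mult f g z a b :
  cderiv f z a -> cderiv g z b -> cderiv (fun u => f u * g u) z (a * g z + f z * b).
Proof.
  intros Hf Hg. assert (Cg := cderiv_cont _ _ _ Hg).
  destruct Hf as [p [Hp [Ep Kp]]], Hg as [q [Hq [Eq Kq]]].
  exists (fun u => p u * g u + f z * q u).
  split; [|split; [now rewrite Ep, Eq|]].
  - generalize (filter_and _ _ Hp Hq). apply filter_imp. intros u [A B].
    replace (f u * g u - f z * g z) with ((f u - f z) * g u + f z * (g u - g z)) by ring.
    rewrite A, B. ring.
  - apply clim_plus; apply clim_mult; auto. apply clim_const.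
Qed.

Lemma cderiv_comp (f g : C -> C) z a b :
  cderiv f (g z) a -> cderiv g z b -> cderiv (fun u => f (g u)) z (a * b).
Proof.
  intros Hf Hg. assert (Cg := cderiv_cont _ _ _ Hg).
  destruct Hf as [p [Hp [Ep Kp]]], Hg as [q [Hq [Eq Kq]]].
  exists (fun u => p (g u) * q u). split; [|split; [now rewrite Ep, Eq|]].
  - generalize (filter_and _ _ (clim_cnear _ _ _ Cg Hp) Hq). apply filter_imp. intros u [A B].
    rewrite A, B. ring.
  - apply clim_mult; [|exact Kq]. now apply (clim_ccont g p (g z)).
Qed.

Lemma cderiv_inv (f : C -> C) z a : f z <> 0 -> cderiv f z a -> cderiv (fun u => / f u) z (- a / (f z * f z)).
Proof.
  intros N Hf. assert (Cf := cderiv_cont _ _ _ Hf).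
  destruct Hf as [p [Hp [Ep Kp]]].
  exists (fun u => - p u / (f u * f z)). split; [|split; [now rewrite Ep|]].
  - generalize (filter_and _ _ Hp (clim_neq0 f _ N Cf)). apply filter_imp. intros u [A B].
    transitivity (- (f u - f z) / (f u * f z)); [field; tauto|].
    rewrite A. field. tauto.
  - apply clim_div; [now apply Cmult_neq_0| now apply clim_opp |].
    apply clim_mult; [exact Cf | apply clim_const].
Qed.

Lemma cderiv_opp f z a : cderiv f z a -> cderiv (fun u => - f u) z (- a).
Proof.
  intros H. apply (cderiv_eq _ _ (0 * f z + (-(1)) * a)); [ring|].
  apply (cderiv_ext (fun u => (-(1)) * f u)); [intros; ring|].
  apply (cderiv_mult (fun _ => -(1)) f); [apply cderiv_const | exact H].
Qed.

Lemma cderiv_minus f g z a b :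
  cderiv f z a -> cderiv g z b -> cderiv (fun u => f u - g u) z (a - b).
Proof. intros Hf Hg. apply cderiv_plus; [exact Hf | now apply cderiv_opp]. Qed.

(** Continuity of the derivative is part of the notion because primitives are
    obtained below by differentiating under the integral sign. *)
Definition holo (D : C -> Prop) (f : C -> C) : Prop :=
  exists f' : C -> C, forall z, D z -> cderiv f z (f' z) /\ ccont f' z.

Section Holo.
Variable D : C -> Prop.

Lemma holo_cont f z : holo D f -> D z -> ccont f z.
Proof. intros [f' H] Hz. exact (cderiv_cont _ _ _ (proj1 (H z Hz))). Qed.

Lemma holo_const a : holo D (fun _ => a).
Proof. exists (fun _ => 0). intros z _. split; [apply cderiv_const | apply clim_const]. Qed.

Lemma holo_id : holo D (fun u => u).
Proof. exists (fun _ => 1). intros z _. split; [apply cderiv_id | apply clim_const]. Qed.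

Lemma holo_plus f g : holo D f -> holo D g -> holo D (fun u => f u + g u).
Proof.
  intros [f' Hf] [g' Hg]. exists (fun u => f' u + g' u). intros z Hz.
  destruct (Hf z Hz), (Hg z Hz). split; [now apply cderiv_plus | now apply clim_plus].
Qed.

Lemma holo_mult f g : holo D f -> holo D g -> holo D (fun u => f u * g u).
Proof.
  intros Hf Hg. generalize (fun z => holo_cont f z Hf) (fun z => holo_cont g z Hg).
  destruct Hf as [f' Hf], Hg as [g' Hg]. intros Cf Cg.
  exists (fun u => f' u * g u + f u * g' u). intros z Hz.
  destruct (Hf z Hz), (Hg z Hz). split; [now apply cderiv_mult |].
  apply clim_plus; apply clim_mult; auto; [now apply Cg | now apply Cf].
Qed.

Lemma holo_opp f : holo D f -> holo D (fun u => - f u).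
Proof.
  intros [f' H]. exists (fun u => - f' u). intros z Hz. destruct (H z Hz).
  split; [now apply cderiv_opp | now apply clim_opp].
Qed.

Lemma holo_minus f g : holo D f -> holo D g -> holo D (fun u => f u - g u).
Proof. intros Hf Hg. apply holo_plus; [exact Hf | now apply holo_opp]. Qed.

Lemma holo_inv (f : C -> C) : (forall z, D z -> f z <> 0) -> holo D f -> holo D (fun u => / f u).
Proof.
  intros N Hf. generalize (fun z => holo_cont f z Hf). destruct Hf as [f' Hf]. intros Cf.
  exists (fun u => - f' u / (f u * f u)). intros z Hz. destruct (Hf z Hz). split.
  - now apply cderiv_inv; [apply N|].
  - apply clim_div; [apply Cmult_neq_0; now apply N | now apply clim_opp |].
    apply clim_mult; now apply Cf.
Qed.

Lemma holo_div (f g : C -> C) : (forall z, D z -> g z <> 0) -> holo D f -> holo D g ->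
  holo D (fun u => f u / g u).
Proof. intros N Hf Hg. apply holo_mult; [exact Hf | now apply holo_inv]. Qed.
End Holo.

Lemma holo_comp (D E : C -> Prop) f g :
  (forall z, D z -> E (g z)) -> holo E f -> holo D g -> holo D (fun u => f (g u)).
Proof.
  intros H Hf Hg. generalize (fun z => holo_cont D g z Hg).
  destruct Hf as [f' Hf], Hg as [g' Hg]. intros Cg.
  exists (fun u => f' (g u) * g' u). intros z Hz.
  destruct (Hf _ (H z Hz)), (Hg z Hz). split; [now apply cderiv_comp |].
  apply clim_mult; [|assumption]. apply (clim_ccont g f'); [now apply Cg | assumption].
Qed.

Lemma holo_sub (D E : C -> Prop) f : (forall z, D z -> E z) -> holo E f -> holo D f.
Proof. intros H [f' Hf]. exists f'. auto. Qed.

(** * Curves with complex values *)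

Definition is_derivC (f : R -> C) (t : R) (v : C) : Prop := is_derive (V := C_R_NormedModule) f t v.

Lemma norm_C_R (x : C) : norm (V := C_R_NormedModule) x = Cmod x.
Proof. 
  change (sqrt (Rabs (fst x) ^ 2 + Rabs (snd x) ^ 2) = sqrt (fst x ^ 2 + snd x ^ 2)).
  rewrite <- !Rsqr_pow2, <- !Rsqr_abs. reflexivity.
Qed.

Lemma scal_C_R (k : R) (x : C) : scal (V := C_R_NormedModule) k x = RtoC k * x.
Proof.
  destruct x as [a b]. unfold scal. simpl. unfold prod_scal, scal; simpl. unfold mult; simpl.
  unfold Cmult, RtoC; simpl. f_equal; ring.
Qed.

Lemma Rlocally_C (t : R) (P : R -> Prop) : locally t P <->
  exists d, (0 < d)%R /\ forall s, (Rabs (s - t) < d)%R -> P s.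
Proof.
  split.
  - intros [d H]. exists d. split; [apply cond_pos|]. intros s Hs. apply H. exact Hs.
  - intros [d [Hd H]]. exists (mkposreal d Hd). intros s Hs. apply H. exact Hs.
Qed.

Lemma clim_RtoC t : clim (locally t) (fun s => RtoC s) (RtoC t).
Proof.
  intros eps He. apply Rlocally_C. exists eps. split; [exact He|].
  intros s Hs. rewrite <- RtoC_minus, Cmod_R. exact Hs.
Qed.

Lemma is_derivC_carath (g : R -> C) t v :
  is_derivC g t v <->
  exists gam : R -> C, (forall s, g s - g t = gam s * RtoC (s - t)) /\ gam t = v /\
    clim (locally t) gam v.
Proof.
  split.
  - intros [_ H]. specialize (H t (fun P H => H)).
    exists (fun s => if Req_EM_T s t then v else (g s - g t) / RtoC (s - t)).
    split; [|split].
    + intros s. destruct (Req_EM_T s t) as [->|N].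
      * replace (t - t)%R with 0%R by ring. ring.
      * field. intros E. apply RtoC_inj in E. lra.
    + now destruct (Req_EM_T t t).
    + intros eps He.
      assert (He2 : (0 < eps / 2)%R) by lra.
      specialize (H (mkposreal _ He2)). revert H. apply filter_imp. intros s H.
      destruct (Req_EM_T s t) as [->|N].
      * replace (v - v) with (RtoC 0) by ring. now rewrite Cmod_0.
      * assert (P : (0 < Rabs (s - t))%R) by (apply Rabs_pos_lt; lra).
        rewrite norm_C_R in H. simpl in H.
        rewrite scal_C_R in H.
        change (Cmod ((g s - g t) - RtoC (s - t) * v) <= eps / 2 * Rabs (s - t))%R in H.
        replace ((g s - g t) / RtoC (s - t) - v) with (((g s - g t) - RtoC (s - t) * v) / RtoC (s - t)).
        2:{ field. intros E. apply RtoC_inj in E. lra. }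
        rewrite Cmod_div, Cmod_R by (apply RtoC_neq0; lra).
        apply Rlt_div_l; [exact P|]. nra.
  - intros [gam [H [E K]]]. split; [apply is_linear_scal_l|].
    intros x Hx eps. assert (E0 := is_filter_lim_locally_unique (V := AbsRing_NormedModule R_AbsRing) _ _ Hx). subst x.
    generalize (K eps (cond_pos eps)). apply filter_imp. intros s Hs.
    rewrite norm_C_R, scal_C_R.
    change (Cmod ((g s - g t) - RtoC (s - t) * v) <= eps * Rabs (s - t))%R.
    rewrite H. replace (gam s * RtoC (s - t) - RtoC (s - t) * v) with ((gam s - v) * RtoC (s - t)) by ring.
    rewrite Cmod_mult, Cmod_R. apply Rmult_le_compat_r; [apply Rabs_pos | lra].
Qed.

Lemma is_derivC_cont g t v : is_derivC g t v -> clim (locally t) g (g t).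
Proof.
  intros H. apply is_derivC_carath in H. destruct H as [gam [H [E K]]].
  apply (clim_ext (fun s => gam s * (RtoC s - RtoC t) + g t)).
  - intros s. rewrite <- RtoC_minus, <- H. ring.
  - apply (clim_eq _ (v * (RtoC t - RtoC t) + g t)); [ring|].
    apply clim_plus; [|apply clim_const]. apply clim_mult; [exact K|].
    apply clim_minus; [apply clim_RtoC | apply clim_const].
Qed.

Lemma is_derivC_eq g t v v' : v = v' -> is_derivC g t v -> is_derivC g t v'.
Proof. now intros ->. Qed.

Lemma is_derivC_mult f g t a b :
  is_derivC f t a -> is_derivC g t b -> is_derivC (fun s => f s * g s) t (a * g t + f t * b).
Proof.
  intros Hf Hg. assert (Cg := is_derivC_cont _ _ _ Hg).
  apply is_derivC_carath in Hf. apply is_derivC_carath in Hg. apply is_derivC_carath.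
  destruct Hf as [p [Hp [Ep Kp]]], Hg as [q [Hq [Eq Kq]]].
  exists (fun s => p s * g s + f t * q s). split; [|split].
  - intros s. replace (f s * g s - f t * g t) with ((f s - f t) * g s + f t * (g s - g t)) by ring.
    rewrite Hp, Hq. ring.
  - now rewrite Ep, Eq.
  - apply clim_plus; apply clim_mult; auto. apply clim_const.
Qed.

Lemma is_derivC_plus f g t a b :
  is_derivC f t a -> is_derivC g t b -> is_derivC (fun s => f s + g s) t (a + b).
Proof. intros Hf Hg. exact (is_derive_plus (V := C_R_NormedModule) f g t a b Hf Hg). Qed.

Lemma is_derivC_const a t : is_derivC (fun _ => a) t 0.
Proof. apply (is_derive_const (V := C_R_NormedModule) a t). Qed.

Lemma is_derivC_minus f g t a b :
  is_derivC f t a -> is_derivC g t b -> is_derivC (fun s => f s - g s) t (a - b).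
Proof. intros Hf Hg. exact (is_derive_minus (V := C_R_NormedModule) f g t a b Hf Hg). Qed.

Lemma is_derivC_comp f (g : R -> C) t a b :
  cderiv f (g t) a -> is_derivC g t b -> is_derivC (fun s => f (g s)) t (a * b).
Proof.
  intros Hf Hg. assert (Cg := is_derivC_cont _ _ _ Hg).
  apply is_derivC_carath in Hg. 
  destruct Hf as [p [Hp [Ep Kp]]], Hg as [q [Hq [Eq Kq]]].
  apply (is_derive_ext_loc (fun s => f (g t) + p (g s) * q s * RtoC (s - t))).
  - generalize (clim_cnear _ _ _ Cg Hp). apply filter_imp. intros s Hs.
    change (f (g t) + p (g s) * q s * RtoC (s - t) = f (g s)).
    rewrite <- Cmult_assoc, <- Hq. 
    replace (f (g s)) with (f (g t) + (f (g s) - f (g t))) by ring. now rewrite Hs.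
  - apply is_derivC_carath. exists (fun s => p (g s) * q s). split; [|split].
    + intros s. replace (t - t)%R with 0%R by ring. ring.
    + now rewrite Ep, Eq.
    + apply clim_mult; [|exact Kq]. rewrite <- Ep. now apply (clim_ccont g p).
Qed.

Lemma is_derivC_RtoC (f : R -> R) t a :
  is_derive f t a -> is_derivC (fun s => RtoC (f s)) t (RtoC a).
Proof.
  intros [_ H]. split; [apply is_linear_scal_l|].
  intros x Hx eps. specialize (H x Hx eps). revert H. apply filter_imp. intros s H.
  rewrite norm_C_R, scal_C_R.
  change (Cmod ((RtoC (f s) - RtoC (f x)) - RtoC (s - x) * RtoC a) <= eps * Rabs (s - x))%R.
  rewrite <- RtoC_mult, <- !RtoC_minus, Cmod_R. exact H.
Qed.

Lemma is_derivC_Re f t a : is_derivC f t a -> is_derive (fun s => Re (f s)) t (Re a).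
Proof.
  intros H. apply is_derivC_carath in H. destruct H as [p [H [E K]]].
  split; [apply is_linear_scal_l|].
  intros x Hx eps. assert (E0 := is_filter_lim_locally_unique (V := AbsRing_NormedModule R_AbsRing) _ _ Hx). subst x.
  generalize (K eps (cond_pos eps)). apply filter_imp. intros s Hs.
  change (Rabs (Re (f s) - Re (f t) - (s - t) * Re a) <= eps * Rabs (s - t))%R.
  replace (Re (f s) - Re (f t) - (s - t) * Re a)%R with (Re ((p s - a) * RtoC (s - t))).
  - eapply Rle_trans; [apply re_le_Cmod|]. rewrite Cmod_mult, Cmod_R.
    apply Rmult_le_compat_r; [apply Rabs_pos | lra].
  - replace ((p s - a) * RtoC (s - t)) with (f s - f t - RtoC (s - t) * a) by (rewrite H; ring).
    unfold Re, Cminus, Cplus, Copp, Cmult; simpl. ring.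
Qed.

Lemma is_derivC_Im f t a : is_derivC f t a -> is_derive (fun s => Im (f s)) t (Im a).
Proof.
  intros H.
  assert (K : is_derivC (fun s => - Ci * f s) t (- Ci * a)).
  { apply (is_derivC_eq _ _ (0 * f t + - Ci * a)); [ring|].
    apply (is_derivC_mult (fun _ => - Ci) f); [apply is_derivC_const | exact H]. }
  apply is_derivC_Re in K.
  replace (Re (- Ci * a)) with (Im a) in K by (destruct a; unfold Re, Im, Ci; simpl; ring).
  apply (is_derive_ext (fun s => Re (- Ci * f s))); [|exact K].
  intros s. destruct (f s); unfold Re, Im, Ci; simpl; ring.
Qed.

Lemma continuousC (f : R -> C) t :
  continuous (U := C_R_NormedModule) f t <-> clim (locally t) f (f t).
Proof. split; intros H; [apply clim_filterlim in H| apply clim_filterlim]; auto; apply locally_filter. Qed.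

(** The real mean value theorem, applied to the real and to the imaginary part;
    this is where the factor 2 comes from. *)
Lemma mean_value_C (g g' : R -> C) a b K : (a <= b)%R ->
  (forall t, (a <= t <= b)%R -> is_derivC g t (g' t)) ->
  (forall t, (a <= t <= b)%R -> (Cmod (g' t) <= K)%R) ->
  (Cmod (g b - g a) <= 2 * K * (b - a))%R.
Proof.
  intros Hab Hd HK.
  assert (M : forall (f f' : R -> R), (forall t, (a <= t <= b)%R -> is_derive f t (f' t)) ->
     (forall t, (a <= t <= b)%R -> (Rabs (f' t) <= K)%R) -> (Rabs (f b - f a) <= K * (b - a))%R).
  { intros f f' Hf HfK.
    destruct (MVT_gen f a b f') as [x [Hx E]].
    - rewrite Rmin_left, Rmax_right by lra. intros x Hx. apply Hf. lra.
    - rewrite Rmin_left, Rmax_right by lra. intros x Hx. 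
      apply continuity_pt_filterlim. apply (ex_derive_continuous f). exists (f' x). apply Hf. lra.
    - rewrite Rmin_left, Rmax_right in Hx by lra. rewrite E, Rabs_mult, (Rabs_right (b - a)) by lra.
      apply Rmult_le_compat_r; [lra | auto]. }
  assert (M1 := M (fun t => Re (g t)) (fun t => Re (g' t))
     (fun t Ht => is_derivC_Re _ _ _ (Hd t Ht))
     (fun t Ht => Rle_trans _ _ _ (re_le_Cmod _) (HK t Ht))).
  assert (M2 := M (fun t => Im (g t)) (fun t => Im (g' t))
     (fun t Ht => is_derivC_Im _ _ _ (Hd t Ht))
     (fun t Ht => Rle_trans _ _ _ (Rle_trans _ _ _ (Rmax_r _ _) (Rmax_Cmod _)) (HK t Ht))).
  cbv beta in M1, M2.
  set (w := g b - g a).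
  replace (Re (g b) - Re (g a))%R with (Re w) in M1 by (unfold w, Re; simpl; ring).
  replace (Im (g b) - Im (g a))%R with (Im w) in M2 by (unfold w, Im; simpl; ring).
  replace w with (RtoC (Re w) + Ci * RtoC (Im w)).
  2:{ destruct w as [x y]. unfold RtoC, Ci, Cplus, Cmult, Re, Im; simpl. f_equal; ring. }
  eapply Rle_trans; [apply Cmod_triangle|]. rewrite Cmod_mult, Cmod_Ci, !Cmod_R. lra.
Qed.

Lemma zero_deriv_C (g : R -> C) a b : (a <= b)%R ->
  (forall t, (a <= t <= b)%R -> is_derivC g t 0) -> g b = g a.
Proof.
  intros Hab H. assert (M := mean_value_C g (fun _ => 0) a b 0 Hab H).
  assert (Cmod (g b - g a) = 0)%R.
  { apply Rle_antisym; [|apply Cmod_ge_0]. eapply Rle_trans; [apply M | lra].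
    intros. rewrite Cmod_0. lra. }
  apply Cmod_eq_0 in H0. replace (g b) with (g b - g a + g a) by ring. rewrite H0. ring.
Qed.

Lemma RInt_C_derive_gen (f df : R -> C) (a b : R) :
  (forall x, (Rmin a b <= x <= Rmax a b)%R -> is_derivC f x (df x)) ->
  (forall x, (Rmin a b <= x <= Rmax a b)%R -> clim (locally x) df (df x)) ->
  is_RInt (V := C_R_NormedModule) df a b (f b - f a).
Proof.
  intros H K. apply (is_RInt_derive (V := C_R_CompleteNormedModule) f df); [exact H|].
  intros x Hx. apply continuousC. auto.
Qed.

Lemma RInt_C_derive (f df : R -> C) (a b : R) : (a <= b)%R ->
  (forall x, (a <= x <= b)%R -> is_derivC f x (df x)) ->
  (forall x, (a <= x <= b)%R -> clim (locally x) df (df x)) ->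
  is_RInt (V := C_R_NormedModule) df a b (f b - f a).
Proof.
  intros Hab H K. apply RInt_C_derive_gen; rewrite Rmin_left, Rmax_right by lra; auto.
Qed.

Lemma is_derivC_unique f t a b : is_derivC f t a -> is_derivC f t b -> a = b.
Proof.
  intros Ha Hb.
  assert (E1 : Re a = Re b).
  { rewrite <- (is_derive_unique _ _ _ (is_derivC_Re _ _ _ Ha)).
    exact (is_derive_unique _ _ _ (is_derivC_Re _ _ _ Hb)). }
  assert (E2 : Im a = Im b).
  { rewrite <- (is_derive_unique _ _ _ (is_derivC_Im _ _ _ Ha)).
    exact (is_derive_unique _ _ _ (is_derivC_Im _ _ _ Hb)). }
  destruct a, b. unfold Re, Im in *; simpl in *. congruence.
Qed.

Lemma is_derivC_id t : is_derivC (fun s => RtoC s) t 1.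
Proof. apply (is_derivC_RtoC (fun s => s)). apply (is_derive_id (K := R_AbsRing)). Qed.

Lemma cderiv_unique f z a b : cderiv f z a -> cderiv f z b -> a = b.
Proof.
  intros Ha Hb.
  assert (G : is_derivC (fun s => z + RtoC s) 0 1).
  { apply (is_derivC_eq _ _ (0 + 1)); [ring|]. apply is_derivC_plus; [apply is_derivC_const | apply is_derivC_id]. }
  assert (E : z + RtoC 0 = z) by ring.
  replace a with (a * 1) by ring. replace b with (b * 1) by ring.
  apply (is_derivC_unique (fun s => f (z + RtoC s)) 0);
    apply (is_derivC_comp f (fun s => z + RtoC s)); rewrite ?E; auto.
Qed.

(** * Integrals of complex-valued functions of a real variable *)
Definition is_RIntC (f : R -> C) (a b : R) (l : C) : Prop := is_RInt (V := C_R_NormedModule) f a b l.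
Definition RIntC (f : R -> C) (a b : R) : C := RInt (V := C_R_CompleteNormedModule) f a b.

Lemma is_RIntC_unique f a b l : is_RIntC f a b l -> RIntC f a b = l.
Proof. apply (is_RInt_unique (V := C_R_CompleteNormedModule)). Qed.

Lemma cont_RIntC f a b : (a <= b)%R ->
  (forall t, (a <= t <= b)%R -> clim (locally t) f (f t)) -> is_RIntC f a b (RIntC f a b).
Proof.
  intros Hab H. apply (RInt_correct (V := C_R_CompleteNormedModule)).
  apply (ex_RInt_continuous (V := C_R_CompleteNormedModule)).
  rewrite Rmin_left, Rmax_right by lra. intros t Ht. apply continuousC. auto.
Qed.

Lemma is_RIntC_Re f a b l : is_RIntC f a b l -> is_RInt (fun t => Re (f t)) a b (Re l).
Proof. apply (is_RInt_fct_extend_fst (U := R_NormedModule) (V := R_NormedModule)). Qed.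

Lemma is_RIntC_Im f a b l : is_RIntC f a b l -> is_RInt (fun t => Im (f t)) a b (Im l).
Proof. apply (is_RInt_fct_extend_snd (U := R_NormedModule) (V := R_NormedModule)). Qed.

Lemma is_RIntC_pair f a b x y :
  is_RInt (fun t => Re (f t)) a b x -> is_RInt (fun t => Im (f t)) a b y -> is_RIntC f a b (x, y).
Proof. apply (is_RInt_fct_extend_pair (U := R_NormedModule) (V := R_NormedModule)). Qed.

Lemma is_RIntC_plus f g a b x y :
  is_RIntC f a b x -> is_RIntC g a b y -> is_RIntC (fun t => f t + g t) a b (x + y).
Proof. apply (is_RInt_plus (V := C_R_NormedModule)). Qed.

Lemma is_RIntC_mult (k : C) f a b x :
  is_RIntC f a b x -> is_RIntC (fun t => k * f t) a b (k * x).
Proof.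
  intros H. assert (H1 := is_RIntC_Re _ _ _ _ H). assert (H2 := is_RIntC_Im _ _ _ _ H).
  apply is_RIntC_pair.
  - apply (is_RInt_minus (V := R_NormedModule) (fun t => scal (Re k) (Re (f t))) (fun t => scal (Im k) (Im (f t))));
      now apply (is_RInt_scal (V := R_NormedModule)).
  - apply (is_RInt_plus (V := R_NormedModule) (fun t => scal (Re k) (Im (f t))) (fun t => scal (Im k) (Re (f t))));
      now apply (is_RInt_scal (V := R_NormedModule)).
Qed.

Lemma RIntC_scal (k : C) f a b : (a <= b)%R ->
  (forall t, (a <= t <= b)%R -> clim (locally t) f (f t)) ->
  RIntC (fun t => k * f t) a b = k * RIntC f a b.
Proof. intros Hab H. apply is_RIntC_unique, is_RIntC_mult. now apply cont_RIntC. Qed.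

Lemma RIntC_ext f g a b : (a <= b)%R -> (forall t, (a <= t <= b)%R -> f t = g t) -> RIntC f a b = RIntC g a b.
Proof.
  intros Hab H. apply (RInt_ext (V := C_R_CompleteNormedModule)).
  rewrite Rmin_left, Rmax_right by lra. intros t Ht. apply H. lra.
Qed.

Lemma RIntC_plus f g a b : (a <= b)%R ->
  (forall t, (a <= t <= b)%R -> clim (locally t) f (f t)) ->
  (forall t, (a <= t <= b)%R -> clim (locally t) g (g t)) ->
  RIntC (fun t => f t + g t) a b = RIntC f a b + RIntC g a b.
Proof. intros Hab H K. apply is_RIntC_unique, is_RIntC_plus; now apply cont_RIntC. Qed.

Lemma is_RIntC_const (k : C) : is_RIntC (fun _ => k) 0 1 k.
Proof.
  assert (H := is_RInt_const (V := C_R_NormedModule) 0 1 k).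
  rewrite scal_C_R in H. replace (RtoC (1 - 0) * k) with k in H; [exact H|].
  replace (1 - 0)%R with 1%R by ring. ring.
Qed.

Lemma RIntC_bound f a b l K : (a <= b)%R -> (forall t, (a <= t <= b)%R -> (Cmod (f t) <= K)%R) ->
  is_RIntC f a b l -> (Cmod l <= (b - a) * K)%R.
Proof.
  intros Hab H Hl. rewrite <- norm_C_R. apply (norm_RInt_le_const (V := C_R_NormedModule) f a b l K Hab); [|exact Hl].
  intros t Ht. rewrite norm_C_R. auto.
Qed.

(** * Differentiation under the integral sign *)

Lemma deriv_param_R (p p' : R -> R -> R) (x : R) :
  (exists e, (0 < e)%R /\ forall u t, (Rabs (u - x) < e)%R -> (0 <= t <= 1)%R ->
     is_derive (fun v => p v t) u (p' u t) /\ continuous (p u) t) ->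
  (forall t, (0 <= t <= 1)%R -> locally_2d (fun u t => is_derive (fun v => p v t) u (p' u t)) x t) ->
  (forall t, (0 <= t <= 1)%R -> continuity_2d_pt p' x t) ->
  is_derive (fun u => RInt (p u) 0 1) x (RInt (p' x) 0 1).
Proof.
  intros [e [He H]] H1 H2.
  replace (RInt (p' x) 0 1) with (RInt (fun t => Derive (fun u => p u t) x) 0 1).
  - apply is_derive_RInt_param; rewrite ?Rmin_left, ?Rmax_right by lra.
    + apply Rlocally_C. exists e. split; [exact He|]. intros u Hu t Ht.
      exists (p' u t). now apply H.
    + intros t Ht. apply (continuity_2d_pt_ext_loc p').
      * destruct (H1 t Ht) as [d Hd]. exists d. intros u v Hu Hv.
        symmetry. apply is_derive_unique. now apply Hd.
      * now apply H2.
    + apply Rlocally_C. exists e. split; [exact He|]. intros u Hu.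
      apply (ex_RInt_continuous (V := R_CompleteNormedModule)). rewrite ?Rmin_left, ?Rmax_right by lra. intros t Ht. now apply H.
  - apply RInt_ext. rewrite ?Rmin_left, ?Rmax_right by lra. intros t Ht.
    apply is_derive_unique. apply (H x t); [|lra].
    replace (x - x)%R with 0%R by ring. now rewrite Rabs_R0.
Qed.

Lemma is_derivC_pair (f : R -> C) t a :
  is_derive (fun s => Re (f s)) t (Re a) -> is_derive (fun s => Im (f s)) t (Im a) -> is_derivC f t a.
Proof.
  intros H1 H2. apply is_derivC_RtoC in H1. apply is_derivC_RtoC in H2.
  assert (E : forall z : C, RtoC (Re z) + Ci * RtoC (Im z) = z).
  { intros [x y]. unfold RtoC, Ci, Cplus, Cmult, Re, Im; simpl. f_equal; ring. }
  apply (is_derive_ext (V := C_R_NormedModule) (fun s => RtoC (Re (f s)) + Ci * RtoC (Im (f s)))).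
  - intros s. apply E.
  - apply (is_derivC_eq _ _ (RtoC (Re a) + (0 * RtoC (Im (f t)) + Ci * RtoC (Im a)))).
    + transitivity (RtoC (Re a) + Ci * RtoC (Im a)); [ring | apply E].
    + apply is_derivC_plus; [exact H1|]. apply (is_derivC_mult (fun _ => Ci) (fun s => RtoC (Im (f s)))); [apply is_derivC_const | exact H2].
Qed.

Lemma clim_Re {T} (F : (T -> Prop) -> Prop) {FF : Filter F} (f : T -> C) l :
  clim F f l -> filterlim (fun x => Re (f x)) F (locally (Re l)).
Proof.
  intros H P [e HP]. change (F (fun x => P (Re (f x)))). generalize (H e (cond_pos e)).
  apply filter_imp. intros x K. apply HP. change (Rabs (Re (f x) - Re l) < e)%R.
  eapply Rle_lt_trans; [|exact K].
  replace (Re (f x) - Re l)%R with (Re (f x - l)) by (unfold Re; simpl; ring). apply re_le_Cmod.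
Qed.

Lemma clim_Im {T} (F : (T -> Prop) -> Prop) {FF : Filter F} (f : T -> C) l :
  clim F f l -> filterlim (fun x => Im (f x)) F (locally (Im l)).
Proof.
  intros H P [e HP]. change (F (fun x => P (Im (f x)))). generalize (H e (cond_pos e)).
  apply filter_imp. intros x K. apply HP. change (Rabs (Im (f x) - Im l) < e)%R.
  eapply Rle_lt_trans; [|exact K].
  replace (Im (f x) - Im l)%R with (Im (f x - l)) by (unfold Im; simpl; ring).
  eapply Rle_trans; [apply Rmax_r | apply Rmax_Cmod].
Qed.

(** The derivative has to be known on a neighbourhood of (x, t) in the plane,
    also when t is an end point of [0, 1], because the continuity required by
    the real statement is that of a function of two free variables. *)
Lemma deriv_param_C (k k' : R -> R -> C) (x : R) :
  (exists e, (0 < e)%R /\ forall u t, (Rabs (u - x) < e)%R -> (0 <= t <= 1)%R ->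
     is_derivC (fun v => k v t) u (k' u t) /\ clim (locally t) (k u) (k u t)) ->
  (forall t, (0 <= t <= 1)%R -> locally (x, t)
     (fun ut => is_derivC (fun v => k v (snd ut)) (fst ut) (k' (fst ut) (snd ut)))) ->
  (forall t, (0 <= t <= 1)%R -> clim (locally (x, t)) (fun ut => k' (fst ut) (snd ut)) (k' x t)) ->
  is_derivC (fun u => RIntC (k u) 0 1) x (RIntC (k' x) 0 1).
Proof.
  intros [e [He H]] H1 H2.
  assert (Hx : (Rabs (x - x) < e)%R) by (replace (x - x)%R with 0%R by ring; now rewrite Rabs_R0).
  assert (I : forall u, (Rabs (u - x) < e)%R -> is_RIntC (k u) 0 1 (RIntC (k u) 0 1)).
  { intros u Hu. apply cont_RIntC; [lra|]. intros t Ht. now apply H. }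
  assert (I' : is_RIntC (k' x) 0 1 (RIntC (k' x) 0 1)).
  { apply cont_RIntC; [lra|]. intros t Ht eps Heps.
    destruct (H2 t Ht eps Heps) as [d Hd]. exists d. intros s Hs.
    apply (Hd (x, s)). split; [apply ball_center | exact Hs]. }
  apply is_derivC_pair.
  - apply (is_derive_ext_loc (fun u => RInt (fun t => Re (k u t)) 0 1)).
    + apply Rlocally_C. exists e. split; [exact He|]. intros u Hu.
      apply is_RInt_unique. apply is_RIntC_Re. auto.
    + replace (Re (RIntC (k' x) 0 1)) with (RInt (fun t => Re (k' x t)) 0 1)
        by (apply is_RInt_unique; now apply is_RIntC_Re).
      apply (deriv_param_R (fun u t => Re (k u t)) (fun u t => Re (k' u t))).
      * exists e. split; [exact He|]. intros u t Hu Ht. destruct (H u t Hu Ht) as [A B]. split.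
        -- now apply is_derivC_Re in A.
        -- now apply clim_Re in B; [|apply locally_filter].
      * intros t Ht. apply locally_2d_locally. generalize (H1 t Ht). apply filter_imp.
        intros [u v] A. now apply is_derivC_Re in A.
      * intros t Ht. apply continuity_2d_pt_filterlim.
        apply (clim_Re (locally (x, t)) (fun ut => k' (fst ut) (snd ut))). auto.
  - apply (is_derive_ext_loc (fun u => RInt (fun t => Im (k u t)) 0 1)).
    + apply Rlocally_C. exists e. split; [exact He|]. intros u Hu.
      apply is_RInt_unique. apply is_RIntC_Im. auto.
    + replace (Im (RIntC (k' x) 0 1)) with (RInt (fun t => Im (k' x t)) 0 1)
        by (apply is_RInt_unique; now apply is_RIntC_Im).
      apply (deriv_param_R (fun u t => Im (k u t)) (fun u t => Im (k' u t))).
      * exists e. split; [exact He|]. intros u t Hu Ht. destruct (H u t Hu Ht) as [A B]. split.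
        -- now apply is_derivC_Im in A.
        -- now apply clim_Im in B; [|apply locally_filter].
      * intros t Ht. apply locally_2d_locally. generalize (H1 t Ht). apply filter_imp.
        intros [u v] A. now apply is_derivC_Im in A.
      * intros t Ht. apply continuity_2d_pt_filterlim.
        apply (clim_Im (locally (x, t)) (fun ut => k' (fst ut) (snd ut))). auto.
Qed.

(** * Primitives on star-shaped domains *)

Definition prim (f : C -> C) (w : C) : C := RIntC (fun s => w * f (RtoC s * w)) 0 1.

Definition copen (D : C -> Prop) : Prop := forall z, D z -> cnear z D.
Definition star (D : C -> Prop) : Prop :=
  forall z s, D z -> (0 <= s <= 1)%R -> D (RtoC s * z).

Section Prim.
Variables (D : C -> Prop) (f : C -> C).
Hypotheses (Dopen : copen D) (Dstar : star D) (Hf : holo D f).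

Lemma ray_cont w s : D w -> (0 <= s <= 1)%R ->
  clim (locally s) (fun s => w * f (RtoC s * w)) (w * f (RtoC s * w)).
Proof.
  intros Hw Hs. apply clim_mult; [apply clim_const|].
  apply (clim_ccont (fun s => RtoC s * w) f).
  - apply clim_mult; [apply clim_RtoC | apply clim_const].
  - apply (holo_cont D); [exact Hf | now apply Dstar].
Qed.

(** Cauchy's theorem for the triangle 0, z, z + h.  Along u -> z + u h the
    u-derivative of the integrand of [prim] is an s-derivative, namely that of
    s h f(s (z + u h)), so that the derivative of [prim] along the segment is
    the boundary term at s = 1. *)
Lemma prim_segment z h : (forall u, (0 <= u <= 1)%R -> D (z + RtoC u * h)) ->
  is_RIntC (fun u => h * f (z + RtoC u * h)) 0 1 (prim f (z + h) - prim f z).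
Proof.
  intros Hz.
  assert (Hf0 := Hf). destruct Hf0 as [f' Hf'].
  set (g := fun u : R => z + RtoC u * h).
  assert (Cg : forall u, is_derivC g u h).
  { intros u. apply (is_derivC_eq _ _ (0 + (1 * h + RtoC u * 0))); [ring|].
    apply is_derivC_plus; [apply is_derivC_const|]. apply is_derivC_mult; [|apply is_derivC_const].
    apply (is_derivC_RtoC (fun u => u)). apply (is_derive_id (K := R_AbsRing)). }
  set (k := fun u s : R => g u * f (RtoC s * g u)).
  set (k' := fun u s : R => h * f (RtoC s * g u) + g u * (f' (RtoC s * g u) * (RtoC s * h))).
  assert (Ck : forall u s, D (RtoC s * g u) -> is_derivC (fun v => k v s) u (k' u s)).
  { intros u s HD. apply (is_derivC_mult g (fun v => f (RtoC s * g v))); [apply Cg|].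
    apply (is_derivC_comp f (fun v => RtoC s * g v)); [now apply Hf'|].
    apply (is_derivC_eq _ _ (0 * g u + RtoC s * h)); [ring|].
    apply (is_derivC_mult (fun _ => RtoC s) g); [apply is_derivC_const | apply Cg]. }
  assert (L2 : forall u s, clim (locally (u, s)) (fun ut : R * R => RtoC (snd ut) * g (fst ut)) (RtoC s * g u)).
  { intros u s. apply clim_mult.
    - intros e He. exists (mkposreal e He). intros [a b] [_ Hb]. simpl in *.
      rewrite <- RtoC_minus, Cmod_R. exact Hb.
    - intros e He. destruct (is_derivC_cont _ _ _ (Cg u) e He) as [d Hd].
      exists d. intros [a b] [Ha _]. now apply Hd. }
  assert (P : forall u, (0 <= u <= 1)%R -> is_derivC (fun v => prim f (g v)) u (h * f (g u))).
  { intros u Hu. 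
    replace (h * f (g u)) with (RIntC (k' u) 0 1).
    - apply (deriv_param_C k k').
      + destruct (clim_cnear g D _ (is_derivC_cont _ _ _ (Cg u)) (Dopen _ (Hz u Hu))) as [e He].
        exists e. split; [apply cond_pos|]. intros v t Hv Ht. split.
        * apply Ck. apply Dstar; [now apply He | exact Ht].
        * unfold k. apply ray_cont; [now apply He | exact Ht].
      + intros t Ht. generalize (clim_cnear _ D _ (L2 u t) (Dopen _ (Dstar _ t (Hz u Hu) Ht))).
        apply filter_imp. intros [v s]. apply Ck.
      + intros t Ht. assert (Du := Dstar _ t (Hz u Hu) Ht). 
        assert (Lg : clim (locally (u, t)) (fun ut : R * R => g (fst ut)) (g u)).
        { intros e He. destruct (is_derivC_cont _ _ _ (Cg u) e He) as [d Hd].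
          exists d. intros [a b] [Ha _]. now apply Hd. }
        apply clim_plus; apply clim_mult; [apply clim_const| |exact Lg|apply clim_mult].
        * apply (clim_ccont _ f _ (L2 u t)). now apply (holo_cont D).
        * apply (clim_ccont _ f' _ (L2 u t)). now apply Hf'.
        * apply clim_mult; [|apply clim_const].
          intros e He. exists (mkposreal e He). intros [a b] [_ Hb]. simpl in *.
          rewrite <- RtoC_minus, Cmod_R. exact Hb.
    - apply is_RIntC_unique.
      replace (h * f (g u)) with (RtoC 1 * (h * f (RtoC 1 * g u)) - RtoC 0 * (h * f (RtoC 0 * g u)))
        by (rewrite !Cmult_1_l; ring).
      assert (Ds : forall s, (0 <= s <= 1)%R -> is_derivC (fun s => RtoC s * g u) s (g u)).
      { intros s Hs. apply (is_derivC_eq _ _ (1 * g u + RtoC s * 0)); [ring|].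
        apply (is_derivC_mult (fun s => RtoC s) (fun _ => g u)); [|apply is_derivC_const].
        apply (is_derivC_RtoC (fun u => u)). apply (is_derive_id (K := R_AbsRing)). }
      apply (RInt_C_derive (fun s => RtoC s * (h * f (RtoC s * g u))) (k' u)); [lra| |].
      + intros s Hs. assert (Du := Dstar _ s (Hz u Hu) Hs).
        apply (is_derivC_eq _ _ (1 * (h * f (RtoC s * g u)) + RtoC s * (0 * f (RtoC s * g u) + h * (f' (RtoC s * g u) * g u)))).
        { unfold k'. ring. }
        apply (is_derivC_mult (fun s => RtoC s) (fun s => h * f (RtoC s * g u))); [apply (is_derivC_RtoC (fun u => u)); apply (is_derive_id (K := R_AbsRing))|].
        apply (is_derivC_mult (fun _ => h) (fun s => f (RtoC s * g u))); [apply is_derivC_const|].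
        apply (is_derivC_comp f (fun s => RtoC s * g u)); [now apply Hf' | now apply Ds].
      + intros s Hs. assert (Du := Dstar _ s (Hz u Hu) Hs).
        assert (Cs := is_derivC_cont _ _ _ (Ds s Hs)).
        apply clim_plus; apply clim_mult; try apply clim_const; [|apply clim_mult].
        * apply (clim_ccont _ f _ Cs). now apply (holo_cont D).
        * apply (clim_ccont _ f' _ Cs). now apply Hf'.
        * apply clim_mult; [apply clim_RtoC | apply clim_const]. }
  replace (prim f (z + h) - prim f z) with (prim f (g 1%R) - prim f (g 0%R)).
  2:{ unfold g. f_equal; [f_equal; ring | f_equal; f_equal; ring]. }
  apply (RInt_C_derive (fun u => prim f (g u))); [lra | exact P |].
  intros u Hu. apply clim_mult; [apply clim_const|].
  apply (clim_ccont g f); [exact (is_derivC_cont _ _ _ (Cg u))|]. apply (holo_cont D); auto.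
Qed.

(** By [prim_segment] the difference quotient of [prim] at z is the mean of f
    over the segment from z to u, which tends to f(z). *)
Theorem prim_deriv z : D z -> cderiv (prim f) z (f z).
Proof.
  intros Hz.
  set (phi := fun u => RIntC (fun t => f (z + RtoC t * (u - z))) 0 1).
  destruct (Dopen z Hz) as [d [Hd HD]].
  assert (Seg : forall u t, (Cmod (u - z) < d)%R -> (0 <= t <= 1)%R ->
     (Cmod (z + RtoC t * (u - z) - z) <= Cmod (u - z))%R).
  { intros u t Hu Ht. replace (z + RtoC t * (u - z) - z) with (RtoC t * (u - z)) by ring.
    rewrite Cmod_mult, Cmod_R, Rabs_right by lra. generalize (Cmod_ge_0 (u - z)). nra. }
  assert (Cs : forall u t, (Cmod (u - z) < d)%R -> (0 <= t <= 1)%R ->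
     clim (locally t) (fun t => f (z + RtoC t * (u - z))) (f (z + RtoC t * (u - z)))).
  { intros u t Hu Ht. apply (clim_ccont (fun t => z + RtoC t * (u - z)) f).
    - apply clim_plus; [apply clim_const|]. apply clim_mult; [apply clim_RtoC | apply clim_const].
    - apply (holo_cont D); [exact Hf|]. apply HD. eapply Rle_lt_trans; [now apply Seg | exact Hu]. }
  assert (E0 : phi z = f z).
  { unfold phi. transitivity (RIntC (fun _ => f z) 0 1).
    - apply RIntC_ext; [lra|]. intros t _. f_equal. ring.
    - apply is_RIntC_unique, is_RIntC_const. }
  exists phi. split; [|split; [exact E0|]].
  - exists d. split; [exact Hd|]. intros u Hu.
    assert (P : is_RIntC (fun t => (u - z) * f (z + RtoC t * (u - z))) 0 1 (prim f (z + (u - z)) - prim f z)).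
    { apply prim_segment. intros t Ht. apply HD. eapply Rle_lt_trans; [now apply Seg | exact Hu]. }
    apply is_RIntC_unique in P. rewrite RIntC_scal in P by (lra || (intros; now apply Cs)).
    replace (z + (u - z)) with u in P by ring. rewrite <- P. unfold phi. ring.
  - intros eps He. assert (He2 : (0 < eps / 2)%R) by lra.
    destruct (holo_cont D f z Hf Hz _ He2) as [d' [Hd' K]].
    exists (Rmin d d'). split; [now apply Rmin_glb_lt|]. intros u Hu.
    assert (Hu1 : (Cmod (u - z) < d)%R) by (eapply Rlt_le_trans; [exact Hu | apply Rmin_l]).
    assert (Hu2 : (Cmod (u - z) < d')%R) by (eapply Rlt_le_trans; [exact Hu | apply Rmin_r]).
    rewrite E0.
    assert (I : is_RIntC (fun t => f (z + RtoC t * (u - z)) + - f z) 0 1 (phi u + - f z)).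
    { apply is_RIntC_plus; [apply cont_RIntC; [lra|]; intros; now apply Cs|].
      apply is_RIntC_const. }
    apply (RIntC_bound _ _ _ _ (eps / 2)) in I; [|lra|].
    + change (phi u - f z) with (phi u + - f z). lra.
    + intros t Ht. left. apply K. eapply Rle_lt_trans; [now apply Seg | exact Hu2].
Qed.

Lemma prim_holo : holo D (prim f).
Proof. exists f. intros z Hz. split; [now apply prim_deriv | now apply (holo_cont D)]. Qed.
End Prim.

Lemma prim_0 f : prim f 0 = 0.
Proof.
  unfold prim. transitivity (RIntC (fun _ => 0) 0 1).
  - apply RIntC_ext; [lra|]. intros t _. ring.
  - apply is_RIntC_unique, is_RIntC_const.
Qed.

Lemma zero_deriv_const (D : C -> Prop) (f : C -> C) m z :
  (forall s, (0 <= s <= 1)%R -> D (m + RtoC s * (z - m))) ->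
  (forall u, D u -> cderiv f u 0) -> f z = f m.
Proof.
  intros HD Hf.
  replace z with (m + RtoC 1 * (z - m)) at 1 by ring.
  replace m with (m + RtoC 0 * (z - m)) at 3 by ring.
  apply (zero_deriv_C (fun s => f (m + RtoC s * (z - m))) 0 1); [lra|].
  intros t Ht. apply (is_derivC_eq _ _ (0 * (0 + (1 * (z - m) + RtoC t * 0)))); [ring|].
  apply (is_derivC_comp f (fun s => m + RtoC s * (z - m))); [now apply Hf, HD|].
  apply is_derivC_plus; [apply is_derivC_const|].
  apply (is_derivC_mult (fun s => RtoC s) (fun _ => z - m)); [|apply is_derivC_const].
  apply (is_derivC_RtoC (fun u => u)). apply (is_derive_id (K := R_AbsRing)).
Qed.

(** * The principal square root *)

(** The branch with nonnegative real part; negative reals are sent to the upper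
    half of the imaginary axis, which makes it continuous on the closed upper
    half-plane. *)
Definition csqrt (z : C) : C :=
  (sqrt ((Cmod z + Re z) / 2),
   (if Rle_dec 0 (Im z) then 1 else -1) * sqrt ((Cmod z - Re z) / 2))%R.

Lemma Re_le_mod z : (Rabs (Re z) <= Cmod z)%R.
Proof. apply re_le_Cmod. Qed.

Lemma csqrt_sq z : csqrt z * csqrt z = z.
Proof.
  assert (H := Re_le_mod z). assert (A : (-Cmod z <= Re z <= Cmod z)%R) by (split_Rabs; lra).
  assert (M : (Cmod z * Cmod z = Re z * Re z + Im z * Im z)%R).
  { unfold Cmod. rewrite sqrt_sqrt by (generalize (pow2_ge_0 (fst z)) (pow2_ge_0 (snd z)); lra).
    unfold Re, Im. ring. }
  assert (S1 := sqrt_sqrt ((Cmod z + Re z) / 2) ltac:(lra)).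
  assert (S2 := sqrt_sqrt ((Cmod z - Re z) / 2) ltac:(lra)).
  assert (S3 : (sqrt ((Cmod z + Re z) / 2) * sqrt ((Cmod z - Re z) / 2) = Rabs (Im z) / 2)%R).
  { rewrite <- sqrt_mult by lra.
    replace ((Cmod z + Re z) / 2 * ((Cmod z - Re z) / 2))%R with (Rsqr (Im z / 2)).
    - rewrite sqrt_Rsqr_abs. unfold Rdiv. rewrite Rabs_mult, (Rabs_right (/ 2)) by lra. reflexivity.
    - unfold Rsqr. nra. }
  unfold csqrt. set (a := sqrt ((Cmod z + Re z) / 2)) in *. set (b := sqrt ((Cmod z - Re z) / 2)) in *.
  rewrite (surjective_pairing z) at 3. unfold Cmult; simpl.
  change (fst z) with (Re z). change (snd z) with (Im z).
  destruct (Rle_dec 0 (Im z)) as [P|P].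
  - rewrite Rabs_right in S3 by lra. f_equal; nra.
  - rewrite Rabs_left in S3 by lra. f_equal; nra.
Qed.

Lemma csqrt_Re_ge0 z : (0 <= Re (csqrt z))%R.
Proof. apply sqrt_pos. Qed.

(** The plane without the closed negative half-axis, where [csqrt] is
    holomorphic. *)
Definition slit (z : C) : Prop := Im z <> 0%R \/ (0 < Re z)%R.

Lemma csqrt_Re_pos z : slit z -> (0 < Re (csqrt z))%R.
Proof.
  intros H. apply sqrt_lt_R0.
  assert (A := Re_le_mod z). 
  assert (M : (Cmod z * Cmod z = Re z * Re z + Im z * Im z)%R).
  { unfold Cmod. rewrite sqrt_sqrt by (generalize (pow2_ge_0 (fst z)) (pow2_ge_0 (snd z)); lra).
    unfold Re, Im. ring. }
  destruct H as [H|H]; [|split_Rabs; lra].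
  assert (0 < Im z * Im z)%R by nra.
  assert (- Re z < Cmod z)%R; [|lra]. generalize (Cmod_ge_0 z). nra.
Qed.

Lemma csqrt_Im_ge0 z : (0 <= Im z)%R -> (0 <= Im (csqrt z))%R.
Proof.
  intros H. unfold csqrt, Im at 1; simpl. destruct (Rle_dec 0 (Im z)); [|lra].
  generalize (sqrt_pos ((Cmod z - Re z) / 2)). lra.
Qed.

Lemma csqrt_Im_le0 z : (Im z < 0)%R -> (Im (csqrt z) <= 0)%R.
Proof.
  intros H. unfold csqrt, Im at 1; simpl. destruct (Rle_dec 0 (Im z)); [lra|].
  generalize (sqrt_pos ((Cmod z - Re z) / 2)). lra.
Qed.

Lemma slit_neq0 z : slit z -> z <> 0.
Proof. intros [H|H] ->; unfold Re, Im in H; simpl in H; lra. Qed.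

Lemma csqrt_neq0 (z : C) : z <> 0 -> csqrt z <> 0.
Proof. intros H E. apply H. rewrite <- (csqrt_sq z), E. ring. Qed.

Lemma sq_eq (a b : C) : a * a = b * b -> a = b \/ a = - b.
Proof.
  intros H. assert (E : (a - b) * (a + b) = 0) by (transitivity (a * a - b * b); [ring | rewrite H; ring]).
  destruct (Ceq_dec (a - b) 0) as [K|K].
  - left. replace a with (a - b + b) by ring. rewrite K. ring.
  - right. destruct (Ceq_dec (a + b) 0) as [L|L].
    + replace a with (a + b - b) by ring. rewrite L. ring.
    + exfalso. now apply (Cmult_neq_0 _ _ K L).
Qed.

Lemma csqrt_uniq_quadrant a z : (0 <= Re a)%R -> (0 <= Im a)%R -> (0 <= Im z)%R -> a * a = z -> csqrt z = a.
Proof.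
  intros P Q N E. assert (G := csqrt_Re_ge0 z). assert (G' := csqrt_Im_ge0 z N).
  destruct (sq_eq (csqrt z) a) as [H|H].
  - now rewrite csqrt_sq.
  - exact H.
  - rewrite H in *. destruct a as [x y]. unfold Re, Im, Copp in *; simpl in *.
    assert (x = 0%R) by lra. assert (y = 0%R) by lra. subst. f_equal; ring.
Qed.

Lemma csqrt_R x : (0 <= x)%R -> csqrt (RtoC x) = RtoC (sqrt x).
Proof.
  intros H. apply csqrt_uniq_quadrant; try (unfold Re, Im; simpl; lra); [apply sqrt_pos|].
  rewrite <- RtoC_mult. now rewrite sqrt_sqrt.
Qed.

(** Both sides are square roots of u lying in the closed first quadrant.  This
    makes the two families of branches used below agree on the upper
    half-plane. *)
Lemma csqrt_opp u : (0 <= Im u)%R -> (Im u <> 0 \/ Re u <= 0)%R -> Ci * csqrt (- u) = csqrt u.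
Proof.
  intros H K. symmetry. apply csqrt_uniq_quadrant; [| |exact H|].
  - replace (Re (Ci * csqrt (- u))) with (- Im (csqrt (- u)))%R
      by (destruct (csqrt (- u)); unfold Re, Im, Ci; simpl; ring).
    destruct (Req_dec (Im u) 0) as [E|E].
    + destruct K as [K|K]; [lra|].
      replace (- u) with (RtoC (- Re u)).
      * rewrite csqrt_R by lra. unfold Im; simpl. lra.
      * destruct u as [x y]. unfold Re, Im, RtoC, Copp in *; simpl in *. rewrite E. f_equal. ring.
    + assert (Im (csqrt (- u)) <= 0)%R; [|lra]. apply csqrt_Im_le0. unfold Im, Copp in *; simpl. lra.
  - replace (Im (Ci * csqrt (- u))) with (Re (csqrt (- u)))
      by (destruct (csqrt (- u)); unfold Re, Im, Ci; simpl; ring).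
    apply csqrt_Re_ge0.
  - transitivity ((Ci * Ci) * (csqrt (- u) * csqrt (- u))); [ring|].
    rewrite csqrt_sq. replace (Ci * Ci) with (- (RtoC 1)).
    + ring.
    + unfold Ci, Cmult, Copp, RtoC; simpl. f_equal; ring.
Qed.

Lemma copen_slit : copen slit.
Proof.
  intros z [H|H].
  - exists (Rabs (Im z)). split; [now apply Rabs_pos_lt|]. intros u Hu. left. intros E.
    assert (Rabs (Im (u - z)) <= Cmod (u - z))%R by (eapply Rle_trans; [apply Rmax_r | apply Rmax_Cmod]).
    replace (Im (u - z)) with (- Im z)%R in H0 by (unfold Im in *; simpl; lra).
    rewrite Rabs_Ropp in H0. lra.
  - exists (Re z). split; [exact H|]. intros u Hu. right.
    assert (A := Re_le_mod (u - z)). replace (Re (u - z)) with (Re u - Re z)%R in A by (unfold Re; simpl; ring).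
    split_Rabs; lra.
Qed.

(** The sum of two values of the root has a real part bounded below, so the
    difference of the values is controlled by the difference of the squares. *)
Lemma csqrt_cont z : slit z -> ccont csqrt z.
Proof.
  intros Hz. assert (P := csqrt_Re_pos z Hz). intros e He.
  exists (e * Re (csqrt z))%R. split; [now apply Rmult_lt_0_compat|]. intros u Hu.
  assert (E : (csqrt u - csqrt z) * (csqrt u + csqrt z) = u - z).
  { transitivity (csqrt u * csqrt u - csqrt z * csqrt z); [ring | now rewrite !csqrt_sq]. }
  assert (B : (Re (csqrt z) <= Cmod (csqrt u + csqrt z))%R).
  { eapply Rle_trans; [|eapply Rle_trans; [apply Rle_abs | apply Re_le_mod]].
    generalize (csqrt_Re_ge0 u). unfold Re; simpl. lra. }
  apply (f_equal Cmod) in E. rewrite Cmod_mult in E.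
  generalize (Cmod_ge_0 (csqrt u - csqrt z)). nra.
Qed.

Lemma csqrt_deriv z : slit z -> cderiv csqrt z (/ (2 * csqrt z)).
Proof.
  intros Hz. assert (P := csqrt_Re_pos z Hz).
  assert (N : forall u, csqrt u + csqrt z <> 0).
  { intros u E. generalize (csqrt_Re_ge0 u). apply (f_equal Re) in E. unfold Re in *; simpl in *. lra. }
  exists (fun u => / (csqrt u + csqrt z)). split; [|split].
  - apply filter_forall. intros u. replace (u - z) with ((csqrt u - csqrt z) * (csqrt u + csqrt z)).
    + field. apply N.
    + transitivity (csqrt u * csqrt u - csqrt z * csqrt z); [ring | now rewrite !csqrt_sq].
  - f_equal. ring.
  - apply clim_inv; [apply N|]. apply clim_plus; [now apply csqrt_cont | apply clim_const].
Qed.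

Lemma csqrt_holo : holo slit csqrt.
Proof.
  exists (fun z => / (2 * csqrt z)). intros z Hz. split; [now apply csqrt_deriv|].
  apply clim_inv.
  - apply Cmult_neq_0; [|now apply csqrt_neq0, slit_neq0]. intros E. apply RtoC_inj in E. lra.
  - apply clim_mult; [apply clim_const | now apply csqrt_cont].
Qed.

Lemma slit_segment (a : R) u s : (0 < a)%R -> slit u -> (0 <= s <= 1)%R ->
  slit (RtoC a + RtoC s * (u - RtoC a)).
Proof.
  intros Ha Hu Hs. unfold slit in *. destruct u as [x y]. unfold Re, Im, RtoC in *; simpl in *.
  destruct (Req_dec y 0) as [->|Ny].
  - right. destruct Hu; [lra|]. nra.
  - destruct (Req_dec s 0) as [->|Ns]; [right; lra|]. left. 
    replace (0 + (s * (y + - 0) + 0 * (x + - a)))%R with (s * y)%R by ring. nra.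
Qed.

(** * Products over the branch points *)

Fixpoint cprod (g : nat -> C) (l : list nat) : C :=
  match l with nil => 1 | k :: l' => g k * cprod g l' end.

Lemma cprod_ext g h l : (forall k, In k l -> g k = h k) -> cprod g l = cprod h l.
Proof.
  induction l as [|a l IH]; intros H; simpl; [reflexivity|].
  rewrite H by now left. rewrite IH; [reflexivity|]. intros k Hk. apply H. now right.
Qed.

Lemma cprod_mult g h l : cprod (fun k => g k * h k) l = cprod g l * cprod h l.
Proof. induction l as [|a l IH]; simpl; [ring | rewrite IH; ring]. Qed.

Lemma cprod_neq0 (g : nat -> C) l : (forall k, In k l -> g k <> 0) -> cprod g l <> 0.
Proof.
  induction l as [|a l IH]; intros H; simpl.
  - intros E. apply RtoC_inj in E. lra.
  - apply Cmult_neq_0; [apply H; now left | apply IH; intros; apply H; now right].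
Qed.

Lemma cprod_pull g l j : NoDup l -> In j l ->
  cprod g l = g j * cprod (fun k => if Nat.eqb k j then 1 else g k) l.
Proof.
  induction l as [|a l IH]; intros ND HI; [destruct HI|].
  inversion ND as [|? ? N ND']; subst. simpl. destruct (Nat.eqb_spec a j) as [->|Na].
  - rewrite Cmult_1_l. f_equal. apply cprod_ext. intros k Hk.
    destruct (Nat.eqb_spec k j); [subst; contradiction | reflexivity].
  - destruct HI as [E|HI]; [contradiction|]. rewrite (IH ND' HI). ring.
Qed.

Lemma holo_cprod (D : C -> Prop) (g : nat -> C -> C) l :
  (forall k, In k l -> holo D (g k)) -> holo D (fun z => cprod (fun k => g k z) l).
Proof.
  induction l as [|a l IH]; intros H; simpl; [apply holo_const|].
  apply (holo_mult D (g a)); [apply H; now left | apply IH; intros; apply H; now right].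
Qed.

Lemma monic_cprod c l z : monic_of_roots (map c l) z = cprod (fun k => z - RtoC (c k)) l.
Proof. induction l as [|a l IH]; simpl; [reflexivity | now rewrite IH]. Qed.

Lemma monic'_cprod c l j : NoDup l -> In j l ->
  monic_of_roots' (map c l) (RtoC (c j)) =
  cprod (fun k => if Nat.eqb k j then 1 else RtoC (c j) - RtoC (c k)) l.
Proof.
  induction l as [|a l IH]; intros ND HI; [destruct HI|].
  inversion ND as [|? ? N ND']; subst. simpl. destruct (Nat.eqb_spec a j) as [->|Na].
  - rewrite monic_cprod. replace (RtoC (c j) - RtoC (c j)) with (RtoC 0) by ring.
    rewrite Cmult_0_l, Cplus_0_r, Cmult_1_l. apply cprod_ext. intros k Hk.
    destruct (Nat.eqb_spec k j); [subst; contradiction | reflexivity].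
  - destruct HI as [E|HI]; [contradiction|]. rewrite (IH ND' HI).
    rewrite monic_cprod, (cprod_pull _ l j ND' HI).
    replace (RtoC (c j) - RtoC (c j)) with (RtoC 0) by ring. ring.
Qed.

Definition entire (f : C -> C) : Prop := holo (fun _ => True) f.

(** * Charts of the curve around the branch points *)

Section Charts.
(* Branch points are listed decreasingly from c 1 to c (2 d).  The interval
   number i is (c (i+1), c i): a band of the spectrum when i is odd, a gap when
   i is even. *)
Variables (d : nat) (c : nat -> R).
Hypothesis hc : forall j : nat, (1 <= j < 2 * d)%nat -> (c (S j) < c j)%R.

Notation idx := (seq 1 (2 * d)).

Lemma in_idx k : In k idx <-> (1 <= k <= 2 * d)%nat.
Proof. rewrite in_seq. lia. Qed.

Lemma c_decr j k : (1 <= j < k)%nat -> (k <= 2 * d)%nat -> (c k < c j)%R.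
Proof.
  intros [Hj Hjk]. induction k as [|k IH]; [lia|]. intros Hk.
  destruct (Nat.eq_dec j k) as [->|N]; [apply hc; lia|].
  apply Rlt_trans with (c k); [apply hc; lia | apply IH; lia].
Qed.

Lemma c_decr_le j k : (1 <= j <= k)%nat -> (k <= 2 * d)%nat -> (c k <= c j)%R.
Proof.
  intros Hj Hk. destruct (Nat.eq_dec j k) as [->|N]; [lra|]. left. apply c_decr; lia.
Qed.

(** A root of z - c_k, cut along the half-line to the right of c_k when b is
    true and along the half-line to its left otherwise.  Both agree on the
    upper half-plane. *)
Definition rt (b : bool) (k : nat) (z : C) : C :=
  if b then Ci * csqrt (RtoC (c k) - z) else csqrt (z - RtoC (c k)).
Definition rt_dom (b : bool) (k : nat) (z : C) : Prop :=
  if b then slit (RtoC (c k) - z) else slit (z - RtoC (c k)).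

Lemma Ci_sq : Ci * Ci = - (1).
Proof. unfold Ci, Cmult, Copp, RtoC; simpl. f_equal; ring. Qed.

Lemma rt_sq b k z : rt b k z * rt b k z = z - RtoC (c k).
Proof.
  destruct b; simpl; [|apply csqrt_sq].
  transitivity ((Ci * Ci) * (csqrt (RtoC (c k) - z) * csqrt (RtoC (c k) - z))); [ring|].
  rewrite csqrt_sq, Ci_sq. ring.
Qed.

Lemma Ci_neq0 : Ci <> 0.
Proof. intros E. apply (f_equal snd) in E. simpl in E. lra. Qed.

Lemma C2_neq0 : RtoC 2 <> 0.
Proof. intros E. apply RtoC_inj in E. lra. Qed.

Ltac cfield := field; repeat split; auto using C2_neq0, Ci_neq0.

Lemma rt_neq0 b k z : rt_dom b k z -> rt b k z <> 0.
Proof.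
  destruct b; simpl; intros H.
  - apply Cmult_neq_0; [apply Ci_neq0 | now apply csqrt_neq0, slit_neq0].
  - now apply csqrt_neq0, slit_neq0.
Qed.

Lemma rt_holo b k : holo (rt_dom b k) (rt b k).
Proof.
  destruct b; simpl.
  - apply (holo_mult _ (fun _ => Ci)); [apply holo_const|].
    apply (holo_comp _ slit csqrt (fun z => RtoC (c k) - z)); [auto | apply csqrt_holo |].
    apply holo_minus; [apply holo_const | apply holo_id].
  - apply (holo_comp _ slit csqrt (fun z => z - RtoC (c k))); [auto | apply csqrt_holo |].
    apply holo_minus; [apply holo_id | apply holo_const].
Qed.

(** Differentiate [rt_sq]. *)
Lemma rt_deriv b k z : rt_dom b k z -> cderiv (rt b k) z (/ (2 * rt b k z)).
Proof.
  intros Hz. destruct (rt_holo b k) as [r' Hr]. destruct (Hr z Hz) as [A _].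
  assert (N := rt_neq0 b k z Hz).
  assert (B := cderiv_mult _ _ _ _ _ A A).
  apply (cderiv_ext _ (fun u => u - RtoC (c k))) in B; [|intros; apply rt_sq].
  assert (E : r' z * rt b k z + rt b k z * r' z = 1).
  { apply (cderiv_unique _ _ _ _ B). apply (cderiv_eq _ _ (1 - 0)); [ring|].
    apply cderiv_minus; [apply cderiv_id | apply cderiv_const]. }
  apply (cderiv_eq _ _ (r' z)); [|exact A].
  replace (r' z) with ((r' z * rt b k z + rt b k z * r' z) / (2 * rt b k z)).
  - rewrite E. cfield.
  - cfield.
Qed.

Lemma rt_dom_open b k : copen (rt_dom b k).
Proof.
  intros z Hz. destruct b; simpl in *.
  - apply (clim_cnear (fun u => RtoC (c k) - u) slit (RtoC (c k) - z)); [|now apply copen_slit].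
    apply clim_minus; [apply clim_const | apply clim_id].
  - apply (clim_cnear (fun u => u - RtoC (c k)) slit (z - RtoC (c k))); [|now apply copen_slit].
    apply clim_minus; [apply clim_id | apply clim_const].
Qed.

(** Product of roots of z - c_k over the k not skipped, cut to the right of c_k
    for k <= i and to the left of c_k for k > i: it is holomorphic near the
    part of the real axis that lies between the two groups. *)
Definition rt_prod (skip : nat -> bool) (i : nat) (z : C) : C :=
  cprod (fun k => if skip k then 1 else rt (Nat.leb k i) k z) idx.
Definition rt_prod_dom (skip : nat -> bool) (i : nat) (z : C) : Prop :=
  forall k, (1 <= k <= 2 * d)%nat -> skip k = false -> rt_dom (Nat.leb k i) k z.

Lemma rt_prod_open skip i : copen (rt_prod_dom skip i).
Proof.
  intros z Hz.
  assert (P : forall l, (forall k, In k l -> In k idx) ->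
    cnear z (fun u => forall k, In k l -> skip k = false -> rt_dom (Nat.leb k i) k u)).
  { induction l as [|a l IH]; intros Hl.
    - apply filter_forall. intros u k [].
    - assert (A : cnear z (fun u => skip a = false -> rt_dom (Nat.leb a i) a u)).
      { destruct (skip a) eqn:E.
        - apply filter_forall. discriminate.
        - assert (Da : rt_dom (Nat.leb a i) a z) by (apply Hz; [apply in_idx, Hl; now left | exact E]).
          generalize (rt_dom_open _ _ z Da). apply filter_imp. auto. }
      assert (B := IH (fun k Hk => Hl k (or_intror Hk))).
      generalize (filter_and _ _ A B). apply filter_imp. intros u [K1 K2] k [->|Hk]; auto. }
  generalize (P idx (fun k Hk => Hk)). apply filter_imp. intros u Hu k Hk. apply Hu. now apply in_idx.
Qed.

Lemma rt_prod_holo skip i : holo (rt_prod_dom skip i) (rt_prod skip i).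
Proof.
  apply (holo_cprod _ (fun k z => if skip k then 1 else rt (Nat.leb k i) k z)).
  intros k Hk. destruct (skip k) eqn:E; [apply holo_const|].
  apply (holo_sub _ (rt_dom (Nat.leb k i) k)); [|apply rt_holo].
  intros z Hz. apply Hz; [now apply in_idx | exact E].
Qed.

Lemma rt_prod_neq0 skip i z : rt_prod_dom skip i z -> rt_prod skip i z <> 0.
Proof.
  intros Hz. apply cprod_neq0. intros k Hk. destruct (skip k) eqn:E.
  - intros E0. apply RtoC_inj in E0. lra.
  - apply rt_neq0, Hz; [now apply in_idx | exact E].
Qed.

Lemma rt_prod_sq skip i z : rt_prod skip i z * rt_prod skip i z =
  cprod (fun k => if skip k then 1 else z - RtoC (c k)) idx.
Proof.
  unfold rt_prod. rewrite <- cprod_mult. apply cprod_ext. intros k _.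
  destruct (skip k); [ring | apply rt_sq].
Qed.

Definition skip_none (k : nat) : bool := false.
Definition skip_one (j k : nat) : bool := Nat.eqb k j.
Definition skip_two (i k : nat) : bool := orb (Nat.eqb k i) (Nat.eqb k (S i)).

(** With Q the branch polynomial, the squares of the three roots are
    Q(z)/(z - c_j), Q(z) and Q(z)/((z - c_i)(z - c_{i+1})).  Their domains
    contain all nonreal numbers, and of the real axis the interval
    (c_{j+1}, c_{j-1}) around c_j, the interval (c_{i+1}, c_i), and the interval
    (c_{i+2}, c_{i-1}). *)
Definition chart_root j := rt_prod (skip_one j) j.
Definition chart_slit j := rt_prod_dom (skip_one j) j.
Definition interval_root i := rt_prod skip_none i.
Definition interval_slit i := rt_prod_dom skip_none i.
Definition oval_root i := rt_prod (skip_two i) i.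
Definition oval_slit i := rt_prod_dom (skip_two i) i.

Lemma interval_root_sq i z : interval_root i z * interval_root i z = branch_poly d c z.
Proof.
  unfold interval_root. rewrite rt_prod_sq. unfold branch_poly, branch_list. now rewrite monic_cprod.
Qed.

Lemma branch_poly_chart_root j z : (1 <= j <= 2 * d)%nat ->
  branch_poly d c z = (z - RtoC (c j)) * (chart_root j z * chart_root j z).
Proof.
  intros Hj. unfold chart_root. rewrite rt_prod_sq. unfold branch_poly, branch_list.
  rewrite monic_cprod. apply (cprod_pull (fun k => z - RtoC (c k))); [apply seq_NoDup | now apply in_idx].
Qed.

Lemma branch_poly'_chart_root j : (1 <= j <= 2 * d)%nat ->
  branch_poly' d c (RtoC (c j)) = chart_root j (RtoC (c j)) * chart_root j (RtoC (c j)).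
Proof.
  intros Hj. unfold chart_root. rewrite rt_prod_sq. unfold branch_poly', branch_list.
  apply monic'_cprod; [apply seq_NoDup | now apply in_idx].
Qed.

Lemma interval_root_left i z : (1 <= i <= 2 * d)%nat -> interval_root i z = rt true i z * chart_root i z.
Proof.
  intros Hi. unfold interval_root, chart_root, rt_prod.
  rewrite (cprod_pull _ idx i (seq_NoDup _ _)) by now apply in_idx.
  unfold skip_none, skip_one. rewrite Nat.leb_refl. reflexivity.
Qed.

Lemma interval_root_right i z : (S i <= 2 * d)%nat -> interval_root i z = rt false (S i) z * chart_root (S i) z.
Proof.
  intros Hi. unfold interval_root, chart_root, rt_prod.
  rewrite (cprod_pull _ idx (S i) (seq_NoDup _ _)) by (apply in_idx; lia).
  unfold skip_none, skip_one. replace (Nat.leb (S i) i) with false by (symmetry; apply Nat.leb_gt; lia). f_equal.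
  apply cprod_ext. intros k _. destruct (Nat.eqb_spec k (S i)) as [E|N]; [reflexivity|].
  f_equal. destruct (Nat.leb_spec k i), (Nat.leb_spec k (S i)); try reflexivity; lia.
Qed.

Lemma chart_root_oval_root_left i z : (S i <= 2 * d)%nat -> chart_root i z = rt false (S i) z * oval_root i z.
Proof.
  intros Hi. unfold oval_root, chart_root, rt_prod.
  rewrite (cprod_pull _ idx (S i) (seq_NoDup _ _)) by (apply in_idx; lia).
  unfold skip_one, skip_two. replace (Nat.eqb (S i) i) with false by (symmetry; apply Nat.eqb_neq; lia).
  replace (Nat.leb (S i) i) with false by (symmetry; apply Nat.leb_gt; lia). f_equal.
  apply cprod_ext. intros k _. destruct (Nat.eqb_spec k i), (Nat.eqb_spec k (S i)); reflexivity.
Qed.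

Lemma chart_root_oval_root_right i z : (1 <= i <= 2 * d)%nat -> chart_root (S i) z = rt true i z * oval_root i z.
Proof.
  intros Hi. unfold oval_root, chart_root, rt_prod.
  rewrite (cprod_pull _ idx i (seq_NoDup _ _)) by now apply in_idx.
  unfold skip_one, skip_two. replace (Nat.eqb i (S i)) with false by (symmetry; apply Nat.eqb_neq; lia).
  replace (Nat.leb i (S i)) with true by (symmetry; apply Nat.leb_le; lia). f_equal.
  apply cprod_ext. intros k _. destruct (Nat.eqb_spec k i), (Nat.eqb_spec k (S i)); try reflexivity.
  simpl. f_equal. destruct (Nat.leb_spec k i), (Nat.leb_spec k (S i)); try reflexivity; lia.
Qed.

Lemma interval_slit_chart_slit_left i z : interval_slit i z -> chart_slit i z.
Proof. intros H k Hk _. now apply H. Qed.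

Lemma interval_slit_chart_slit_right i z : interval_slit i z -> chart_slit (S i) z.
Proof.
  intros H k Hk E. generalize (H k Hk eq_refl). apply Nat.eqb_neq in E.
  destruct (Nat.leb_spec k i), (Nat.leb_spec k (S i)); try tauto; lia.
Qed.

Lemma chart_slit_interval_slit i z : (S i <= 2 * d)%nat -> (1 <= i)%nat -> chart_slit i z -> chart_slit (S i) z -> interval_slit i z.
Proof.
  intros Hi Hi' H1 H2 k Hk _. destruct (Nat.eq_dec k i) as [->|N].
  - assert (E : skip_one (S i) i = false) by (apply Nat.eqb_neq; lia). generalize (H2 i Hk E).
    destruct (Nat.leb_spec i i), (Nat.leb_spec i (S i)); try tauto; lia.
  - apply H1; [exact Hk | now apply Nat.eqb_neq].
Qed.

Lemma rt_dom_nonreal b k z : Im z <> 0%R -> rt_dom b k z.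
Proof.
  intros H. destruct b; left; unfold Im, RtoC in *; simpl; lra.
Qed.

Lemma rt_dom_R (b : bool) k x : (if b then x < c k else c k < x)%R -> rt_dom b k (RtoC x).
Proof. intros H. destruct b; right; unfold Re, RtoC in *; simpl; lra. Qed.

Lemma rt_dom_real (b : bool) k z : Im z = 0%R -> rt_dom b k z -> (if b then Re z < c k else c k < Re z)%R.
Proof.
  intros H K. destruct b; destruct K as [K|K]; unfold Im, Re, RtoC in *; simpl in *; lra.
Qed.

Lemma rt_prod_dom_nonreal skip i z : Im z <> 0%R -> rt_prod_dom skip i z.
Proof. intros H k _ _. now apply rt_dom_nonreal. Qed.

Lemma chart_slit_R j x : (1 <= j <= 2 * d)%nat ->
  ((2 <= j)%nat -> (x < c (j - 1)%nat)%R) -> ((j < 2 * d)%nat -> (c (S j) < x)%R) -> chart_slit j (RtoC x).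
Proof.
  intros Hj H1 H2 k Hk E. apply Nat.eqb_neq in E. apply rt_dom_R.
  destruct (Nat.leb_spec k j).
  - apply Rlt_le_trans with (c (j - 1)%nat); [apply H1; lia | apply c_decr_le; lia].
  - apply Rle_lt_trans with (c (S j)); [apply c_decr_le; lia | apply H2; lia].
Qed.

Lemma interval_slit_R i x : ((1 <= i)%nat -> (x < c i)%R) -> ((i < 2 * d)%nat -> (c (S i) < x)%R) ->
  (i <= 2 * d)%nat -> interval_slit i (RtoC x).
Proof.
  intros H1 H2 Hi k Hk _. apply rt_dom_R. destruct (Nat.leb_spec k i).
  - apply Rlt_le_trans with (c i); [apply H1; lia | apply c_decr_le; lia].
  - apply Rle_lt_trans with (c (S i)); [apply c_decr_le; lia | apply H2; lia].
Qed.

Lemma chart_slit_center j : (1 <= j <= 2 * d)%nat -> chart_slit j (RtoC (c j)).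
Proof. intros Hj. apply chart_slit_R; [exact Hj | |]; intros; apply c_decr; lia. Qed.

Definition mid i : R := ((c i + c (S i)) / 2)%R.

Lemma mid_between i : (1 <= i < 2 * d)%nat -> (c (S i) < mid i < c i)%R.
Proof. intros Hi. unfold mid. generalize (hc i Hi). lra. Qed.

Lemma interval_slit_mid i : (1 <= i < 2 * d)%nat -> interval_slit i (RtoC (mid i)).
Proof. intros Hi. assert (M := mid_between i Hi). apply interval_slit_R; intros; (tauto || lia). Qed.

(** Segments starting at a real point meet the real axis only between that
    point and their other end, hence do not meet the cuts. *)
Lemma rt_dom_segment b k x z s : rt_dom b k (RtoC x) -> rt_dom b k z -> (0 <= s <= 1)%R ->
  rt_dom b k (RtoC x + RtoC s * (z - RtoC x)).
Proof.
  intros Hx Hz Hs. apply rt_dom_real in Hx; [|reflexivity]. unfold Re in Hx; simpl in Hx.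
  destruct b; simpl in *.
  - replace (RtoC (c k) - (RtoC x + RtoC s * (z - RtoC x)))
      with (RtoC (c k - x) + RtoC s * ((RtoC (c k) - z) - RtoC (c k - x))) by (rewrite !RtoC_minus; ring).
    apply slit_segment; [lra | exact Hz | exact Hs].
  - replace (RtoC x + RtoC s * (z - RtoC x) - RtoC (c k))
      with (RtoC (x - c k) + RtoC s * ((z - RtoC (c k)) - RtoC (x - c k))) by (rewrite !RtoC_minus; ring).
    apply slit_segment; [lra | exact Hz | exact Hs].
Qed.

Lemma rt_prod_dom_segment skip i x z s : rt_prod_dom skip i (RtoC x) -> rt_prod_dom skip i z ->
  (0 <= s <= 1)%R -> rt_prod_dom skip i (RtoC x + RtoC s * (z - RtoC x)).
Proof. intros Hx Hz Hs k Hk E. apply rt_dom_segment; auto. Qed.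

(** The chart around the branch point c_j: on the part of the curve that lies
    over [chart_slit j] the function w = mu / [chart_root j] is a coordinate,
    with z = c_j + w^2. *)
Definition chart_z (j : nat) (w : C) : C := RtoC (c j) + w * w.
Definition chart_dom (j : nat) (w : C) : Prop := chart_slit j (chart_z j w).

Lemma chart_z_rt b j z : chart_z j (rt b j z) = z.
Proof. unfold chart_z. rewrite rt_sq. ring. Qed.

Lemma chart_z_opp j w : chart_z j (- w) = chart_z j w.
Proof. unfold chart_z. ring. Qed.

Lemma chart_z_holo D j : holo D (chart_z j).
Proof. apply holo_plus; [apply holo_const | apply holo_mult; apply holo_id]. Qed.

Lemma chart_open j : copen (chart_dom j).
Proof.
  intros w Hw. apply (clim_cnear (chart_z j) (chart_slit j) (chart_z j w)); [|now apply rt_prod_open].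
  apply (holo_cont (fun _ => True)); [apply chart_z_holo | exact I].
Qed.

(** Scaling w by s moves z = c_j + w^2 along the segment towards c_j. *)
Lemma chart_star j : (1 <= j <= 2 * d)%nat -> star (chart_dom j).
Proof.
  intros Hj w s Hw Hs. unfold chart_dom, chart_z in *.
  replace (RtoC (c j) + RtoC s * w * (RtoC s * w)) with
    (RtoC (c j) + RtoC (s * s) * (RtoC (c j) + w * w - RtoC (c j))) by (rewrite RtoC_mult; ring).
  apply rt_prod_dom_segment; [now apply chart_slit_center | exact Hw | nra].
Qed.

Lemma chart_0 j : (1 <= j <= 2 * d)%nat -> chart_dom j 0.
Proof.
  intros Hj. unfold chart_dom, chart_z. replace (RtoC (c j) + 0 * 0) with (RtoC (c j)) by ring.
  now apply chart_slit_center.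
Qed.

Lemma chart_root_holo_w j : holo (chart_dom j) (fun w => chart_root j (chart_z j w)).
Proof.
  apply (holo_comp _ (chart_slit j)); [auto | apply rt_prod_holo | apply chart_z_holo].
Qed.

(** f(z) dz/mu = [chart_form j f w] dw, since dz = 2 w dw and
    mu = w [chart_root j]. *)
Definition chart_form (j : nat) (f : C -> C) (w : C) : C := 2 * f (chart_z j w) / chart_root j (chart_z j w).
Definition chart_prim (j : nat) (f : C -> C) : C -> C := prim (chart_form j f).

Lemma chart_form_holo j f : entire f -> holo (chart_dom j) (chart_form j f).
Proof.
  intros Hf. apply holo_div.
  - intros w Hw. now apply rt_prod_neq0.
  - apply (holo_mult _ (fun _ => RtoC 2)); [apply holo_const|].
    apply (holo_comp _ (fun _ => True)); [auto | exact Hf | apply chart_z_holo].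
  - apply chart_root_holo_w.
Qed.

Lemma chart_form_opp j f w : chart_form j f (- w) = chart_form j f w.
Proof. unfold chart_form. now rewrite chart_z_opp. Qed.

Section Chart.
Variable j : nat.
Hypothesis Hj : (1 <= j <= 2 * d)%nat.

Lemma chart_prim_deriv f w : entire f -> chart_dom j w -> cderiv (chart_prim j f) w (chart_form j f w).
Proof.
  intros Hf Hw. apply (prim_deriv (chart_dom j)); auto.
  - apply chart_open.
  - now apply chart_star.
  - now apply chart_form_holo.
Qed.

Lemma chart_prim_holo f : entire f -> holo (chart_dom j) (chart_prim j f).
Proof.
  intros Hf. apply prim_holo; [apply chart_open | now apply chart_star | now apply chart_form_holo].
Qed.

Lemma chart_prim_0 f : chart_prim j f 0 = 0.
Proof. apply prim_0. Qed.

Lemma prim_odd f w : holo (chart_dom j) f -> (forall w, f (- w) = f w) -> chart_dom j w ->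
  prim f (- w) = - prim f w.
Proof.
  intros Hf E Hw. unfold prim.
  transitivity (RIntC (fun s => - (1) * (w * f (RtoC s * w))) 0 1).
  - apply RIntC_ext; [lra|]. intros t _. rewrite <- E.
    replace (- (RtoC t * - w)) with (RtoC t * w) by ring. ring.
  - rewrite RIntC_scal; [ring | lra|]. intros t Ht. 
    apply (ray_cont (chart_dom j)); auto. now apply chart_star.
Qed.

(** The hyperelliptic involution mu -> - mu is w -> - w in the chart, and it
    changes the sign of f dz/mu. *)
Lemma chart_prim_odd f w : entire f -> chart_dom j w -> chart_prim j f (- w) = - chart_prim j f w.
Proof. intros Hf Hw. apply prim_odd; auto; [now apply chart_form_holo | intros; apply chart_form_opp]. Qed.

Lemma chart_prim_linear (a : C) f g w : entire f -> entire g -> chart_dom j w ->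
  chart_prim j (fun z => a * f z + g z) w = a * chart_prim j f w + chart_prim j g w.
Proof.
  intros Hf Hg Hw. unfold chart_prim, prim.
  assert (Cf : forall f, entire f -> forall t, (0 <= t <= 1)%R ->
    clim (locally t) (fun s => w * chart_form j f (RtoC s * w)) (w * chart_form j f (RtoC t * w))).
  { intros h Hh t Ht. apply (ray_cont (chart_dom j)); auto.
    - now apply chart_star.
    - now apply chart_form_holo. }
  rewrite <- RIntC_scal by (lra || auto).
  rewrite <- RIntC_plus; [|lra| |auto].
  - apply RIntC_ext; [lra|]. intros t _. unfold chart_form, Cdiv. ring.
  - intros t Ht. apply clim_mult; [apply clim_const | auto].
Qed.

Lemma chart_prim_scal (a : C) f w : entire f -> chart_dom j w ->
  chart_prim j (fun z => a * f z) w = a * chart_prim j f w.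
Proof.
  intros Hf Hw. unfold chart_prim, prim. rewrite <- RIntC_scal.
  - apply RIntC_ext; [lra|]. intros t _. unfold chart_form, Cdiv. ring.
  - lra.
  - intros t Ht. apply (ray_cont (chart_dom j)); auto; [now apply chart_star | now apply chart_form_holo].
Qed.

Lemma chart_prim_ext f g w : (forall z, f z = g z) -> chart_prim j f w = chart_prim j g w.
Proof.
  intros H. unfold chart_prim, prim. apply RIntC_ext; [lra|]. intros t _. unfold chart_form. now rewrite H.
Qed.
End Chart.

Lemma chart_form_rt b j i f z : (1 <= j <= 2 * d)%nat ->
  (b = true /\ i = j) \/ (b = false /\ j = S i) -> interval_slit i z ->
  rt_dom b j z /\ chart_slit j z /\ chart_form j f (rt b j z) * / (2 * rt b j z) = f z / interval_root i z.
Proof.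
  intros Hj Hb Hz.
  assert (Hdom : rt_dom b j z).
  { generalize (Hz j Hj eq_refl). destruct Hb as [[-> ->]|[-> ->]].
    - now rewrite Nat.leb_refl.
    - now replace (Nat.leb (S i) i) with false by (symmetry; apply Nat.leb_gt; lia). }
  assert (HU : chart_slit j z).
  { destruct Hb as [[-> ->]|[-> ->]]; [now apply interval_slit_chart_slit_left | now apply interval_slit_chart_slit_right]. }
  assert (HT : interval_root i z = rt b j z * chart_root j z).
  { destruct Hb as [[-> ->]|[-> ->]]; [now apply interval_root_left | apply interval_root_right; lia]. }
  split; [exact Hdom|]. split; [exact HU|].
  assert (rt b j z <> 0) by now apply rt_neq0. assert (chart_root j z <> 0) by now apply rt_prod_neq0.
  unfold chart_form. rewrite chart_z_rt, HT. cfield.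
Qed.

Lemma chart_prim_rt_deriv b j i f z : entire f -> (1 <= j <= 2 * d)%nat ->
  (b = true /\ i = j) \/ (b = false /\ j = S i) -> interval_slit i z ->
  cderiv (fun u => chart_prim j f (rt b j u)) z (f z / interval_root i z).
Proof.
  intros Hf Hj Hb Hz. destruct (chart_form_rt b j i f z Hj Hb Hz) as [H1 [H2 H3]].
  rewrite <- H3. apply (cderiv_comp (chart_prim j f) (rt b j)); [|now apply rt_deriv].
  apply chart_prim_deriv; auto. unfold chart_dom. now rewrite chart_z_rt.
Qed.

(** The integral of f dz/mu from c_i to c_{i+1}, with mu = [interval_root i]:
    the two terms are the integrals from c_i and from c_{i+1} to the
    midpoint. *)
Definition half_period (i : nat) (f : C -> C) : C :=
  chart_prim i f (rt true i (RtoC (mid i))) - chart_prim (S i) f (rt false (S i) (RtoC (mid i))).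

(** Both primitives have derivative f / [interval_root i] on the star-shaped
    domain [interval_slit i], so their difference is a constant. *)
Lemma half_period_eq i f z : entire f -> (1 <= i < 2 * d)%nat -> interval_slit i z ->
  chart_prim i f (rt true i z) - chart_prim (S i) f (rt false (S i) z) = half_period i f.
Proof.
  intros Hf Hi Hz.
  apply (zero_deriv_const (interval_slit i) (fun z => chart_prim i f (rt true i z) - chart_prim (S i) f (rt false (S i) z)) (RtoC (mid i)) z).
  - intros s Hs. apply rt_prod_dom_segment; [now apply interval_slit_mid | exact Hz | exact Hs].
  - intros u Hu. apply (cderiv_eq _ _ (f u / interval_root i u - f u / interval_root i u)); [ring|].
    apply cderiv_minus; apply chart_prim_rt_deriv; auto; lia.
Qed.

Lemma half_period_linear i (a : C) f g : entire f -> entire g -> (1 <= i < 2 * d)%nat ->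
  half_period i (fun z => a * f z + g z) = a * half_period i f + half_period i g.
Proof.
  intros Hf Hg Hi. unfold half_period.
  assert (M := interval_slit_mid i Hi).
  rewrite !chart_prim_linear; auto; try lia; [ring | |]; unfold chart_dom; rewrite chart_z_rt.
  - now apply interval_slit_chart_slit_right.
  - now apply interval_slit_chart_slit_left.
Qed.

Lemma half_period_scal i (a : C) f : entire f -> (1 <= i < 2 * d)%nat ->
  half_period i (fun z => a * f z) = a * half_period i f.
Proof.
  intros Hf Hi. unfold half_period. assert (M := interval_slit_mid i Hi).
  rewrite !chart_prim_scal; auto; try lia; [ring | |]; unfold chart_dom; rewrite chart_z_rt.
  - now apply interval_slit_chart_slit_right.
  - now apply interval_slit_chart_slit_left.
Qed.

Lemma half_period_ext i f g : (forall z, f z = g z) -> half_period i f = half_period i g.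
Proof. intros H. unfold half_period. now rewrite !(chart_prim_ext _ f g). Qed.

(** * Integration along curves *)

Section AlongCurve.
Variables (g : curve d c) (w : abelian_differential) (f : C -> C).
Hypothesis Hf : entire f.
Hypothesis Hw : forall p, factor w p = f (fst p).

Definition chart_pt (j : nat) (p : C * C) : C := snd p / chart_root j (fst p).

Lemma chart_pt_sq j p : (1 <= j <= 2 * d)%nat -> on_curve d c p -> chart_slit j (fst p) ->
  chart_pt j p * chart_pt j p = fst p - RtoC (c j).
Proof.
  intros Hj Hp HU. unfold chart_pt. assert (N : chart_root j (fst p) <> 0) by now apply rt_prod_neq0.
  transitivity (snd p * snd p / (chart_root j (fst p) * chart_root j (fst p))); [field; exact N|].
  rewrite Hp, (branch_poly_chart_root j) by exact Hj. field. exact N.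
Qed.

Lemma chart_pt_dom j p : (1 <= j <= 2 * d)%nat -> on_curve d c p -> chart_slit j (fst p) ->
  chart_dom j (chart_pt j p).
Proof.
  intros Hj Hp HU. unfold chart_dom, chart_z. rewrite chart_pt_sq; auto.
  now replace (RtoC (c j) + (fst p - RtoC (c j))) with (fst p) by ring.
Qed.

(** Inside one chart the integral of f dz/mu along a curve is the increment of
    the chart primitive.  The relation 2 w w' = z', obtained by differentiating
    w^2 = z - c_j, gives the value of the form where mu is not 0, and w' =
    mu' / [chart_root j] gives it at the branch point.  Continuity of the
    pullback is read off from the same formula. *)
Lemma curve_chart j t : (1 <= j <= 2 * d)%nat -> chart_slit j (fst (point g t)) ->
  is_derivC (fun s => chart_prim j f (chart_pt j (point g s))) t (pullback w g t) /\
  clim (locally t) (pullback w g) (pullback w g t).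
Proof.
  intros Hj HU0.
  destruct (rt_prod_holo (skip_one j) j) as [S' HS]. fold (chart_root j) in HS.
  assert (Dz : forall s, is_derivC (fun s => fst (point g s)) s (fst (velocity g s))) by apply is_derive_z.
  assert (Dm : forall s, is_derivC (fun s => snd (point g s)) s (snd (velocity g s))) by apply is_derive_mu.
  assert (Cz := is_derivC_cont _ _ _ (Dz t)). assert (Cm := is_derivC_cont _ _ _ (Dm t)).
  set (w' := fun s => (snd (velocity g s) - chart_pt j (point g s) * (S' (fst (point g s)) * fst (velocity g s)))
     / chart_root j (fst (point g s))).
  assert (Dw : forall s, chart_slit j (fst (point g s)) -> is_derivC (fun s => chart_pt j (point g s)) s (w' s)).
  { intros s HU. assert (N : chart_root j (fst (point g s)) <> 0) by now apply rt_prod_neq0.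
    unfold chart_pt at 1. 
    apply (is_derivC_eq _ _ (snd (velocity g s) * / chart_root j (fst (point g s)) +
       snd (point g s) * (- S' (fst (point g s)) / (chart_root j (fst (point g s)) * chart_root j (fst (point g s))) * fst (velocity g s)))).
    - unfold w', chart_pt. field. exact N.
    - apply (is_derivC_mult (fun s => snd (point g s)) (fun s => / chart_root j (fst (point g s)))); [apply Dm|].
      apply (is_derivC_comp (fun u => / chart_root j u) (fun s => fst (point g s))); [|apply Dz].
      apply cderiv_inv; [exact N | now apply HS]. }
  assert (Eq : forall s, chart_slit j (fst (point g s)) ->
     pullback w g s = chart_form j f (chart_pt j (point g s)) * w' s).
  { intros s HU. assert (N : chart_root j (fst (point g s)) <> 0) by now apply rt_prod_neq0.
    assert (Hp := point_on_curve g s). assert (Esq := chart_pt_sq j _ Hj Hp HU).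
    unfold pullback, apply_form. rewrite Hw.
    assert (Ez : chart_z j (chart_pt j (point g s)) = fst (point g s)) by (unfold chart_z; rewrite Esq; ring).
    unfold chart_form. rewrite Ez.
    destruct (Ceq_dec (snd (point g s)) 0) as [E|E].
    - assert (E0 : chart_pt j (point g s) = 0) by (unfold chart_pt; rewrite E; field; exact N).
      assert (Ec : fst (point g s) = RtoC (c j)).
      { rewrite E0 in Esq. replace (fst (point g s)) with (fst (point g s) - RtoC (c j) + RtoC (c j)) by ring.
        rewrite <- Esq. ring. }
      unfold w'. rewrite E0, Ec. rewrite branch_poly'_chart_root by exact Hj. rewrite Ec in N. field. exact N.
    - assert (D2 := is_derivC_mult _ _ _ _ _ (Dw s HU) (Dw s HU)).
      assert (Hloc : locally s (fun r => chart_slit j (fst (point g r)))).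
      { apply (clim_cnear (fun r => fst (point g r)) (chart_slit j) _ (is_derivC_cont _ _ _ (Dz s))).
        now apply rt_prod_open. }
      assert (D3 : is_derivC (fun r => fst (point g r) - RtoC (c j)) s
         (w' s * chart_pt j (point g s) + chart_pt j (point g s) * w' s)).
      { apply (is_derive_ext_loc (V := C_R_NormedModule) (fun r => chart_pt j (point g r) * chart_pt j (point g r))); [|exact D2].
        revert Hloc. apply filter_imp. intros r Hr. apply chart_pt_sq; [exact Hj | apply point_on_curve | exact Hr]. }
      assert (D4 : is_derivC (fun r => fst (point g r) - RtoC (c j)) s (fst (velocity g s) - 0)).
      { apply is_derivC_minus; [apply Dz | apply is_derivC_const]. }
      assert (E5 : fst (velocity g s) = 2 * (chart_pt j (point g s) * w' s)).
      { transitivity (fst (velocity g s) - 0); [ring|].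
        rewrite <- (is_derivC_unique _ _ _ _ D3 D4). ring. }
      rewrite E5. 
      assert (N2 : chart_pt j (point g s) <> 0).
      { intros E0. apply E. unfold chart_pt in E0. 
        replace (snd (point g s)) with (snd (point g s) / chart_root j (fst (point g s)) * chart_root j (fst (point g s))) by (field; exact N).
        rewrite E0. ring. }
      replace (snd (point g s)) with (chart_pt j (point g s) * chart_root j (fst (point g s))) by (unfold chart_pt; field; exact N).
      cfield. }
  split.
  - rewrite Eq by exact HU0.
    apply (is_derivC_comp (chart_prim j f) (fun s => chart_pt j (point g s))); [|now apply Dw].
    apply chart_prim_deriv; auto. apply chart_pt_dom; auto. apply point_on_curve.
  - rewrite Eq by exact HU0.
    apply (clim_ext_loc (fun s => chart_form j f (chart_pt j (point g s)) * w' s)).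
    + assert (Hloc : locally t (fun r => chart_slit j (fst (point g r)))).
      { apply (clim_cnear (fun r => fst (point g r)) (chart_slit j) _ Cz). now apply rt_prod_open. }
      revert Hloc. apply filter_imp. intros s Hs. symmetry. now apply Eq.
    + assert (N : chart_root j (fst (point g t)) <> 0) by now apply rt_prod_neq0.
      assert (Cc := is_derivC_cont _ _ _ (Dw t HU0)).
      apply clim_mult.
      * apply (clim_ccont _ (chart_form j f) _ Cc). apply (holo_cont (chart_dom j)); [now apply chart_form_holo|].
        apply chart_pt_dom; auto. apply point_on_curve.
      * apply clim_div; [exact N | |].
        -- apply clim_minus; [apply continuousC, continuous_vmu|]. apply clim_mult; [exact Cc|].
           apply clim_mult; [|apply continuousC, continuous_vz].
           apply (clim_ccont _ S' _ Cz). now apply HS.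
        -- apply (clim_ccont _ (chart_root j) _ Cz). apply (holo_cont (chart_slit j)); [apply rt_prod_holo | exact HU0].
Qed.
End AlongCurve.

(** * Integrals over loops are integer combinations of periods *)

Fixpoint csum (g : nat -> C) (l : list nat) : C :=
  match l with nil => 0 | k :: l' => g k + csum g l' end.

Lemma csum_ext g h l : (forall k, In k l -> g k = h k) -> csum g l = csum h l.
Proof.
  induction l as [|a l IH]; intros H; simpl; [reflexivity|].
  rewrite H by now left. rewrite IH; [reflexivity|]. intros k Hk. apply H. now right.
Qed.

Lemma csum_plus g h l : csum (fun k => g k + h k) l = csum g l + csum h l.
Proof. induction l as [|a l IH]; simpl; [ring | rewrite IH; ring]. Qed.

Lemma csum_scal a g l : csum (fun k => a * g k) l = a * csum g l.
Proof. induction l as [|b l IH]; simpl; [ring | rewrite IH; ring]. Qed.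

Lemma csum_0 l : csum (fun _ => 0) l = 0.
Proof. induction l as [|b l IH]; simpl; [ring | rewrite IH; ring]. Qed.

Lemma csum_app g l1 l2 : csum g (l1 ++ l2) = csum g l1 + csum g l2.
Proof. induction l1 as [|b l IH]; simpl; [ring | rewrite IH; ring]. Qed.

Lemma csum_single g l i : NoDup l -> In i l -> csum (fun k => if Nat.eqb k i then g k else 0) l = g i.
Proof.
  induction l as [|a l IH]; intros ND HI; [destruct HI|].
  inversion ND as [|? ? N ND']; subst. simpl. destruct (Nat.eqb_spec a i) as [->|Na].
  - rewrite (csum_ext _ (fun _ => 0)), csum_0; [ring|].
    intros k Hk. destruct (Nat.eqb_spec k i); [subst; contradiction | reflexivity].
  - destruct HI as [E|HI]; [contradiction|]. rewrite (IH ND' HI). ring.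
Qed.

Definition lattice_sum (n : nat -> Z) (f : C -> C) : C :=
  csum (fun i => RtoC (IZR (n i)) * half_period i f) (seq 1 (2 * d - 1)).

Lemma lattice_sum_plus n m f :
  lattice_sum (fun i => (n i + m i)%Z) f = lattice_sum n f + lattice_sum m f.
Proof.
  unfold lattice_sum. rewrite <- csum_plus. apply csum_ext. intros k _. rewrite plus_IZR, RtoC_plus. ring.
Qed.

Lemma lattice_sum_opp n f : lattice_sum (fun i => (- n i)%Z) f = - lattice_sum n f.
Proof.
  unfold lattice_sum. transitivity (- (1) * csum (fun i => RtoC (IZR (n i)) * half_period i f) (seq 1 (2 * d - 1))); [|ring].
  rewrite <- csum_scal. apply csum_ext. intros k _. rewrite opp_IZR, RtoC_opp. ring.
Qed.

(** The primitive of f dz/mu on the chart around c_j, as a function on the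
    curve. *)
Definition curve_prim (j : nat) (f : C -> C) (p : C * C) : C := chart_prim j f (chart_pt j p).

Lemma on_curve_interval_root i p : on_curve d c p -> snd p = interval_root i (fst p) \/ snd p = - interval_root i (fst p).
Proof. intros Hp. apply sq_eq. rewrite Hp. symmetry. apply interval_root_sq. Qed.

(** Over [interval_slit i] the curve has two sheets, mu = [interval_root i] and
    its opposite; the sign e tells on which one p lies. *)
Lemma adjacent_charts i p : (1 <= i < 2 * d)%nat -> on_curve d c p -> interval_slit i (fst p) ->
  exists e : Z, (e = 1%Z \/ e = (-1)%Z) /\
    (snd p = RtoC (IZR e) * interval_root i (fst p)) /\
    forall f, entire f -> curve_prim i f p - curve_prim (S i) f p = RtoC (IZR e) * half_period i f.
Proof.
  intros Hi Hp HD.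
  assert (U1 := interval_slit_chart_slit_left _ _ HD). assert (U2 := interval_slit_chart_slit_right _ _ HD).
  assert (N1 : chart_root i (fst p) <> 0) by now apply rt_prod_neq0.
  assert (N2 : chart_root (S i) (fst p) <> 0) by now apply rt_prod_neq0.
  assert (K1 : interval_root i (fst p) / chart_root i (fst p) = rt true i (fst p)).
  { rewrite interval_root_left by lia. field. exact N1. }
  assert (K2 : interval_root i (fst p) / chart_root (S i) (fst p) = rt false (S i) (fst p)).
  { rewrite interval_root_right by lia. field. exact N2. }
  destruct (on_curve_interval_root i p Hp) as [E|E].
  - exists 1%Z. split; [now left|]. split; [rewrite E; ring|]. intros f Hf.
    unfold curve_prim, chart_pt. rewrite E, K1, K2, half_period_eq by (auto; lia). ring.
  - exists (-1)%Z. assert (EN : RtoC (IZR (-1)) = - (1)) by (rewrite <- RtoC_opp; reflexivity).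
    split; [now right|]. split; [rewrite E, EN; ring|]. intros f Hf.
    unfold curve_prim, chart_pt. rewrite E.
    replace (- interval_root i (fst p) / chart_root i (fst p)) with (- rt true i (fst p)) by (rewrite <- K1; unfold Cdiv; ring).
    replace (- interval_root i (fst p) / chart_root (S i) (fst p)) with (- rt false (S i) (fst p)) by (rewrite <- K2; unfold Cdiv; ring).
    rewrite !chart_prim_odd; auto; try lia; [| |]; unfold chart_dom; rewrite ?chart_z_rt; auto.
    rewrite <- (half_period_eq i f (fst p)) by (auto; lia). rewrite EN. ring.
Qed.

Lemma chart_slit_cover z : (1 <= d)%nat -> exists j, (1 <= j <= 2 * d)%nat /\ chart_slit j z.
Proof.
  intros Hd. destruct (Req_dec (Im z) 0) as [E|N].
  2:{ exists 1%nat. split; [lia | now apply rt_prod_dom_nonreal]. }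
  assert (Ez : z = RtoC (Re z)) by (destruct z; unfold Im, Re, RtoC in *; simpl in *; now subst).
  rewrite Ez. set (x := Re z).
  assert (P : forall m, (1 <= m <= 2 * d)%nat -> (c m < x)%R -> exists j, (1 <= j <= 2 * d)%nat /\ chart_slit j (RtoC x)).
  { induction m as [|m IH]; [lia|]. intros Hm Hx.
    destruct (Nat.eq_dec m 0) as [->|Nm].
    - exists 1%nat. split; [lia|]. apply chart_slit_R; [lia|lia|]. intros. assert (c 2 < c 1)%R by (apply hc; lia). lra.
    - destruct (Rtotal_order (c m) x) as [L|[L|L]].
      + apply IH; [lia | exact L].
      + exists m. split; [lia|]. rewrite <- L. apply chart_slit_center. lia.
      + exists (S m). split; [lia|]. apply chart_slit_R; [lia| |].
        * intros _. now replace (S m - 1)%nat with m by lia.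
        * intros. assert (c (S (S m)) < c (S m))%R by (apply hc; lia). lra. }
  destruct (Rtotal_order (c (2 * d)%nat) x) as [L|[L|L]].
  - apply (P (2 * d)%nat); [lia | exact L].
  - exists (2 * d)%nat. split; [lia|]. rewrite <- L. apply chart_slit_center. lia.
  - exists (2 * d)%nat. split; [lia|]. apply chart_slit_R; [lia| |lia].
    intros _. assert (c (2 * d)%nat < c (2 * d - 1)%nat)%R by (apply c_decr; lia). lra.
Qed.

(** Charts that are not adjacent have only nonreal points in common. *)
Lemma chart_slit_between j l k z : (1 <= j <= l)%nat -> (l <= k <= 2 * d)%nat -> chart_slit j z -> chart_slit k z -> chart_slit l z.
Proof.
  intros Hl Hk H1 H2. destruct (Req_dec (Im z) 0) as [E|N]; [|now apply rt_prod_dom_nonreal].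
  destruct (Nat.eq_dec l j) as [->|Nj]; [exact H1|]. destruct (Nat.eq_dec l k) as [->|Nk]; [exact H2|].
  exfalso.
  assert (A := H1 l ltac:(lia) ltac:(apply Nat.eqb_neq; lia)).
  assert (B := H2 l ltac:(lia) ltac:(apply Nat.eqb_neq; lia)).
  apply rt_dom_real in A; [|exact E]. apply rt_dom_real in B; [|exact E].
  replace (Nat.leb l j) with false in A by (symmetry; apply Nat.leb_gt; lia).
  replace (Nat.leb l k) with true in B by (symmetry; apply Nat.leb_le; lia). lra.
Qed.

(** The parity of the coefficient of the half period i in the difference of the
    primitives of two charts only depends on whether the interval i separates
    their branch points.  Along a closed path these parities cancel, which is
    why loops have integer combinations of full periods. *)
Definition below (j i : nat) : bool := Nat.ltb i j.

Lemma charts_climb m : forall j p, (1 <= j)%nat -> (j + m <= 2 * d)%nat -> on_curve d c p ->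
  chart_slit j (fst p) -> chart_slit (j + m) (fst p) ->
  exists n : nat -> Z, (forall i, Z.odd (n i) = xorb (below j i) (below (j + m) i)) /\
    forall f, entire f -> curve_prim j f p - curve_prim (j + m) f p = lattice_sum n f.
Proof.
  induction m as [|m IH]; intros j p Hj Hm Hp H1 H2.
  - exists (fun _ => 0%Z). split.
    + intros i. rewrite Nat.add_0_r. destruct (below j i); reflexivity.
    + intros f Hf. rewrite Nat.add_0_r. unfold lattice_sum.
      rewrite (csum_ext _ (fun _ => 0)), csum_0; [ring|]. intros; ring.
  - assert (H3 : chart_slit (j + m) (fst p)) by (apply (chart_slit_between j (j + m) (j + S m)); auto; lia).
    destruct (IH j p Hj ltac:(lia) Hp H1 H3) as [n [Pn Hn]].
    replace (j + S m)%nat with (S (j + m)) in * by lia.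
    destruct (adjacent_charts (j + m) p ltac:(lia) Hp) as [e [He [_ K]]].
    { apply chart_slit_interval_slit; auto; lia. }
    exists (fun i => (n i + if Nat.eqb i (j + m) then e else 0)%Z). split.
    + intros i. rewrite Z.odd_add, Pn. unfold below.
      destruct (Nat.eqb_spec i (j + m)) as [Ei|Ni].
      * replace (Z.odd e) with true by (destruct He; subst e; reflexivity).
        destruct (Nat.ltb_spec i j), (Nat.ltb_spec i (j + m)), (Nat.ltb_spec i (S (j + m))); try lia; reflexivity.
      * destruct (Nat.ltb_spec i j), (Nat.ltb_spec i (j + m)), (Nat.ltb_spec i (S (j + m))); try lia; reflexivity.
    + intros f Hf. rewrite lattice_sum_plus, <- Hn by exact Hf.
      replace (lattice_sum (fun i => if Nat.eqb i (j + m) then e else 0%Z) f) with (RtoC (IZR e) * half_period (j + m) f).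
      * rewrite <- K by exact Hf. ring.
      * unfold lattice_sum. symmetry.
        rewrite (csum_ext _ (fun i => if Nat.eqb i (j + m) then RtoC (IZR e) * half_period i f else 0)).
        -- apply (csum_single (fun i => RtoC (IZR e) * half_period i f)); [apply seq_NoDup | apply in_seq; lia].
        -- intros i _. destruct (Nat.eqb i (j + m)); ring.
Qed.

Lemma charts_differ j k p : (1 <= j <= 2 * d)%nat -> (1 <= k <= 2 * d)%nat -> on_curve d c p ->
  chart_slit j (fst p) -> chart_slit k (fst p) ->
  exists n : nat -> Z, (forall i, Z.odd (n i) = xorb (below j i) (below k i)) /\
    forall f, entire f -> curve_prim j f p - curve_prim k f p = lattice_sum n f.
Proof.
  intros Hj Hk Hp H1 H2. destruct (Nat.le_ge_cases j k) as [L|L].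
  - replace k with (j + (k - j))%nat in * by lia. apply charts_climb; auto; lia.
  - replace j with (k + (j - k))%nat in * by lia.
    destruct (charts_climb (j - k) k p) as [n [Pn Hn]]; auto; try lia.
    exists (fun i => (- n i)%Z). split.
    + intros i. rewrite Z.odd_opp, Pn. apply xorb_comm.
    + intros f Hf. rewrite lattice_sum_opp, <- Hn by exact Hf. ring.
Qed.

Lemma interval_connected (P : R -> Prop) :
  (forall t0, (0 <= t0 <= 1)%R -> exists e, (0 < e)%R /\
     forall s t, (0 <= s <= 1)%R -> (0 <= t <= 1)%R -> (Rabs (s - t0) < e)%R -> (Rabs (t - t0) < e)%R -> P s -> P t) ->
  P 0%R -> P 1%R.
Proof.
  intros H P0.
  destruct (completeness (fun x => (0 <= x <= 1)%R /\ P x)) as [b [Hb1 Hb2]].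
  - exists 1%R. intros x [Hx _]. lra.
  - exists 0%R. split; [lra | exact P0].
  - assert (B0 : (0 <= b)%R) by (apply Hb1; split; [lra | exact P0]).
    assert (B1 : (b <= 1)%R) by (apply Hb2; intros x [Hx _]; lra).
    destruct (H b (conj B0 B1)) as [e [He K]].
    assert (Hs : exists s, (0 <= s <= 1)%R /\ P s /\ (b - e < s <= b)%R).
    { apply NNPP. intros N. assert (b <= b - e)%R; [|lra]. apply Hb2. intros x [Hx Px].
      destruct (Rle_lt_dec x (b - e)) as [L|L]; [exact L|]. exfalso. apply N. exists x.
      split; [exact Hx|]. split; [exact Px|]. split; [exact L|]. apply Hb1. now split. }
    destruct Hs as [s [Hs [Ps Hsb]]].
    set (t := Rmin 1 (b + e / 2)).
    assert (Ht : (b <= t <= 1)%R) by (unfold t; split; [apply Rmin_glb; lra | apply Rmin_l]).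
    assert (Ht2 : (t <= b + e / 2)%R) by apply Rmin_r.
    assert (Pt : P t).
    { apply (K s t); auto; try lra; split_Rabs; lra. }
    assert (t <= b)%R by (apply Hb1; split; [lra | exact Pt]).
    assert (E : t = 1%R).
    { unfold t in *. unfold Rmin in *. destruct (Rle_dec 1 (b + e / 2)); lra. }
    now rewrite <- E.
Qed.

Section LoopIntegrals.
Variable g : curve d c.
Hypothesis Hd : (1 <= d)%nat.

Lemma pullback_cont w f t : entire f -> (forall p, factor w p = f (fst p)) ->
  clim (locally t) (pullback w g) (pullback w g t).
Proof.
  intros Hf Hw. destruct (chart_slit_cover (fst (point g t)) Hd) as [j [Hj HU]].
  now apply (curve_chart g w f Hf Hw j t).
Qed.

Lemma pullback_int w f a b : entire f -> (forall p, factor w p = f (fst p)) ->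
  is_RIntC (pullback w g) a b (RIntC (pullback w g) a b).
Proof.
  intros Hf Hw. apply (RInt_correct (V := C_R_CompleteNormedModule)).
  apply (ex_RInt_continuous (V := C_R_CompleteNormedModule)). intros t _. apply continuousC.
  now apply (pullback_cont w f).
Qed.

Lemma pullback_Chasles w f a b e : entire f -> (forall p, factor w p = f (fst p)) ->
  RIntC (pullback w g) a b + RIntC (pullback w g) b e = RIntC (pullback w g) a e.
Proof.
  intros Hf Hw. apply (RInt_Chasles (V := C_R_CompleteNormedModule)); eexists; now apply (pullback_int w f).
Qed.

Lemma int_in_chart w f j a b : entire f -> (forall p, factor w p = f (fst p)) -> (1 <= j <= 2 * d)%nat ->
  (forall t, (Rmin a b <= t <= Rmax a b)%R -> chart_slit j (fst (point g t))) ->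
  RIntC (pullback w g) a b = curve_prim j f (point g b) - curve_prim j f (point g a).
Proof.
  intros Hf Hw Hj H. apply is_RIntC_unique.
  apply (RInt_C_derive_gen (fun t => curve_prim j f (point g t))); intros t Ht;
    now apply (curve_chart g w f Hf Hw j t Hj), H.
Qed.

Lemma near_chart t0 : exists j e, (1 <= j <= 2 * d)%nat /\ (0 < e)%R /\
  forall t, (Rabs (t - t0) < e)%R -> chart_slit j (fst (point g t)).
Proof.
  destruct (chart_slit_cover (fst (point g t0)) Hd) as [j [Hj HU]].
  assert (Dz : is_derivC (fun s => fst (point g s)) t0 (fst (velocity g t0))) by apply is_derive_z.
  assert (HL := clim_cnear _ _ _ (is_derivC_cont _ _ _ Dz) (rt_prod_open _ _ _ HU)).
  apply Rlocally_C in HL. destruct HL as [e [He K]]. exists j, e. auto.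
Qed.

(** Follow the path and change charts as needed, recording the half periods
    collected and their parity. *)
Theorem path_integral : exists j0 j n, (1 <= j0 <= 2 * d)%nat /\ (1 <= j <= 2 * d)%nat /\
  chart_slit j0 (fst (point g 0)) /\ chart_slit j (fst (point g 1)) /\
  (forall i, Z.odd (n i) = xorb (below j0 i) (below j i)) /\
  forall w f, entire f -> (forall p, factor w p = f (fst p)) ->
    RIntC (pullback w g) 0 1 = curve_prim j f (point g 1) - curve_prim j0 f (point g 0) + lattice_sum n f.
Proof.
  destruct (near_chart 0) as [j0 [e0 [Hj0 [He0 HU0]]]].
  assert (U0 : chart_slit j0 (fst (point g 0))) by (apply HU0; replace (0 - 0)%R with 0%R by ring; now rewrite Rabs_R0).
  exists j0.
  set (P := fun t => exists j n, (1 <= j <= 2 * d)%nat /\ chart_slit j (fst (point g t)) /\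
    (forall i, Z.odd (n i) = xorb (below j0 i) (below j i)) /\
    forall w f, entire f -> (forall p, factor w p = f (fst p)) ->
      RIntC (pullback w g) 0 t = curve_prim j f (point g t) - curve_prim j0 f (point g 0) + lattice_sum n f).
  assert (P1 : P 1%R).
  { apply interval_connected.
    - intros t0 _. destruct (near_chart t0) as [j [e [Hj [He HU]]]]. exists e. split; [exact He|].
      intros s t _ _ Hs Ht [j' [n [Hj' [HU' [Pn Hn]]]]].
      destruct (charts_differ j' j (point g s)) as [m [Pm Hm]]; auto.
      { apply point_on_curve. }
      exists j, (fun i => (n i + m i)%Z). split; [exact Hj|]. split; [now apply HU|]. split.
      + intros i. rewrite Z.odd_add, Pn, Pm.
        destruct (below j0 i), (below j' i), (below j i); reflexivity.
      + intros w f Hf Hw. rewrite <- (pullback_Chasles w f 0 s t Hf Hw), (Hn w f Hf Hw), lattice_sum_plus, <- Hm by exact Hf.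
        rewrite (int_in_chart w f j s t Hf Hw Hj); [ring|].
        intros r Hr. apply HU. unfold Rmin, Rmax in Hr. destruct (Rle_dec s t); split_Rabs; lra.
    - exists j0, (fun _ => 0%Z). split; [exact Hj0|]. split; [exact U0|]. split.
      + intros i. now rewrite xorb_nilpotent.
      + intros w f Hf Hw. rewrite (int_in_chart w f j0 0 0 Hf Hw Hj0).
        * unfold lattice_sum. rewrite (csum_ext _ (fun _ => 0)), csum_0; [ring|]. intros; ring.
        * intros t Ht. rewrite Rmin_left, Rmax_left in Ht by lra. replace t with 0%R by lra. exact U0. }
  destruct P1 as [j [n [H1 [H2 [H3 H4]]]]]. exists j, n. auto 10.
Qed.
End LoopIntegrals.

(** At the end of a loop one can change back to the initial chart; then all
    coefficients are even. *)
Theorem loop_integral (g : loop d c) : (1 <= d)%nat -> exists n : nat -> Z,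
  forall w f, entire f -> (forall p, factor w p = f (fst p)) ->
    loop_int w g = 2 * lattice_sum n f.
Proof.
  intros Hd. destruct (path_integral g Hd) as [j0 [j [n [H0 [H1 [U0 [U1 [Pn Hn]]]]]]]].
  assert (E : point g 1 = point g 0).
  { rewrite <- (loop_periodic g 0). f_equal. ring. }
  rewrite E in *.
  destruct (charts_differ j j0 (point g 0)) as [m [Pm Hm]]; auto.
  { apply point_on_curve. }
  exists (fun i => Z.div2 (n i + m i)). intros w f Hf Hw.
  change (RIntC (pullback w g) 0 1 = 2 * lattice_sum (fun i => Z.div2 (n i + m i)) f).
  rewrite (Hn w f Hf Hw), Hm by exact Hf. rewrite Cplus_comm, <- lattice_sum_plus.
  unfold lattice_sum. rewrite <- csum_scal. apply csum_ext. intros i _.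
  rewrite Cmult_assoc, <- RtoC_mult, <- mult_IZR. do 3 f_equal.
  assert (Q : Z.odd (n i + m i) = false).
  { rewrite Z.odd_add, Pn, Pm. destruct (below j0 i), (below j i); reflexivity. }
  rewrite (Zdiv2_odd_eqn (n i + m i)) at 1. rewrite Q. ring.
Qed.

(** * The ovals over the intervals between consecutive branch points *)

Definition rad i : R := ((c i - c (S i)) / 2)%R.
Definition oval_x i (t : R) : R := (mid i + rad i * cos (2 * PI * t))%R.
Definition oval_y i (t : R) : R := (rad i * sin (2 * PI * t))%R.

(** The oval of the curve over [c_{i+1}, c_i].  The polar angle 2 pi t makes mu
    a smooth function, sqrt((z - c_i)(z - c_{i+1})) being i r sin(2 pi t).  On
    its first half the oval runs from c_i to c_{i+1} with
    mu = [interval_root i].  The velocities at the two branch points are the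
    ones that enter the intersection numbers. *)
Definition is_oval (i : nat) (L : loop d c) : Prop :=
  (forall t, point L t = (RtoC (oval_x i t), Ci * RtoC (oval_y i t) * oval_root i (RtoC (oval_x i t)))) /\
  velocity L 0 = (RtoC 0, Ci * RtoC (2 * PI * rad i) * oval_root i (RtoC (c i))) /\
  velocity L (1 / 2) = (RtoC 0, - (Ci * RtoC (2 * PI * rad i) * oval_root i (RtoC (c (S i))))).

Lemma rad_pos i : (1 <= i < 2 * d)%nat -> (0 < rad i)%R.
Proof. intros Hi. unfold rad. generalize (hc i Hi). lra. Qed.

Lemma oval_x_range i t : (1 <= i < 2 * d)%nat -> (c (S i) <= oval_x i t <= c i)%R.
Proof.
  intros Hi. unfold oval_x, mid. assert (R0 := rad_pos i Hi).
  destruct (COS_bound (2 * PI * t)) as [B1 B2].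
  assert (E1 : c i = ((c i + c (S i)) / 2 + rad i)%R) by (unfold rad; field).
  assert (E2 : c (S i) = ((c i + c (S i)) / 2 - rad i)%R) by (unfold rad; field).
  rewrite E1 at 3. rewrite E2 at 1. nra.
Qed.

Lemma oval_slit_R i x : (1 <= i < 2 * d)%nat -> (c (S i) <= x <= c i)%R -> oval_slit i (RtoC x).
Proof.
  intros Hi Hx k Hk E. apply orb_false_elim in E. destruct E as [E1 E2].
  apply Nat.eqb_neq in E1. apply Nat.eqb_neq in E2. apply rt_dom_R.
  destruct (Nat.leb_spec k i).
  - apply Rle_lt_trans with (c i); [lra | apply c_decr; lia].
  - apply Rlt_le_trans with (c (S i)); [apply c_decr; lia | lra].
Qed.

Lemma oval_x_deriv i t : is_derive (oval_x i) t (- (2 * PI * oval_y i t))%R.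
Proof. unfold oval_x, oval_y. auto_derive; [trivial | ring]. Qed.

Lemma oval_y_deriv i t : is_derive (oval_y i) t (2 * PI * (rad i * cos (2 * PI * t)))%R.
Proof. unfold oval_y. auto_derive; [trivial | ring]. Qed.

Lemma clim_deriv_R (f : R -> R) t a : is_derive f t a -> clim (locally t) (fun s => RtoC (f s)) (RtoC (f t)).
Proof. intros H. apply (is_derivC_cont (fun s => RtoC (f s)) t (RtoC a)). now apply is_derivC_RtoC. Qed.

Lemma oval_on_curve i t : (1 <= i < 2 * d)%nat ->
  on_curve d c (RtoC (oval_x i t), Ci * RtoC (oval_y i t) * oval_root i (RtoC (oval_x i t))).
Proof.
  intros Hi. unfold on_curve. simpl. set (z := RtoC (oval_x i t)).
  rewrite (branch_poly_chart_root i) by lia. rewrite chart_root_oval_root_left by lia.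
  transitivity ((z - RtoC (c i)) * (rt false (S i) z * rt false (S i) z) * (oval_root i z * oval_root i z)); [|ring].
  rewrite rt_sq.
  transitivity (Ci * Ci * RtoC (oval_y i t * oval_y i t) * (oval_root i z * oval_root i z)); [rewrite RtoC_mult; ring|].
  f_equal. unfold z. rewrite <- !RtoC_minus, <- RtoC_mult, Ci_sq, <- RtoC_opp, <- RtoC_mult. f_equal.
  assert (E := sin2_cos2 (2 * PI * t)). unfold Rsqr in E. unfold oval_x, oval_y, mid.
  transitivity (- (rad i * rad i) * (sin (2 * PI * t) * sin (2 * PI * t)))%R; [ring|].
  replace (sin (2 * PI * t) * sin (2 * PI * t))%R with (1 - cos (2 * PI * t) * cos (2 * PI * t))%R by lra.
  unfold rad. field.
Qed.

Lemma oval_period_1 i t : oval_x i (t + 1) = oval_x i t /\ oval_y i (t + 1) = oval_y i t.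
Proof.
  unfold oval_x, oval_y. replace (2 * PI * (t + 1))%R with (2 * PI * t + 2 * INR 1 * PI)%R by (simpl; ring).
  rewrite cos_period, sin_period. split; reflexivity.
Qed.

Lemma oval_exists i : (1 <= i < 2 * d)%nat -> exists L : loop d c, is_oval i L.
Proof.
  intros Hi.
  destruct (rt_prod_holo (skip_two i) i) as [P' HP]. fold (oval_root i) in HP.
  set (zz := fun t => RtoC (oval_x i t)).
  assert (HPt : forall t, cderiv (oval_root i) (zz t) (P' (zz t)) /\ ccont P' (zz t)).
  { intros t. apply HP. apply (oval_slit_R i); [exact Hi | now apply oval_x_range]. }
  set (vz := fun t => RtoC (- (2 * PI * oval_y i t))).
  set (vm := fun t => Ci * RtoC (2 * PI * (rad i * cos (2 * PI * t))) * oval_root i (zz t) +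
     Ci * RtoC (oval_y i t) * (P' (zz t) * vz t)).
  assert (Dz : forall t, is_derivC zz t (vz t)) by (intros t; apply is_derivC_RtoC, oval_x_deriv).
  assert (Cz : forall t, clim (locally t) zz (zz t)) by (intros t; exact (is_derivC_cont _ _ _ (Dz t))).
  assert (Cy : forall t, clim (locally t) (fun t => RtoC (oval_y i t)) (RtoC (oval_y i t)))
    by (intros t; exact (clim_deriv_R _ _ _ (oval_y_deriv i t))).
  assert (Cv : forall t, clim (locally t) vz (vz t)).
  { intros t. apply (clim_deriv_R (fun s => (- (2 * PI * oval_y i s))%R) t (- (2 * PI * (2 * PI * (rad i * cos (2 * PI * t)))))%R).
    unfold oval_y. auto_derive; [trivial | ring]. }
  assert (Dm : forall t, is_derivC (fun t => Ci * RtoC (oval_y i t) * oval_root i (zz t)) t (vm t)).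
  { intros t. apply (is_derivC_mult (fun t => Ci * RtoC (oval_y i t)) (fun t => oval_root i (zz t))).
    - apply (is_derivC_eq _ _ (0 * RtoC (oval_y i t) + Ci * RtoC (2 * PI * (rad i * cos (2 * PI * t))))); [ring|].
      apply (is_derivC_mult (fun _ => Ci) (fun t => RtoC (oval_y i t))); [apply is_derivC_const|].
      apply is_derivC_RtoC, oval_y_deriv.
    - apply (is_derivC_comp (oval_root i) zz); [apply HPt | apply Dz]. }
  assert (Cm : forall t, clim (locally t) vm (vm t)).
  { intros t. apply clim_plus; apply clim_mult; try apply clim_mult; try apply clim_const; auto.
    - apply (clim_deriv_R (fun t => (2 * PI * (rad i * cos (2 * PI * t)))%R) t (- (2 * PI * (rad i * (2 * PI * sin (2 * PI * t)))))%R).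
      auto_derive; [trivial | ring].
    - apply (clim_ccont zz (oval_root i) _ (Cz t)). exact (cderiv_cont _ _ _ (proj1 (HPt t))).
    - apply (clim_ccont zz P' _ (Cz t)). apply HPt. }
  set (C0 := @Curve d c (fun t => (zz t, Ci * RtoC (oval_y i t) * oval_root i (zz t))) (fun t => (vz t, vm t))
    (fun t => oval_on_curve i t Hi) Dz Dm (fun t => proj2 (continuousC _ _) (Cv t)) (fun t => proj2 (continuousC _ _) (Cm t))).
  assert (Hper : forall t, point C0 (t + 1)%R = point C0 t).
  { intros t. simpl. unfold zz. destruct (oval_period_1 i t) as [-> ->]. reflexivity. }
  exists (Loop Hper). split; [reflexivity|].
  assert (E0 : oval_y i 0 = 0%R /\ oval_x i 0 = c i).
  { unfold oval_y, oval_x. rewrite Rmult_0_r, sin_0, cos_0. unfold mid, rad. split; field. }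
  assert (E1 : oval_y i (1 / 2) = 0%R /\ oval_x i (1 / 2) = c (S i)).
  { unfold oval_y, oval_x. replace (2 * PI * (1 / 2))%R with PI by field. rewrite sin_PI, cos_PI.
    unfold mid, rad. split; field. }
  split; simpl; unfold vm, vz, zz.
  - destruct E0 as [-> ->]. rewrite ?Rmult_0_r, cos_0, ?Rmult_1_r, ?Rmult_0_r, Ropp_0. f_equal. ring.
  - destruct E1 as [-> ->]. replace (2 * PI * (1 / 2))%R with PI by field. rewrite cos_PI, !Rmult_0_r, Ropp_0. f_equal.
    replace (2 * PI * (rad i * -1))%R with (- (2 * PI * rad i))%R by ring. rewrite RtoC_opp. ring.
Qed.

Lemma oval_mid i : (1 <= i < 2 * d)%nat ->
  Ci * RtoC (rad i) * oval_root i (RtoC (mid i)) = interval_root i (RtoC (mid i)).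
Proof.
  intros Hi. rewrite interval_root_left, chart_root_oval_root_left by lia. unfold rt.
  rewrite <- !RtoC_minus. unfold mid.
  replace (c i - (c i + c (S i)) / 2)%R with (rad i) by (unfold rad; field).
  replace ((c i + c (S i)) / 2 - c (S i))%R with (rad i) by (unfold rad; field).
  transitivity (Ci * (csqrt (RtoC (rad i)) * csqrt (RtoC (rad i))) * oval_root i (RtoC ((c i + c (S i)) / 2))); [|ring].
  now rewrite csqrt_sq.
Qed.

Lemma chart_pt_opp j z m : chart_pt j (z, - m) = - chart_pt j (z, m).
Proof. unfold chart_pt, Cdiv. simpl. ring. Qed.

Lemma chart_pt_interval_root_left i z : (1 <= i <= 2 * d)%nat -> interval_slit i z -> chart_pt i (z, interval_root i z) = rt true i z.
Proof.
  intros Hi HD. change (interval_root i z / chart_root i z = rt true i z). rewrite interval_root_left by exact Hi.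
  assert (chart_root i z <> 0) by now apply rt_prod_neq0, interval_slit_chart_slit_left. cfield.
Qed.

Lemma chart_pt_interval_root_right i z : (S i <= 2 * d)%nat -> interval_slit i z -> chart_pt (S i) (z, interval_root i z) = rt false (S i) z.
Proof.
  intros Hi HD. change (interval_root i z / chart_root (S i) z = rt false (S i) z). rewrite interval_root_right by exact Hi.
  assert (chart_root (S i) z <> 0) by now apply rt_prod_neq0, interval_slit_chart_slit_right. cfield.
Qed.

(** Quarters of the oval adjacent to c_i lie in the chart of c_i, the middle
    half in that of c_{i+1}.  The two changes of charts, at opposite points over
    the midpoint, contribute one half period each because the primitives are
    odd. *)
Theorem oval_integral i L w f : (1 <= i < 2 * d)%nat -> is_oval i L ->
  entire f -> (forall p, factor w p = f (fst p)) -> loop_int w L = 2 * half_period i f.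
Proof.
  intros Hi [HL _] Hf Hw. assert (Hd : (1 <= d)%nat) by lia.
  change (RIntC (pullback w L) 0 1 = 2 * half_period i f).
  rewrite <- (pullback_Chasles L Hd w f 0 (1 / 4) 1), <- (pullback_Chasles L Hd w f (1 / 4) (3 / 4) 1) by auto.
  assert (PP := PI_RGT_0).
  assert (R0 := rad_pos i Hi).
  assert (UI : forall t, (0 <= cos (2 * PI * t))%R -> chart_slit i (fst (point L t))).
  { intros t Ht. rewrite HL. assert (X := oval_x_range i t Hi). 
    assert (M := mid_between i Hi). apply chart_slit_R; [lia| |].
    - intros. apply Rle_lt_trans with (c i); [apply X | apply c_decr; lia].
    - intros. unfold oval_x. nra. }
  assert (UJ : forall t, (cos (2 * PI * t) <= 0)%R -> chart_slit (S i) (fst (point L t))).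
  { intros t Ht. rewrite HL. assert (X := oval_x_range i t Hi). 
    assert (M := mid_between i Hi). apply chart_slit_R; [lia| |].
    - intros. replace (S i - 1)%nat with i by lia. unfold oval_x. nra.
    - intros. apply Rlt_le_trans with (c (S i)); [apply c_decr; lia | apply X]. }
  rewrite (int_in_chart L w f i 0 (1 / 4)), (int_in_chart L w f (S i) (1 / 4) (3 / 4)), (int_in_chart L w f i (3 / 4) 1); auto; try lia.
  - assert (E0 : forall t, sin (2 * PI * t) = 0%R -> curve_prim i f (point L t) = 0).
    { intros t Ht. rewrite HL. unfold curve_prim, chart_pt. simpl. unfold oval_y. rewrite Ht, Rmult_0_r.
      unfold Cdiv. replace (Ci * RtoC 0 * oval_root i (RtoC (oval_x i t)) * / chart_root i (RtoC (oval_x i t))) with (RtoC 0) by ring.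
      apply chart_prim_0. }
    rewrite (E0 0%R), (E0 1%R).
    2:{ replace (2 * PI * 1)%R with (2 * PI)%R by ring. apply sin_2PI. }
    2:{ rewrite Rmult_0_r. apply sin_0. }
    assert (DM := interval_slit_mid i Hi).
    assert (E1 : point L (1 / 4) = (RtoC (mid i), interval_root i (RtoC (mid i)))).
    { rewrite HL. unfold oval_x, oval_y. replace (2 * PI * (1 / 4))%R with (PI / 2)%R by field.
      rewrite cos_PI2, sin_PI2, Rmult_0_r, Rplus_0_r, Rmult_1_r. now rewrite oval_mid. }
    assert (E3 : point L (3 / 4) = (RtoC (mid i), - interval_root i (RtoC (mid i)))).
    { rewrite HL. unfold oval_x, oval_y. replace (2 * PI * (3 / 4))%R with (3 * (PI / 2))%R by field.
      rewrite cos_3PI2, sin_3PI2, Rmult_0_r, Rplus_0_r. rewrite <- oval_mid by exact Hi.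
      replace (rad i * -1)%R with (- rad i)%R by ring. rewrite RtoC_opp. f_equal. ring. }
    rewrite E1, E3. unfold curve_prim.
    rewrite !chart_pt_opp, chart_pt_interval_root_left, chart_pt_interval_root_right by (auto; lia).
    rewrite !chart_prim_odd; auto; try lia; [unfold half_period; ring | |]; unfold chart_dom; rewrite chart_z_rt.
    + now apply interval_slit_chart_slit_left.
    + now apply interval_slit_chart_slit_right.
  - intros t Ht. rewrite Rmin_left, Rmax_right in Ht by lra. apply UI. apply cos_ge_0_3PI2; nra.
  - intros t Ht. rewrite Rmin_left, Rmax_right in Ht by lra. apply UJ. apply cos_le_0; nra.
  - intros t Ht. rewrite Rmin_left, Rmax_right in Ht by lra. apply UI. apply cos_ge_0; nra.
Qed.

(** * Intersection numbers of the ovals *)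

Lemma cos_eq_1 t : (0 <= t < 1)%R -> cos (2 * PI * t) = 1%R -> t = 0%R.
Proof.
  intros Ht E. assert (PP := PI_RGT_0). replace (2 * PI * t)%R with (2 * (PI * t))%R in E by ring.
  rewrite cos_2a_sin in E. destruct (Req_dec t 0) as [|N]; [assumption|exfalso].
  assert (0 < sin (PI * t))%R by (apply sin_gt_0; nra). nra.
Qed.

Lemma cos_eq_m1 t : (0 <= t < 1)%R -> cos (2 * PI * t) = (-1)%R -> t = (1 / 2)%R.
Proof.
  intros Ht E. assert (PP := PI_RGT_0). replace (2 * PI * t)%R with (2 * (PI * t))%R in E by ring.
  rewrite cos_2a_cos in E. destruct (Rtotal_order t (1 / 2)) as [L|[L|L]]; [exfalso|exact L|exfalso].
  - assert (0 < cos (PI * t))%R by (apply cos_gt_0; nra). nra.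
  - assert (cos (PI * t) < 0)%R by (apply cos_lt_0; nra). nra.
Qed.

Lemma orient_anti v w : orient v w = (- orient w v)%R.
Proof.
  destruct v as [[a b] [a' b']], w as [[x y] [x' y']]. unfold orient, Im, Cconj, Cplus, Cmult; simpl. ring.
Qed.

(** At the common branch point c_{i+1} both tangent vectors are multiples of
    [chart_root (i+1)], by a negative number and by a positive multiple of the
    imaginary unit: in the coordinate w the oval i arrives along the positive
    real axis and the next one leaves along the positive imaginary axis. *)
Lemma oval_orient i L M : (1 <= i)%nat -> (S (S i) <= 2 * d)%nat -> is_oval i L -> is_oval (S i) M ->
  (orient (velocity L (1 / 2)) (velocity M 0) < 0)%R.
Proof.
  intros Hi Hi' [_ [_ HL]] [_ [HM _]]. rewrite HL, HM.
  set (z := RtoC (c (S i))).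
  assert (E1 : chart_root (S i) z = rt true i z * oval_root i z) by (apply chart_root_oval_root_right; lia).
  assert (E2 : chart_root (S i) z = rt false (S (S i)) z * oval_root (S i) z) by (apply chart_root_oval_root_left; lia).
  assert (D1 := hc i ltac:(lia)). assert (D2 := hc (S i) ltac:(lia)).
  assert (R1 : rt true i z = Ci * RtoC (sqrt (c i - c (S i)))).
  { unfold rt, z. rewrite <- RtoC_minus, csqrt_R by lra. reflexivity. }
  assert (R2 : rt false (S (S i)) z = RtoC (sqrt (c (S i) - c (S (S i))))).
  { unfold rt, z. rewrite <- RtoC_minus, csqrt_R by lra. reflexivity. }
  assert (P1 : (0 < sqrt (c i - c (S i)))%R) by (apply sqrt_lt_R0; lra).
  assert (P2 : (0 < sqrt (c (S i) - c (S (S i))))%R) by (apply sqrt_lt_R0; lra).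
  assert (NS : chart_root (S i) z <> 0) by (apply rt_prod_neq0, chart_slit_center; lia).
  rewrite R1 in E1. rewrite R2 in E2.
  set (a := sqrt (c i - c (S i))) in *. set (b := sqrt (c (S i) - c (S (S i)))) in *.
  set (sg := chart_root (S i) z) in *.
  assert (Na : RtoC a <> 0) by (apply RtoC_neq0; lra).
  assert (Nb : RtoC b <> 0) by (apply RtoC_neq0; lra).
  assert (V1 : - (Ci * RtoC (2 * PI * rad i) * oval_root i z) = RtoC (- (2 * PI * rad i / a)) * sg).
  { rewrite E1, RtoC_opp, RtoC_div by lra. field. exact Na. }
  assert (V2 : Ci * RtoC (2 * PI * rad (S i)) * oval_root (S i) z = RtoC (2 * PI * rad (S i) / b) * (Ci * sg)).
  { rewrite E2, RtoC_div by lra. field. exact Nb. }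
  rewrite V1, V2.
  assert (RP1 := rad_pos i ltac:(lia)). assert (RP2 := rad_pos (S i) ltac:(lia)). assert (PP := PI_RGT_0).
  set (k1 := (2 * PI * rad i / a)%R). set (k2 := (2 * PI * rad (S i) / b)%R).
  assert (K1 : (0 < k1)%R) by (apply Rdiv_lt_0_compat; [|exact P1]; apply Rmult_lt_0_compat; lra).
  assert (K2 : (0 < k2)%R) by (apply Rdiv_lt_0_compat; [|exact P2]; apply Rmult_lt_0_compat; lra).
  assert (NN : (0 < Re sg * Re sg + Im sg * Im sg)%R).
  { apply Cmod_gt_0 in NS. 
    replace (Re sg * Re sg + Im sg * Im sg)%R with (Re sg ^ 2 + Im sg ^ 2)%R by ring.
    rewrite <- Cmod2_alt. nra. }
  replace (orient (RtoC 0, RtoC (- k1) * sg) (RtoC 0, RtoC k2 * (Ci * sg)))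
    with (- (k1 * k2 * (Re sg * Re sg + Im sg * Im sg)))%R.
  - assert (0 < k1 * k2)%R by now apply Rmult_lt_0_compat. nra.
  - destruct sg as [x y]. unfold orient, Re, Im, Cconj, Cplus, Cmult, Ci, RtoC; simpl. ring.
Qed.

Lemma oval_meet i L M s t : (1 <= i)%nat -> (S (S i) <= 2 * d)%nat -> is_oval i L -> is_oval (S i) M ->
  (0 <= s < 1)%R -> (0 <= t < 1)%R -> (point L s = point M t <-> s = (1 / 2)%R /\ t = 0%R).
Proof.
  intros Hi Hi' [HL _] [HM _] Hs Ht. rewrite HL, HM. split.
  - intros E. apply (f_equal fst) in E. simpl in E. apply RtoC_inj in E.
    assert (X := oval_x_range i s ltac:(lia)). assert (Y := oval_x_range (S i) t ltac:(lia)).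
    assert (RP1 := rad_pos i ltac:(lia)). assert (RP2 := rad_pos (S i) ltac:(lia)).
    assert (E1 : oval_x i s = c (S i)) by lra. assert (E2 : oval_x (S i) t = c (S i)) by lra.
    split.
    + apply cos_eq_m1; [exact Hs|]. unfold oval_x, mid in E1. 
      apply (Rmult_eq_reg_l (rad i)); [|lra]. unfold rad in *. lra.
    + apply cos_eq_1; [exact Ht|]. unfold oval_x, mid in E2. 
      apply (Rmult_eq_reg_l (rad (S i))); [|lra]. unfold rad in *. lra.
  - intros [-> ->]. unfold oval_x, oval_y. 
    replace (2 * PI * (1 / 2))%R with PI by field. rewrite Rmult_0_r, cos_PI, sin_PI, cos_0, sin_0, !Rmult_0_r.
    f_equal; [|ring]. f_equal. unfold mid, rad. field.
Qed.

Lemma oval_next i L M : (1 <= i)%nat -> (S (S i) <= 2 * d)%nat -> is_oval i L -> is_oval (S i) M ->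
  transversal_count L M (-1) /\ transversal_count M L 1.
Proof.
  intros Hi Hi' HL HM. assert (O := oval_orient i L M Hi Hi' HL HM). split.
  - exists ((1 / 2, 0)%R :: nil). split; [repeat constructor; intros [] | split; [|split]].
    + intros s t. split.
      * intros [E|[]]. injection E as <- <-. split; [lra|]. split; [lra|].
        apply (oval_meet i L M); auto; lra.
      * intros [Hs [Ht E]]. apply (oval_meet i L M) in E; auto. destruct E as [-> ->]. now left.
    + intros s t [E|[]]. injection E as <- <-. lra.
    + simpl. unfold Zsign. destruct (Rlt_dec 0 _); [lra|]. destruct (Rlt_dec _ 0); [reflexivity|lra].
  - rewrite orient_anti in O. 
    exists ((0, 1 / 2)%R :: nil). split; [repeat constructor; intros [] | split; [|split]].
    + intros s t. split.
      * intros [E|[]]. injection E as <- <-. split; [lra|]. split; [lra|].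
        symmetry. apply (oval_meet i L M); auto; lra.
      * intros [Hs [Ht E]]. symmetry in E. apply (oval_meet i L M) in E; auto. destruct E as [-> ->]. now left.
    + intros s t [E|[]]. injection E as <- <-. lra.
    + simpl. unfold Zsign. destruct (Rlt_dec 0 _); [reflexivity|lra].
Qed.

Lemma oval_far i k L M : (1 <= i)%nat -> (S i < k < 2 * d)%nat -> is_oval i L -> is_oval k M ->
  transversal_count L M 0 /\ transversal_count M L 0.
Proof.
  intros Hi Hk [HL _] [HM _].
  assert (N : forall s t, point L s <> point M t).
  { intros s t E. rewrite HL, HM in E. apply (f_equal fst) in E. simpl in E. apply RtoC_inj in E.
    assert (X := oval_x_range i s ltac:(lia)). assert (Y := oval_x_range k t ltac:(lia)).
    assert (c k < c (S i))%R by (apply c_decr; lia). lra. }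
  split; exists nil; (split; [constructor | split; [|split; [intros s t []|reflexivity]]]);
    intros s t; (split; [intros []|]); intros [_ [_ E]]; [|symmetry in E]; now apply N in E.
Qed.

(** * Values on the real axis *)

Definition real_on_R (f : C -> C) : Prop := forall x : R, Im (f (RtoC x)) = 0%R.

Lemma real_eq (z : C) : Im z = 0%R -> z = RtoC (Re z).
Proof. intros H. destruct z as [a b]. unfold Im, Re, RtoC in *; simpl in *. now subst. Qed.

Lemma Ci_pow_neq0 n : Ci ^ n <> 0.
Proof.
  induction n as [|n IH]; simpl; [intros E; apply RtoC_inj in E; lra | apply Cmult_neq_0; auto using Ci_neq0].
Qed.

Lemma rt_R_true k x : (x <= c k)%R -> rt true k (RtoC x) = Ci * RtoC (sqrt (c k - x)).
Proof. intros H. unfold rt. rewrite <- RtoC_minus, csqrt_R by lra. reflexivity. Qed.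

Lemma rt_R_false k x : (c k <= x)%R -> rt false k (RtoC x) = RtoC (sqrt (x - c k)).
Proof. intros H. unfold rt. rewrite <- RtoC_minus, csqrt_R by lra. reflexivity. Qed.

(** Used with u = i, the phase of the root of a negative number, and later with
    u = -1. *)
Lemma cprod_phase (u : C) (g : nat -> C) m n :
  (forall k, (1 <= k <= n)%nat -> exists s : R, (0 < s)%R /\ g k = (if Nat.leb k m then u else 1) * RtoC s) ->
  exists s : R, (0 < s)%R /\ cprod g (seq 1 n) = u ^ (Nat.min m n) * RtoC s.
Proof.
  assert (A : forall l1 l2, cprod g (l1 ++ l2) = cprod g l1 * cprod g l2).
  { induction l1 as [|a l IH]; intros l2; simpl; [ring | rewrite IH; ring]. }
  induction n as [|n IH]; intros H.
  - exists 1%R. split; [lra|]. rewrite Nat.min_0_r. simpl. ring.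
  - destruct IH as [s [Hs E]]; [intros; apply H; lia|].
    destruct (H (S n)) as [s' [Hs' E']]; [lia|].
    exists (s * s')%R. split; [now apply Rmult_lt_0_compat|].
    rewrite seq_S, A, E. change (1 + n)%nat with (S n). simpl cprod. rewrite E', RtoC_mult.
    destruct (Nat.leb_spec (S n) m).
    + replace (Nat.min m (S n)) with (S (Nat.min m n)) by lia. simpl. ring.
    + replace (Nat.min m (S n)) with (Nat.min m n) by lia. ring.
Qed.

Lemma rt_phase (b : bool) k x : rt_dom b k (RtoC x) ->
  exists s : R, (0 < s)%R /\ rt b k (RtoC x) = (if b then Ci else 1) * RtoC s.
Proof.
  intros H. apply rt_dom_real in H; [|reflexivity]. unfold Re in H; simpl in H. destruct b.
  - exists (sqrt (c k - x)). split; [apply sqrt_lt_R0; lra | apply rt_R_true; lra].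
  - exists (sqrt (x - c k)). split; [apply sqrt_lt_R0; lra | rewrite rt_R_false by lra; ring].
Qed.

Lemma interval_root_phase i x : (i <= 2 * d)%nat -> interval_slit i (RtoC x) ->
  exists s : R, (0 < s)%R /\ interval_root i (RtoC x) = Ci ^ i * RtoC s.
Proof.
  intros Hi HD.
  destruct (cprod_phase Ci (fun k => rt (Nat.leb k i) k (RtoC x)) i (2 * d)) as [s [Hs E]].
  - intros k Hk. apply rt_phase. now apply HD.
  - exists s. split; [exact Hs|]. rewrite Nat.min_l in E by exact Hi. exact E.
Qed.

Lemma chart_root_phase j x : (1 <= j <= 2 * d)%nat -> chart_slit j (RtoC x) ->
  exists s : R, (0 < s)%R /\ chart_root j (RtoC x) = Ci ^ (j - 1) * RtoC s.
Proof.
  intros Hj HU.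
  destruct (cprod_phase Ci (fun k => if skip_one j k then 1 else rt (Nat.leb k j) k (RtoC x)) (j - 1) (2 * d)) as [s [Hs E]].
  - intros k Hk. destruct (skip_one j k) eqn:Ek.
    + exists 1%R. split; [lra|]. apply Nat.eqb_eq in Ek.
      replace (Nat.leb k (j - 1)) with false by (symmetry; apply Nat.leb_gt; lia). ring.
    + destruct (rt_phase (Nat.leb k j) k x) as [s [Hs E]]; [now apply HU|].
      exists s. split; [exact Hs|]. rewrite E. apply Nat.eqb_neq in Ek.
      destruct (Nat.leb_spec k j), (Nat.leb_spec k (j - 1)); try lia; reflexivity.
  - exists s. split; [exact Hs|]. rewrite Nat.min_l in E by lia. exact E.
Qed.

Definition abs_root (x : R) : R := sqrt (Rabs (Re (branch_poly d c (RtoC x)))).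

Lemma Ci_pow_even n : Ci ^ (2 * n) = RtoC ((-1) ^ n).
Proof.
  induction n as [|n IH]; [reflexivity|].
  replace (2 * S n)%nat with (S (S (2 * n))) by lia.
  change (Ci ^ S (S (2 * n))) with (Ci * (Ci * Ci ^ (2 * n))). rewrite IH, Cmult_assoc, Ci_sq.
  change ((-1) ^ S n)%R with (-1 * (-1) ^ n)%R.
  rewrite RtoC_mult. rewrite RtoC_m1. ring.
Qed.

Lemma pow_m1_sign n : ((-1) ^ n = 1 \/ (-1) ^ n = -1)%R.
Proof. induction n as [|n IH]; simpl; [now left | destruct IH as [-> | ->]; [right|left]; lra]. Qed.

Lemma branch_poly_R i x : (i <= 2 * d)%nat -> interval_slit i (RtoC x) ->
  (0 < abs_root x)%R /\ interval_root i (RtoC x) = Ci ^ i * RtoC (abs_root x) /\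
  Re (branch_poly d c (RtoC x)) = ((-1) ^ i * (abs_root x * abs_root x))%R.
Proof.
  intros Hi HD. destruct (interval_root_phase i x Hi HD) as [s [Hs E]].
  assert (EQ : branch_poly d c (RtoC x) = RtoC ((-1) ^ i * (s * s))).
  { rewrite <- (interval_root_sq i), E. transitivity (Ci ^ i * Ci ^ i * RtoC (s * s)); [rewrite RtoC_mult; ring|].
    rewrite <- Cpow_add_r. replace (i + i)%nat with (2 * i)%nat by lia. rewrite Ci_pow_even. now rewrite <- RtoC_mult. }
  assert (Es : abs_root x = s).
  { unfold abs_root. rewrite EQ. unfold Re; simpl. rewrite Rabs_mult.
    rewrite (Rabs_right (s * s)) by nra.
    replace (Rabs ((-1) ^ i)) with 1%R by (destruct (pow_m1_sign i) as [-> | ->]; unfold Rabs; destruct Rcase_abs; lra).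
    rewrite Rmult_1_l. apply sqrt_square. lra. }
  rewrite Es, EQ. auto.
Qed.

(** If the integrand stays on a real line through 0, so does the integral. *)
Lemma prim_line (j : nat) (K : C) (h : C -> C) w : (1 <= j <= 2 * d)%nat -> holo (chart_dom j) h -> chart_dom j w ->
  K <> 0 -> (forall s, (0 <= s <= 1)%R -> Im (w * h (RtoC s * w) / K) = 0%R) ->
  exists r : R, prim h w = K * RtoC r.
Proof.
  intros Hj Hh Hw NK HR.
  set (k := fun s : R => / K * (w * h (RtoC s * w))).
  assert (Ck : forall s, (0 <= s <= 1)%R -> clim (locally s) k (k s)).
  { intros s Hs. apply clim_mult; [apply clim_const|]. apply (ray_cont (chart_dom j)); auto. now apply chart_star. }
  assert (I : is_RIntC k 0 1 (RIntC k 0 1)) by (apply cont_RIntC; [lra | exact Ck]).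
  assert (Ik : Im (RIntC k 0 1) = 0%R).
  { apply is_RIntC_Im in I. apply (is_RInt_unique (V := R_CompleteNormedModule)) in I. rewrite <- I.
    rewrite (RInt_ext _ (fun _ => 0%R)).
    - rewrite RInt_const. unfold scal; simpl. unfold mult; simpl. ring.
    - rewrite Rmin_left, Rmax_right by lra. intros s Hs. unfold k. 
      rewrite <- (HR s) by lra. f_equal. unfold Cdiv. ring. }
  exists (Re (RIntC k 0 1)). rewrite <- (real_eq _ Ik). rewrite <- RIntC_scal by (lra || auto).
  unfold prim. apply RIntC_ext; [lra|]. intros s _. unfold k. field. exact NK.
Qed.

(** The coordinates of the points with real z in the chart of a branch
    point. *)
Definition axis (w : C) : Prop := exists y : R, w = RtoC y \/ w = Ci * RtoC y.

Lemma axis_sq w : axis w -> exists y : R, w * w = RtoC y.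
Proof.
  intros [y [-> | ->]].
  - exists (y * y)%R. now rewrite RtoC_mult.
  - exists (- (y * y))%R. rewrite RtoC_opp, RtoC_mult. transitivity (Ci * Ci * (RtoC y * RtoC y)); [ring|].
    rewrite Ci_sq. ring.
Qed.

Lemma axis_scal w (s : R) : axis w -> axis (RtoC s * w).
Proof.
  intros [y [-> | ->]]; exists (s * y)%R; [left | right]; rewrite RtoC_mult; ring.
Qed.

Lemma axis_chart_z j w : axis w -> exists x : R, chart_z j w = RtoC x.
Proof.
  intros H. destruct (axis_sq w H) as [y E]. exists (c j + y)%R. unfold chart_z. now rewrite E, RtoC_plus.
Qed.

Lemma chart_form_axis j f w : (1 <= j <= 2 * d)%nat -> real_on_R f -> axis w -> chart_dom j w ->
  exists r : R, chart_form j f w = RtoC r / Ci ^ (j - 1).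
Proof.
  intros Hj Hf Hw HD. destruct (axis_chart_z j w Hw) as [x Ex].
  unfold chart_dom in HD. rewrite Ex in HD. destruct (chart_root_phase j x Hj HD) as [s [Hs Es]].
  exists (2 * Re (f (RtoC x)) / s)%R. unfold chart_form. rewrite Ex, Es, (real_eq _ (Hf x)).
  rewrite RtoC_div, RtoC_mult by lra. simpl Re.
  assert (Ns : RtoC s <> 0) by (apply RtoC_neq0; lra).
  assert (NC := Ci_pow_neq0 (j - 1)). cfield.
Qed.

Lemma chart_prim_axis j f w : (1 <= j <= 2 * d)%nat -> entire f -> real_on_R f -> axis w -> chart_dom j w ->
  exists r : R, chart_prim j f w = w / Ci ^ (j - 1) * RtoC r.
Proof.
  intros Hj Hf HR Hw HD.
  destruct (Ceq_dec w 0) as [->|Nw].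
  { exists 0%R. rewrite chart_prim_0. ring. }
  assert (NC := Ci_pow_neq0 (j - 1)).
  apply (prim_line j); auto.
  - now apply chart_form_holo.
  - apply Cmult_neq_0; [exact Nw|]. intros E. apply (Cmult_neq_0 (Ci ^ (j-1)) (/ Ci ^ (j-1))) ; auto.
    + intros E'. rewrite E' in E. 
      assert (Ci ^ (j - 1) * / Ci ^ (j - 1) = 1) by (field; exact NC). rewrite E', Cmult_0_r in H. apply RtoC_inj in H. lra.
    + rewrite E. ring.
  - intros s Hs. destruct (chart_form_axis j f (RtoC s * w) Hj HR (axis_scal w s Hw)) as [r Er].
    { now apply chart_star. }
    rewrite Er. replace (w * (RtoC r / Ci ^ (j - 1)) / (w / Ci ^ (j - 1))) with (RtoC r) by cfield. reflexivity.
Qed.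

Lemma axis_rt_true k x : (x <= c k)%R -> axis (rt true k (RtoC x)).
Proof. intros H. exists (sqrt (c k - x)). right. now apply rt_R_true. Qed.

Lemma axis_rt_false k x : (c k <= x)%R -> axis (rt false k (RtoC x)).
Proof. intros H. exists (sqrt (x - c k)). left. now apply rt_R_false. Qed.

Lemma chart_dom_rt b j z : chart_slit j z -> chart_dom j (rt b j z).
Proof. unfold chart_dom. now rewrite chart_z_rt. Qed.

Lemma interval_slit_interval i x : (1 <= i < 2 * d)%nat -> (c (S i) < x < c i)%R -> interval_slit i (RtoC x).
Proof. intros Hi Hx. apply interval_slit_R; intros; (lra || lia). Qed.

Lemma chart_prim_right_real i f x : (1 <= i < 2 * d)%nat -> entire f -> real_on_R f -> (c (S i) < x < c i)%R ->
  Im (Ci ^ i * chart_prim (S i) f (rt false (S i) (RtoC x))) = 0%R.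
Proof.
  intros Hi Hf HR Hx. assert (HD := interval_slit_interval i x Hi Hx).
  destruct (chart_prim_axis (S i) f (rt false (S i) (RtoC x))) as [r Er]; auto; [lia | apply axis_rt_false; lra | | ].
  { now apply chart_dom_rt, interval_slit_chart_slit_right. }
  rewrite Er, rt_R_false by lra. replace (S i - 1)%nat with i by lia.
  assert (NC := Ci_pow_neq0 i).
  match goal with |- Im ?a = _ => replace a with (RtoC (sqrt (x - c (S i)) * r)) by (rewrite RtoC_mult; cfield) end.
  reflexivity.
Qed.

Lemma chart_prim_left_real i f x : (1 <= i < 2 * d)%nat -> entire f -> real_on_R f -> (c (S i) < x < c i)%R ->
  Im (Ci ^ i * chart_prim i f (rt true i (RtoC x))) = 0%R.
Proof.
  intros Hi Hf HR Hx. assert (HD := interval_slit_interval i x Hi Hx).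
  destruct (chart_prim_axis i f (rt true i (RtoC x))) as [r Er]; auto; [lia | apply axis_rt_true; lra | | ].
  { now apply chart_dom_rt, interval_slit_chart_slit_left. }
  rewrite Er, rt_R_true by lra.
  assert (NC := Ci_pow_neq0 (i - 1)).
  replace (Ci ^ i) with (Ci * Ci ^ (i - 1)) by (replace i with (S (i - 1)) at 2 by lia; reflexivity).
  match goal with |- Im ?a = _ => replace a with (RtoC (- (sqrt (c i - x) * r))) end; [reflexivity|].
  rewrite RtoC_opp, RtoC_mult. transitivity ((Ci * Ci) * (RtoC (sqrt (c i - x)) * RtoC r)); [rewrite Ci_sq; ring | cfield].
Qed.

(** On the interval number k one has [interval_root k] = i^k |Q|^(1/2), so the
    half period of a real differential lies on the line of (-i)^k; it is real
    over gaps and imaginary over bands. *)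
Definition real_period (i : nat) (f : C -> C) : R := Re (Ci ^ i * half_period i f).

Lemma half_period_real_period i f : (1 <= i < 2 * d)%nat -> entire f -> real_on_R f ->
  Ci ^ i * half_period i f = RtoC (real_period i f).
Proof.
  intros Hi Hf HR. apply real_eq. unfold half_period.
  assert (M := mid_between i Hi).
  assert (A := chart_prim_left_real i f (mid i) Hi Hf HR M). assert (B := chart_prim_right_real i f (mid i) Hi Hf HR M).
  replace (Ci ^ i * (chart_prim i f (rt true i (RtoC (mid i))) - chart_prim (S i) f (rt false (S i) (RtoC (mid i)))))
    with (Ci ^ i * chart_prim i f (rt true i (RtoC (mid i))) - Ci ^ i * chart_prim (S i) f (rt false (S i) (RtoC (mid i)))) by ring.
  unfold Im in *; simpl in *. lra.
Qed.

(** * Integrals over the intervals between branch points *)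

Lemma at_right_imp (a b : R) (P : R -> Prop) : (a < b)%R -> (forall x, (a < x < b)%R -> P x) -> at_right a P.
Proof.
  intros Hab H. assert (Q : (0 < b - a)%R) by lra. exists (mkposreal _ Q). intros y Hy Hy'. apply H.
  unfold ball in Hy; simpl in Hy. unfold AbsRing_ball, abs, minus, plus, opp in Hy; simpl in Hy. split_Rabs; lra.
Qed.

Lemma at_left_imp (a b : R) (P : R -> Prop) : (a < b)%R -> (forall x, (a < x < b)%R -> P x) -> at_left b P.
Proof.
  intros Hab H. assert (Q : (0 < b - a)%R) by lra. exists (mkposreal _ Q). intros y Hy Hy'. apply H.
  unfold ball in Hy; simpl in Hy. unfold AbsRing_ball, abs, minus, plus, opp in Hy; simpl in Hy. split_Rabs; lra.
Qed.

Lemma RInt_gen_prim {V : CompleteNormedModule R_AbsRing} (F f : R -> V) (a b : R) (la lb : V) : (a < b)%R ->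
  (forall x, (a < x < b)%R -> is_derive F x (f x) /\ continuous f x) ->
  filterlim F (at_right a) (locally la) -> filterlim F (at_left b) (locally lb) ->
  is_RInt_gen f (at_right a) (at_left b) (minus lb la).
Proof.
  intros Hab HF Ha Hb.
  assert (HL : filterlim (fun ab : R * R => minus (F (snd ab)) (F (fst ab))) (filter_prod (at_right a) (at_left b)) (locally (minus lb la))).
  { apply (filterlim_comp_2 (F := filter_prod (at_right a) (at_left b)) (G := locally lb) (H := locally (opp la))
      (fun ab => F (snd ab)) (fun ab => opp (F (fst ab))) plus).
    - apply (filterlim_comp _ _ _ snd F _ (at_left b)); [apply filterlim_snd | exact Hb].
    - apply (filterlim_comp _ _ _ (fun ab => F (fst ab)) opp _ (locally la)); [|exact (@filterlim_opp _ (CompleteNormedModule.NormedModule R_AbsRing V) la)].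
      apply (filterlim_comp _ _ _ fst F _ (at_right a)); [apply filterlim_fst | exact Ha].
    - exact (@filterlim_plus _ (CompleteNormedModule.NormedModule R_AbsRing V) lb (opp la)). }
  intros P HP. generalize (HL P HP). unfold filtermap, filtermapi. intros H1.
  set (mm := ((a + b) / 2)%R).
  assert (H2 : filter_prod (at_right a) (at_left b) (fun ab : R * R => (a < fst ab < mm /\ mm < snd ab < b)%R)).
  { apply (Filter_prod _ _ _ (fun x => (a < x < mm)%R) (fun x => (mm < x < b)%R)).
    - apply (at_right_imp a mm); [unfold mm; lra | auto].
    - apply (at_left_imp mm b); [unfold mm; lra | auto].
    - auto. }
  generalize (filter_and _ _ H1 H2). apply filter_imp. intros [x y] [K1 [K2 K3]]. simpl in *.
  exists (minus (F y) (F x)). split; [|exact K1].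
  apply (is_RInt_derive F f); rewrite Rmin_left, Rmax_right by lra; intros t Ht; apply HF; lra.
Qed.

Lemma abs_root_cont_pos i x : (i <= 2 * d)%nat -> interval_slit i (RtoC x) -> (0 < abs_root x)%R.
Proof. intros Hi HD. now apply (branch_poly_R i). Qed.

(** A real primitive of f / |Q|^(1/2) on the interval number i. *)
Definition interval_prim (i : nat) (f : C -> C) (x : R) : R := Re (Ci ^ i * chart_prim (S i) f (rt false (S i) (RtoC x))).

Section RealInterval.
Variables (i : nat) (f : C -> C).
Hypotheses (Hi : (1 <= i < 2 * d)%nat) (Hf : entire f) (HR : real_on_R f).

Lemma interval_prim_derivC x : (c (S i) < x < c i)%R ->
  is_derivC (fun x => Ci ^ i * chart_prim (S i) f (rt false (S i) (RtoC x))) x (f (RtoC x) / RtoC (abs_root x)) /\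
  clim (locally x) (fun x => f (RtoC x) / RtoC (abs_root x)) (f (RtoC x) / RtoC (abs_root x)).
Proof.
  intros Hx. assert (HD := interval_slit_interval i x Hi Hx). 
  destruct (branch_poly_R i x ltac:(lia) HD) as [P [ET _]].
  assert (NC := Ci_pow_neq0 i).
  assert (Nq : RtoC (abs_root x) <> 0) by (apply RtoC_neq0; lra).
  assert (E : f (RtoC x) / RtoC (abs_root x) = Ci ^ i * (f (RtoC x) / interval_root i (RtoC x))).
  { rewrite ET. cfield. }
  split.
  - rewrite E. apply (is_derivC_eq _ _ (0 * chart_prim (S i) f (rt false (S i) (RtoC x)) + Ci ^ i * (f (RtoC x) / interval_root i (RtoC x) * 1))); [ring|].
    apply (is_derivC_mult (fun _ => Ci ^ i) (fun x => chart_prim (S i) f (rt false (S i) (RtoC x)))); [apply is_derivC_const|].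
    apply (is_derivC_comp (fun u => chart_prim (S i) f (rt false (S i) u)) (fun x => RtoC x)); [|apply is_derivC_id].
    apply chart_prim_rt_deriv; auto; lia.
  - rewrite E. apply (clim_ext_loc (fun x => Ci ^ i * (f (RtoC x) / interval_root i (RtoC x)))).
    + generalize (clim_cnear _ (interval_slit i) _ (clim_RtoC x) (rt_prod_open _ _ _ HD)). apply filter_imp. intros y Hy.
      destruct (branch_poly_R i y ltac:(lia) Hy) as [P' [ET' _]]. rewrite ET'.
      assert (RtoC (abs_root y) <> 0) by (intros E'; apply RtoC_inj in E'; lra). cfield.
    + apply clim_mult; [apply clim_const|]. apply (clim_ccont (fun x => RtoC x) (fun u => f u / interval_root i u) _ (clim_RtoC x)).
      apply clim_div.
      * now apply rt_prod_neq0.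
      * now apply (holo_cont (fun _ => True)).
      * apply (holo_cont (interval_slit i)); [apply rt_prod_holo | exact HD].
Qed.

Lemma clim_sqrt_0 (F : (R -> Prop) -> Prop) {FF : Filter F} (u : R -> R) (a : R) :
  filter_le F (locally a) -> ex_derive u a -> u a = 0%R ->
  clim F (fun x => RtoC (sqrt (u x))) 0.
Proof.
  intros HF Hu E e He.
  assert (Cu : continuous u a) by exact (ex_derive_continuous u a Hu).
  assert (Cs : continuous (fun x => sqrt (u x)) a).
  { apply continuous_comp; [exact Cu | apply continuous_sqrt]. }
  unfold continuous in Cs. rewrite E, sqrt_0 in Cs.
  specialize (Cs (fun y => (Rabs y < e)%R)). apply HF.
  apply (filter_imp (fun x => (Rabs (sqrt (u x)) < e)%R)).
  - intros x Hx. rewrite <- RtoC_minus, Cmod_R, Rminus_0_r. exact Hx.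
  - apply Cs. exists (mkposreal e He). intros y Hy. unfold ball in Hy; simpl in Hy. 
    unfold AbsRing_ball, abs, minus, plus, opp in Hy; simpl in Hy. now rewrite Ropp_0, Rplus_0_r in Hy.
Qed.

Lemma interval_prim_lim_right : 
  clim (at_right (c (S i))) (fun x => Ci ^ i * chart_prim (S i) f (rt false (S i) (RtoC x))) 0.
Proof.
  apply (clim_eq _ (Ci ^ i * chart_prim (S i) f 0)); [rewrite chart_prim_0; ring|].
  apply clim_mult; [apply clim_const|].
  apply (clim_ccont (fun x => rt false (S i) (RtoC x)) (chart_prim (S i) f)).
  - apply (clim_ext_loc (fun x => RtoC (sqrt (x - c (S i))))).
    + apply (at_right_imp _ (c i)); [apply hc; lia|]. intros x Hx. rewrite rt_R_false by lra. reflexivity.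
    + apply (clim_sqrt_0 _ (fun x => (x - c (S i))%R) (c (S i))); [apply filter_le_within| |ring].
      exists 1%R. auto_derive; [trivial | ring].
  - apply (holo_cont (chart_dom (S i))); [apply chart_prim_holo; auto; lia | apply chart_0; lia].
Qed.

Lemma interval_prim_lim_left : 
  clim (at_left (c i)) (fun x => Ci ^ i * chart_prim (S i) f (rt false (S i) (RtoC x))) (- (Ci ^ i * half_period i f)).
Proof.
  apply (clim_eq _ (Ci ^ i * (chart_prim i f 0 - half_period i f))); [rewrite chart_prim_0; ring|].
  apply (clim_ext_loc (fun x => Ci ^ i * (chart_prim i f (rt true i (RtoC x)) - half_period i f))).
  { apply (at_left_imp (c (S i))); [apply hc; lia|]. intros x Hx.
    rewrite <- (half_period_eq i f (RtoC x)) by (auto; now apply interval_slit_interval). ring. }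
  apply clim_mult; [apply clim_const|]. apply clim_minus; [|apply clim_const].
  apply (clim_ccont (fun x => rt true i (RtoC x)) (chart_prim i f)).
  - apply (clim_ext_loc (fun x => Ci * RtoC (sqrt (c i - x)))).
    + apply (at_left_imp (c (S i))); [apply hc; lia|]. intros x Hx. rewrite rt_R_true by lra. reflexivity.
    + apply (clim_eq _ (Ci * 0)); [ring|]. apply clim_mult; [apply clim_const|].
      apply (clim_sqrt_0 _ (fun x => (c i - x)%R) (c i)); [apply filter_le_within| |ring].
      exists (-1)%R. auto_derive; [trivial | ring].
  - apply (holo_cont (chart_dom i)); [apply chart_prim_holo; auto; lia | apply chart_0; lia].
Qed.

Lemma interval_integral_C : is_RInt_gen (V := C_R_NormedModule) (fun x => f (RtoC x) / RtoC (abs_root x))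
  (at_right (c (S i))) (at_left (c i)) (- (Ci ^ i * half_period i f)).
Proof.
  replace (- (Ci ^ i * half_period i f)) with (minus (G := C_R_NormedModule) (- (Ci ^ i * half_period i f)) (RtoC 0)).
  - apply (RInt_gen_prim (V := C_R_CompleteNormedModule) (fun x => Ci ^ i * chart_prim (S i) f (rt false (S i) (RtoC x)))).
    + now apply hc.
    + intros x Hx. destruct (interval_prim_derivC x Hx) as [A B]. split; [exact A | now apply continuousC].
    + apply clim_filterlim; [typeclasses eauto | apply interval_prim_lim_right].
    + apply clim_filterlim; [typeclasses eauto | apply interval_prim_lim_left].
  - change (- (Ci ^ i * half_period i f) - 0 = - (Ci ^ i * half_period i f)). ring.
Qed.

Lemma interval_prim_deriv x : (c (S i) < x < c i)%R ->
  is_derive (interval_prim i f) x (Re (f (RtoC x)) / abs_root x)%R /\ continuous (fun x => Re (f (RtoC x)) / abs_root x)%R x.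
Proof.
  intros Hx. destruct (interval_prim_derivC x Hx) as [A B].
  assert (P : (0 < abs_root x)%R) by (apply (abs_root_cont_pos i); [lia | now apply interval_slit_interval]).
  assert (E : forall y, (0 < abs_root y)%R -> Re (f (RtoC y) / RtoC (abs_root y)) = (Re (f (RtoC y)) / abs_root y)%R).
  { intros y Hy. rewrite (real_eq _ (HR y)) at 1. rewrite <- RtoC_div by lra. reflexivity. }
  split.
  - apply is_derivC_Re in A. rewrite (E x P) in A. exact A.
  - apply (continuous_ext_loc _ (fun x => Re (f (RtoC x) / RtoC (abs_root x)))).
    + generalize (clim_cnear _ (interval_slit i) _ (clim_RtoC x) (rt_prod_open _ _ _ (interval_slit_interval i x Hi Hx))).
      apply filter_imp. intros y Hy. apply E. now apply (abs_root_cont_pos i); [lia|].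
    + apply clim_Re in B; [|apply locally_filter]. exact B.
Qed.

Lemma interval_prim_right : filterlim (interval_prim i f) (at_right (c (S i))) (locally 0%R).
Proof. apply (clim_Re _ _ _ interval_prim_lim_right). Qed.

Lemma interval_prim_left : filterlim (interval_prim i f) (at_left (c i)) (locally (- real_period i f)%R).
Proof.
  replace (- real_period i f)%R with (Re (- (Ci ^ i * half_period i f))) by (unfold real_period, Re; simpl; ring).
  apply (clim_Re _ _ _ interval_prim_lim_left).
Qed.

Lemma interval_integral_R : is_RInt_gen (V := R_NormedModule) (fun x => Re (f (RtoC x)) / abs_root x)%R
  (at_right (c (S i))) (at_left (c i)) (- real_period i f)%R.
Proof.
  replace (- real_period i f)%R with (minus (G := R_NormedModule) (- real_period i f)%R 0%R).
  - apply (RInt_gen_prim (V := R_CompleteNormedModule) (interval_prim i f)).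
    + now apply hc.
    + intros x Hx. now apply interval_prim_deriv.
    + apply interval_prim_right.
    + apply interval_prim_left.
  - unfold minus, plus, opp; simpl. ring.
Qed.

(** The primitive [interval_prim] increases strictly from its limit 0 at
    c_{i+1} to its limit at c_i, which is minus the half period. *)
Lemma real_period_neg : (forall x, (c (S i) < x < c i)%R -> (0 < Re (f (RtoC x)))%R) -> (real_period i f < 0)%R.
Proof.
  intros Hpos.
  assert (HI : forall x y, (c (S i) < x)%R -> (x < y)%R -> (y < c i)%R -> (interval_prim i f x < interval_prim i f y)%R).
  { intros x y. apply (incr_function (interval_prim i f) (c (S i)) (c i) (fun x => Re (f (RtoC x)) / abs_root x)%R).
    - intros t H1 H2. apply interval_prim_deriv. split; [exact H1 | exact H2].
    - intros t H1 H2. simpl in *. apply Rdiv_lt_0_compat; [apply Hpos; lra|].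
      apply (abs_root_cont_pos i); [lia | apply interval_slit_interval; [exact Hi | lra]]. }
  set (x1 := ((2 * c (S i) + c i) / 3)%R). set (x2 := ((c (S i) + 2 * c i) / 3)%R).
  assert (Hc := hc i Hi).
  assert (L1 : Rbar_le 0%R (interval_prim i f x1)).
  { apply (filterlim_le (F := at_right (c (S i))) (interval_prim i f) (fun _ => interval_prim i f x1)).
    - apply (at_right_imp _ x1); [unfold x1; lra|]. intros x Hx. left. apply HI; unfold x1 in *; lra.
    - apply interval_prim_right.
    - apply filterlim_const. }
  assert (L2 : Rbar_le (interval_prim i f x2) (- real_period i f)%R).
  { apply (filterlim_le (F := at_left (c i)) (fun _ => interval_prim i f x2) (interval_prim i f)).
    - apply (at_left_imp x2); [unfold x2; lra|]. intros x Hx. left. apply HI; unfold x2 in *; lra.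
    - apply filterlim_const.
    - apply interval_prim_left. }
  simpl in L1, L2. assert (interval_prim i f x1 < interval_prim i f x2)%R by (apply HI; unfold x1, x2; lra). lra.
Qed.
End RealInterval.

Lemma real_period_opp i f : (1 <= i < 2 * d)%nat -> entire f -> real_period i (fun z => - f z) = (- real_period i f)%R.
Proof.
  intros Hi Hf. unfold real_period.
  replace (half_period i (fun z => - f z)) with (- (1) * half_period i f).
  - unfold Re; simpl; ring.
  - rewrite <- half_period_scal by assumption. apply half_period_ext. intros z. ring.
Qed.

Lemma real_cont f : entire f -> Ranalysis1.continuity (fun x => Re (f (RtoC x))).
Proof.
  intros Hf x. apply continuity_pt_filterlim. 
  apply (clim_Re (locally x) (fun x => f (RtoC x))).
  apply (clim_ccont (fun x => RtoC x) f _ (clim_RtoC x)). now apply (holo_cont (fun _ => True)).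
Qed.

Lemma no_root_sign f a b : entire f -> (forall x, (a < x < b)%R -> Re (f (RtoC x)) <> 0%R) ->
  (forall x, (a < x < b)%R -> (0 < Re (f (RtoC x)))%R) \/ (forall x, (a < x < b)%R -> (Re (f (RtoC x)) < 0)%R).
Proof.
  intros Hf HN.
  destruct (classic (exists x, (a < x < b)%R /\ (0 < Re (f (RtoC x)))%R)) as [[x [Hx Px]]|N].
  - left. intros y Hy. destruct (Rtotal_order (Re (f (RtoC y))) 0) as [L|[L|L]]; [exfalso | exfalso; now apply (HN y) | exact L].
    destruct (IVT_gen (fun x => Re (f (RtoC x))) x y 0) as [t [Ht Et]].
    + now apply real_cont.
    + rewrite Rmin_right, Rmax_left by lra. lra.
    + apply (HN t); [|exact Et]. unfold Rmin, Rmax in Ht. destruct (Rle_dec x y); lra.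
  - right. intros y Hy. destruct (Rtotal_order (Re (f (RtoC y))) 0) as [L|[L|L]]; [exact L | exfalso; now apply (HN y) | exfalso].
    apply N. now exists y.
Qed.

Lemma real_period_0_root i f : (1 <= i < 2 * d)%nat -> entire f -> real_on_R f -> real_period i f = 0%R ->
  exists x, (c (S i) < x < c i)%R /\ f (RtoC x) = 0.
Proof.
  intros Hi Hf HR E0. apply NNPP. intros N.
  destruct (no_root_sign f (c (S i)) (c i) Hf) as [H|H].
  - intros x Hx E. apply N. exists x. split; [exact Hx|]. rewrite (real_eq _ (HR x)), E. reflexivity.
  - generalize (real_period_neg i f Hi Hf HR H). lra.
  - assert (Hn : (real_period i (fun z => (- f z)%C) < 0)%R).
    { apply real_period_neg; [exact Hi | now apply holo_opp | |].
      - intros x. generalize (HR x). unfold Im; simpl. lra.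
      - intros x Hx. generalize (H x Hx). unfold Re; simpl. lra. }
    rewrite real_period_opp in Hn by assumption. lra.
Qed.

(** * Polynomials *)

Lemma peval_entire l : entire (peval l).
Proof.
  induction l as [|a l IH]; simpl; [apply holo_const|].
  apply (holo_plus _ (fun _ => a) (fun z => z * peval l z)); [apply holo_const|].
  apply holo_mult; [apply holo_id | exact IH].
Qed.

Lemma peval_div l r : exists q, length q = pred (length l) /\
  (forall z, peval l z - peval l r = (z - r) * peval q z) /\
  ((2 <= length l)%nat -> nth (pred (length q)) q 0 = nth (pred (length l)) l 0).
Proof.
  induction l as [|a l IH].
  - exists nil. split; [reflexivity|]. split; [intros z; simpl; ring | simpl; lia].
  - destruct IH as [q [Lq [Hq Nq]]]. destruct l as [|b l].
    + exists nil. split; [reflexivity|]. split; [intros z; simpl; ring | simpl; lia].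
    + exists (peval (b :: l) r :: q). split; [simpl in *; now rewrite Lq|]. split.
      * intros z.
        change (peval (a :: b :: l) z) with (a + z * peval (b :: l) z).
        change (peval (a :: b :: l) r) with (a + r * peval (b :: l) r).
        change (peval (peval (b :: l) r :: q) z) with (peval (b :: l) r + z * peval q z).
        transitivity (z * (peval (b :: l) z - peval (b :: l) r) + (z - r) * peval (b :: l) r); [ring|].
        rewrite Hq. ring.
      * intros _. destruct l as [|e l].
        -- destruct q; [|simpl in Lq; discriminate]. simpl. ring.
        -- destruct q as [|u q]; [simpl in Lq; discriminate|]. apply Nq. simpl. lia.
Qed.

Lemma peval_roots rs : forall l, NoDup rs -> (length l <= length rs)%nat ->
  (forall r, In r rs -> peval l r = 0) -> forall z, peval l z = 0.
Proof.
  induction rs as [|r rs IH]; intros l ND HL HR z.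
  - destruct l; [reflexivity | simpl in HL; lia].
  - inversion ND as [|? ? N ND']; subst. destruct (peval_div l r) as [q [Lq [Hq _]]].
    assert (E0 : peval l r = 0) by (apply HR; now left).
    assert (E : forall z, peval l z = (z - r) * peval q z).
    { intros u. rewrite <- Hq, E0. ring. }
    rewrite E. rewrite (IH q ND').
    + ring.
    + rewrite Lq. simpl in HL. lia.
    + intros s Hs. assert (Es := E s). rewrite HR in Es by now right.
      destruct (Ceq_dec (peval q s) 0) as [K|K]; [exact K|exfalso].
      apply (Cmult_neq_0 (s - r) (peval q s)); [|exact K|now symmetry].
      intros E1. apply N. replace r with (s - (s - r)) by ring. rewrite E1. now replace (s - 0) with s by ring.
Qed.

Lemma peval_factor (rs : list R) : forall l, NoDup rs -> length l = S (length rs) ->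
  (forall r, In r rs -> peval l (RtoC r) = 0) ->
  forall z, peval l z = nth (length rs) l 0 * monic_of_roots rs z.
Proof.
  induction rs as [|r rs IH]; intros l ND HL HR z.
  - destruct l as [|a [|b l]]; try discriminate. simpl. ring.
  - inversion ND as [|? ? N ND']; subst. destruct (peval_div l (RtoC r)) as [q [Lq [Hq Nq]]].
    assert (E0 : peval l (RtoC r) = 0) by (apply HR; now left).
    assert (E : forall z, peval l z = (z - RtoC r) * peval q z).
    { intros u. rewrite <- Hq, E0. ring. }
    simpl length in HL. rewrite HL in Lq, Nq. simpl pred in Lq, Nq.
    rewrite E. rewrite (IH q ND' Lq).
    + rewrite Lq in Nq. simpl pred in Nq. rewrite Nq by lia. simpl. ring.
    + intros s Hs. assert (Es := E (RtoC s)). rewrite HR in Es by now right.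
      destruct (Ceq_dec (peval q (RtoC s)) 0) as [K|K]; [exact K|exfalso].
      apply (Cmult_neq_0 (RtoC s - RtoC r) (peval q (RtoC s))); [|exact K|now symmetry].
      intros E1. apply N. rewrite <- RtoC_minus in E1. apply RtoC_inj in E1. replace r with s by lra. exact Hs.
Qed.

Lemma peval_zero_coef l : (forall z, peval l z = 0) -> forall k, nth k l 0 = 0.
Proof.
  induction l as [|a l IH]; intros H k; [now destruct k|].
  assert (Ea : a = 0) by (rewrite <- (H 0); simpl; ring).
  destruct k as [|k]; [exact Ea|]. simpl. apply IH.
  apply (peval_roots (map (fun n => RtoC (INR n)) (seq 1 (length l)))).
  - apply FinFun.Injective_map_NoDup; [|apply seq_NoDup]. intros x y E. apply RtoC_inj in E. now apply INR_eq.
  - now rewrite length_map, length_seq.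
  - intros r Hr. apply in_map_iff in Hr. destruct Hr as [n [<- Hn]]. apply in_seq in Hn.
    assert (E := H (RtoC (INR n))). simpl in E. rewrite Ea in E.
    destruct (Ceq_dec (peval l (RtoC (INR n))) 0) as [K|K]; [exact K|exfalso].
    apply (Cmult_neq_0 (RtoC (INR n)) (peval l (RtoC (INR n)))); [|exact K|].
    + intros E1. apply RtoC_inj in E1. apply (INR_eq n 0) in E1. lia.
    + rewrite <- E. ring.
Qed.

Lemma peval_app l a z : peval (l ++ a :: nil) z = peval l z + a * z ^ length l.
Proof. induction l as [|b l IH]; simpl; [ring | rewrite IH; ring]. Qed.

Lemma peval_firstn n : forall l : list C, (forall k, (n <= k)%nat -> nth k l 0 = 0) -> forall z, peval (firstn n l) z = peval l z.
Proof.
  induction n as [|n IH]; intros l H z.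
  - simpl. induction l as [|a l IHl]; [reflexivity|]. simpl.
    assert (Ea := H 0%nat (le_n _)). simpl in Ea. rewrite Ea, <- IHl; [ring|].
    intros k Hk. exact (H (S k) ltac:(lia)).
  - destruct l as [|a l]; [reflexivity|]. simpl. rewrite IH; [reflexivity|].
    intros k Hk. exact (H (S k) ltac:(lia)).
Qed.

Section Growth.
Context {T : Type} {F : (T -> Prop) -> Prop} {FF : Filter F}.
Variable z : T -> C.
Hypotheses (Hz : clim F (fun t => / z t) 0) (Nz : F (fun t => z t <> 0)).

Lemma clim_invpow m : (0 < m)%nat -> clim F (fun t => / z t ^ m) 0.
Proof.
  intros Hm. destruct m as [|m]; [lia|].
  apply (clim_ext_loc (fun t => / z t * (/ z t) ^ m)).
  - revert Nz. apply filter_imp. intros t Nt. rewrite Cpow_inv by exact Nt. simpl.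
    assert (z t ^ m <> 0) by now apply Cpow_nz. cfield.
  - apply (clim_eq _ (0 * 0 ^ m)); [ring|]. apply clim_mult; [exact Hz | now apply clim_pow].
Qed.

Lemma peval_lim m : forall l, (length l <= S m)%nat -> clim F (fun t => peval l (z t) / z t ^ m) (nth m l 0).
Proof.
  induction m as [|m IH]; intros l Hl.
  - apply (clim_ext (fun _ => nth 0 l 0)); [|apply clim_const].
    intros t. destruct l as [|a [|b l]]; simpl in *; try lia; unfold Cdiv; replace (/ 1) with (RtoC 1) by (field; intros E; apply RtoC_inj in E; lra); ring.
  - destruct l as [|a l].
    + apply (clim_ext (fun _ => 0)); [|apply clim_const]. intros t. simpl. unfold Cdiv. ring.
    + apply (clim_ext_loc (fun t => a * / z t ^ S m + peval l (z t) / z t ^ m)).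
      * revert Nz. apply filter_imp. intros t Nt. simpl.
        assert (z t ^ m <> 0) by now apply Cpow_nz. cfield.
      * simpl nth. apply (clim_eq _ (a * 0 + nth m l 0)); [ring|].
        apply clim_plus; [apply clim_mult; [apply clim_const | apply clim_invpow; lia]|].
        apply IH. simpl in Hl. lia.
Qed.
End Growth.

(** Polynomial growth bounds the degree.  Induction on the list from its last
    coefficient: while this has index > m, dividing by a higher power of z shows
    that it is 0. *)
Lemma peval_lim_inv {T} {F : (T -> Prop) -> Prop} {FF : ProperFilter F} (z : T -> C) m lam :
  clim F (fun t => / z t) 0 -> F (fun t => z t <> 0) ->
  forall l, clim F (fun t => peval l (z t) / z t ^ m) lam ->
  (forall k, (m < k)%nat -> nth k l 0 = 0) /\ nth m l 0 = lam.
Proof.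
  intros Hz Nz l. induction l as [|a l IH] using rev_ind; intros H.
  - split; [intros [|k] _; reflexivity|].
    apply (clim_unique (fun t => peval nil (z t) / z t ^ m)); [|exact H].
    apply (peval_lim z Hz Nz). simpl. lia.
  - destruct (Nat.le_gt_cases (length l) m) as [L|L].
    + split.
      * intros k Hk. apply nth_overflow. rewrite length_app. simpl. lia.
      * apply (clim_unique (fun t => peval (l ++ a :: nil) (z t) / z t ^ m)); [|exact H].
        apply (peval_lim z Hz Nz). rewrite length_app. simpl. lia.
    + assert (Ea : a = 0).
      { replace a with (nth (length l) (l ++ a :: nil) 0) by (rewrite app_nth2, Nat.sub_diag by lia; reflexivity).
        apply (clim_unique (fun t => peval (l ++ a :: nil) (z t) / z t ^ length l)).
        - apply (peval_lim z Hz Nz). rewrite length_app. simpl. lia.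
        - apply (clim_ext_loc (fun t => (peval (l ++ a :: nil) (z t) / z t ^ m) * / z t ^ (length l - m))).
          + revert Nz. apply filter_imp. intros t Nt.
            replace (z t ^ length l) with (z t ^ m * z t ^ (length l - m)).
            * assert (z t ^ m <> 0) by now apply Cpow_nz. assert (z t ^ (length l - m) <> 0) by now apply Cpow_nz. cfield.
            * rewrite <- Cpow_add_r. f_equal. lia.
          + apply (clim_eq _ (lam * 0)); [ring|]. apply clim_mult; [exact H|]. apply clim_invpow; auto; try lia; typeclasses eauto. }
      destruct IH as [I1 I2].
      { apply (clim_ext (fun t => peval (l ++ a :: nil) (z t) / z t ^ m)); [|exact H].
        intros t. rewrite peval_app, Ea. f_equal. ring. }
      split.
      * intros k Hk. destruct (Nat.lt_ge_cases k (length l)) as [K|K].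
        -- rewrite app_nth1 by exact K. now apply I1.
        -- rewrite app_nth2 by exact K. destruct (k - length l)%nat as [|[|j]]; auto.
      * rewrite app_nth1 by exact L. exact I2.
Qed.

(** * Behaviour at infinity *)

(** The branch of mu over the closed upper half-plane with mu ~ z^d at
    infinity. *)
Definition upper_root (z : C) : C := cprod (fun k => csqrt (z - RtoC (c k))) idx.

Lemma interval_root_upper_root i z : (0 <= Im z)%R -> interval_slit i z -> interval_root i z = upper_root z.
Proof.
  intros HI HD. apply cprod_ext. intros k Hk. apply in_idx in Hk. unfold skip_none.
  assert (K := HD k Hk eq_refl). unfold rt. destruct (Nat.leb k i); [|reflexivity].
  assert (E : RtoC (c k) - z = - (z - RtoC (c k))) by ring.
  simpl in K. rewrite E in K |- *. set (u := z - RtoC (c k)) in *.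
  assert (Iu : Im u = Im z) by (unfold u, Im; simpl; ring).
  apply csqrt_opp; [lra|].
  destruct (Req_dec (Im u) 0) as [E0|N0]; [right|now left].
  destruct K as [K|K]; unfold Im, Re in *; simpl in *; lra.
Qed.

(** u = sqrt(z - a)/sqrt(z) is a quotient of two numbers of the first quadrant,
    so |u + 1| >= 1, while u^2 - 1 = - a/z. *)
Lemma csqrt_ratio z (a : R) : (0 <= Im z)%R -> z <> 0 ->
  (Cmod (csqrt (z - RtoC a) / csqrt z - 1) <= Cmod (RtoC a * / z))%R.
Proof.
  intros HI Nz. assert (Ns := csqrt_neq0 z Nz).
  set (u := csqrt (z - RtoC a) / csqrt z).
  assert (E : (u - 1) * (u + 1) = - (RtoC a * / z)).
  { transitivity (csqrt (z - RtoC a) * csqrt (z - RtoC a) / (csqrt z * csqrt z) - 1); [unfold u; cfield|].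
    rewrite !csqrt_sq. cfield. }
  assert (Re0 : (0 <= Re u)%R).
  { assert (A1 := csqrt_Re_ge0 z). assert (A2 := csqrt_Im_ge0 z HI).
    assert (A3 := csqrt_Re_ge0 (z - RtoC a)).
    assert (A4 : (0 <= Im (csqrt (z - RtoC a)))%R) by (apply csqrt_Im_ge0; unfold Im in *; simpl; lra).
    replace (Re u) with (((Re (csqrt (z - RtoC a)) * Re (csqrt z) + Im (csqrt (z - RtoC a)) * Im (csqrt z)) /
       (Re (csqrt z) ^ 2 + Im (csqrt z) ^ 2)))%R.
    - assert (0 < Cmod (csqrt z))%R by now apply Cmod_gt_0.
      rewrite <- Cmod2_alt. apply Rdiv_le_0_compat; [nra | nra].
    - unfold u, Cdiv. destruct (csqrt z) as [p q], (csqrt (z - RtoC a)) as [p' q'].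
      unfold Re, Im, Cinv, Cmult in *; simpl in *. field.
      intros E1. apply Ns. assert (p = 0%R) by nra. assert (q = 0%R) by nra. subst. reflexivity. }
  apply (f_equal Cmod) in E. rewrite Cmod_mult, Cmod_opp in E. rewrite <- E.
  assert (1 <= Cmod (u + 1))%R.
  { clearbody u. eapply Rle_trans; [|eapply Rle_trans; [apply Rle_abs | apply Re_le_mod]].
    unfold Re in *; simpl. lra. }
  generalize (Cmod_ge_0 (u - 1)). nra.
Qed.

Lemma cprod_div g (s : C) l : s <> 0 -> cprod (fun k => g k / s) l = cprod g l / s ^ length l.
Proof.
  intros N. induction l as [|a l IH]; simpl.
  - field.
  - rewrite IH. assert (s ^ length l <> 0) by now apply Cpow_nz. cfield.
Qed.

Section AtInfinity.
Context {T : Type} {F : (T -> Prop) -> Prop} {FF : Filter F}.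
Variable z : T -> C.
Hypotheses (Hz : clim F (fun t => / z t) 0) (Nz : F (fun t => z t <> 0)) (Iz : F (fun t => (0 <= Im (z t))%R)).

(** mu / z^d is a product of 2 d quotients as in [csqrt_ratio]. *)
Lemma upper_root_lim : clim F (fun t => upper_root (z t) / z t ^ d) 1.
Proof.
  apply (clim_ext_loc (fun t => cprod (fun k => csqrt (z t - RtoC (c k)) / csqrt (z t)) idx)).
  - revert Nz. apply filter_imp. intros t Nt. rewrite cprod_div by now apply csqrt_neq0.
    unfold upper_root. f_equal. rewrite length_seq. rewrite Cpow_mult_r. f_equal.
    change (csqrt (z t) ^ 2) with (csqrt (z t) * (csqrt (z t) * 1)). rewrite Cmult_1_r. apply csqrt_sq.
  - induction idx as [|k l IH]; simpl; [apply clim_const|].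
    apply (clim_eq _ (1 * 1)); [ring|]. apply clim_mult; [|exact IH].
    apply (clim_squeeze _ (fun t => RtoC (c k) * / z t)).
    + generalize (filter_and _ _ Nz Iz). apply filter_imp. intros t [Nt It]. now apply csqrt_ratio.
    + apply (clim_eq _ (RtoC (c k) * 0)); [ring|]. apply clim_mult; [apply clim_const | exact Hz].
Qed.

Lemma upper_root_neq0_loc : F (fun t => upper_root (z t) <> 0).
Proof.
  assert (N1 : RtoC 1 <> 0) by (apply RtoC_neq0; lra).
  generalize (clim_neq0 _ _ N1 upper_root_lim). apply filter_imp. intros t H E. apply H. rewrite E. unfold Cdiv. ring.
Qed.

Lemma peval_upper_root_lim l m : (length l <= S m)%nat -> (m <= d)%nat ->
  clim F (fun t => peval l (z t) / upper_root (z t) * z t ^ (d - m)) (nth m l 0).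
Proof.
  intros Hl Hm.
  assert (N1 : RtoC 1 <> 0) by (apply RtoC_neq0; lra).
  apply (clim_ext_loc (fun t => (peval l (z t) / z t ^ m) / (upper_root (z t) / z t ^ d))).
  - generalize (filter_and _ _ Nz upper_root_neq0_loc). apply filter_imp. intros t [Nt Tt].
    replace (z t ^ d) with (z t ^ m * z t ^ (d - m)) by (rewrite <- Cpow_add_r; f_equal; lia).
    assert (z t ^ m <> 0) by now apply Cpow_nz. assert (z t ^ (d - m) <> 0) by now apply Cpow_nz. cfield.
  - apply (clim_eq _ (nth m l 0 / 1)); [field; exact N1|].
    apply clim_div; [exact N1 | now apply peval_lim | apply upper_root_lim].
Qed.
End AtInfinity.

Lemma clim_inv_infty : clim (Rbar_locally p_infty) (fun x => / RtoC x) 0.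
Proof.
  intros e He. exists (/ e)%R. intros x Hx.
  assert (0 < / e)%R by now apply Rinv_0_lt_compat.
  rewrite <- RtoC_inv by lra. replace (RtoC (/ x) - 0) with (RtoC (/ x)) by ring. rewrite Cmod_R.
  rewrite Rabs_right by (apply Rle_ge; left; apply Rinv_0_lt_compat; lra).
  rewrite <- (Rinv_inv e). apply Rinv_lt_contravar; [|exact Hx]. apply Rmult_lt_0_compat; lra.
Qed.

Lemma infty_pos (a : R) : Rbar_locally p_infty (fun x => (a < x)%R).
Proof. exists a. auto. Qed.

Lemma infty_neq0 : Rbar_locally p_infty (fun x => RtoC x <> 0).
Proof. exists 0%R. intros x Hx E. apply RtoC_inj in E. lra. Qed.

Lemma infty_Im : Rbar_locally p_infty (fun x => (0 <= Im (RtoC x))%R).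
Proof. exists 0%R. intros x Hx. unfold Im; simpl. lra. Qed.

Lemma interval_slit_0_R x : (1 <= d)%nat -> (c 1%nat < x)%R -> interval_slit 0 (RtoC x).
Proof. intros Hd Hx. apply interval_slit_R; intros; try lia. exact Hx. Qed.

Lemma upper_root_sq z : upper_root z * upper_root z = branch_poly d c z.
Proof.
  unfold upper_root. rewrite <- cprod_mult. unfold branch_poly, branch_list. rewrite monic_cprod.
  apply cprod_ext. intros. apply csqrt_sq.
Qed.

#[local] Instance at_infty_filter eps : Filter (at_infty d c eps).
Proof.
  constructor.
  - exists 0%R, 1%R. split; [lra | trivial].
  - intros P Q [M1 [d1 [H1 K1]]] [M2 [d2 [H2 K2]]]. exists (Rmax M1 M2), (Rmin d1 d2).
    split; [now apply Rmin_glb_lt|]. intros p Hp HM Hd.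
    generalize (Rmax_l M1 M2) (Rmax_r M1 M2) (Rmin_l d1 d2) (Rmin_r d1 d2). intros.
    split; [apply K1 | apply K2]; auto; lra.
  - intros P Q H [M [e [He K]]]. exists M, e. auto.
Qed.

Lemma at_infty_inv eps : clim (at_infty d c eps) (fun p => / fst p) 0.
Proof.
  intros e He. exists (/ e)%R, 1%R. split; [lra|]. intros p _ Hp _.
  assert (0 < / e)%R by now apply Rinv_0_lt_compat.
  assert (N : fst p <> 0) by (apply Cmod_gt_0; lra).
  replace (/ fst p - 0) with (/ fst p) by ring. rewrite Cmod_inv by exact N.
  rewrite <- (Rinv_inv e). apply Rinv_lt_contravar; [|exact Hp]. apply Rmult_lt_0_compat; lra.
Qed.

Lemma at_infty_neq0 eps : at_infty d c eps (fun p => fst p <> 0).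
Proof. exists 0%R, 1%R. split; [lra|]. intros p _ Hp _. apply Cmod_gt_0. exact Hp. Qed.

Lemma at_infty_mu eps : clim (at_infty d c eps) (fun p => snd p / fst p ^ d) (RtoC eps).
Proof. intros e He. exists 0%R, e. auto. Qed.

(** Points with large positive z on the two sheets; they suffice to recover the
    shape of a differential from its behaviour at infinity. *)
Lemma real_to_infty eps : (eps = 1 \/ eps = -1)%R ->
  filterlim (fun x => (RtoC x, RtoC eps * upper_root (RtoC x))) (Rbar_locally p_infty) (at_infty d c eps).
Proof.
  intros He P [M [e [Hpos H]]].
  assert (L : clim (Rbar_locally p_infty) (fun x => RtoC eps * upper_root (RtoC x) / RtoC x ^ d) (RtoC eps)).
  { apply (clim_ext (fun x => RtoC eps * (upper_root (RtoC x) / RtoC x ^ d))); [intros; unfold Cdiv; ring|].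
    apply (clim_eq _ (RtoC eps * 1)); [ring|]. apply clim_mult; [apply clim_const|].
    apply (upper_root_lim (fun x => RtoC x)); auto using clim_inv_infty, infty_neq0, infty_Im. }
  unfold filtermap. generalize (filter_and _ _ (L e Hpos) (infty_pos (Rmax M 0))).
  apply filter_imp. intros x [K1 K2]. apply H; [|simpl|exact K1].
  - unfold on_curve; simpl. rewrite <- upper_root_sq.
    transitivity (RtoC (eps * eps) * (upper_root (RtoC x) * upper_root (RtoC x))); [rewrite RtoC_mult; ring|].
    replace (eps * eps)%R with 1%R by (destruct He; subst; ring). ring.
  - rewrite Cmod_R. generalize (Rmax_l M 0) (Rmax_r M 0). intros. rewrite Rabs_right; lra.
Qed.

(** Adding the values at the two points over x isolates the part B dz of the
    differential (A + B mu) dz/mu, subtracting them isolates A dz/mu.  Since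
    mu ~ z^d, the two limits force B = 0 and bound the degree of A by d - n. *)
Lemma differential_at_infinity w n lp lm : (1 <= n <= 2)%nat -> (2 <= d)%nat ->
  clim (Rbar_locally p_infty) (fun x => dz_coef w (RtoC x, upper_root (RtoC x)) * RtoC x ^ n) lp ->
  clim (Rbar_locally p_infty) (fun x => dz_coef w (RtoC x, - upper_root (RtoC x)) * RtoC x ^ n) lm ->
  exists l : list C, length l = (d - n + 1)%nat /\ nth (d - n) l 0 = (lp - lm) / 2 /\
    forall p, factor w p = peval l (fst p).
Proof.
  intros Hn Hd Hp Hm.
  assert (LT := upper_root_lim (fun x => RtoC x) clim_inv_infty infty_neq0 infty_Im).
  assert (NT := upper_root_neq0_loc (fun x => RtoC x) clim_inv_infty infty_neq0 infty_Im).
  assert (L0 : clim (Rbar_locally p_infty) (fun x => (/ RtoC x) ^ n) 0).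
  { apply (clim_eq _ (0 ^ n)); [destruct n; [lia|simpl; ring]|]. apply clim_pow, clim_inv_infty. }
  assert (HB : forall z, peval (dB w) z = 0).
  { assert (HL : clim (Rbar_locally p_infty) (fun x => peval (dB w) (RtoC x) / RtoC x ^ 0) 0).
    { apply (clim_ext_loc (fun x => (dz_coef w (RtoC x, upper_root (RtoC x)) * RtoC x ^ n + dz_coef w (RtoC x, - upper_root (RtoC x)) * RtoC x ^ n) * / 2 * (/ RtoC x) ^ n)).
      - generalize (filter_and _ _ NT infty_neq0). apply filter_imp. intros x [Nt Nx].
        unfold dz_coef, factor; simpl fst; simpl snd. rewrite Cpow_inv by exact Nx. simpl Cpow at 4.
        assert (RtoC x ^ n <> 0) by now apply Cpow_nz.
        simpl. cfield.
      - apply (clim_eq _ ((lp + lm) * / 2 * 0)); [ring|]. apply clim_mult; [|exact L0].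
        apply clim_mult; [now apply clim_plus | apply clim_const]. }
    destruct (peval_lim_inv (fun x => RtoC x) 0 0 clim_inv_infty infty_neq0 (dB w) HL) as [B1 B2].
    intros z. rewrite <- (peval_firstn 0 (dB w)); [reflexivity|].
    intros [|k] Hk; [exact B2 | apply B1; lia]. }
  assert (HA : clim (Rbar_locally p_infty) (fun x => peval (dA w) (RtoC x) / RtoC x ^ (d - n)) ((lp - lm) / 2)).
  { apply (clim_ext_loc (fun x => (dz_coef w (RtoC x, upper_root (RtoC x)) * RtoC x ^ n - dz_coef w (RtoC x, - upper_root (RtoC x)) * RtoC x ^ n) / 2 *
       (upper_root (RtoC x) / RtoC x ^ d))).
    - generalize (filter_and _ _ NT infty_neq0). apply filter_imp. intros x [Nt Nx].
      unfold dz_coef, factor; simpl fst; simpl snd. rewrite !HB.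
      replace (RtoC x ^ d) with (RtoC x ^ n * RtoC x ^ (d - n)) by (rewrite <- Cpow_add_r; f_equal; lia).
      assert (RtoC x ^ n <> 0) by now apply Cpow_nz. assert (RtoC x ^ (d - n) <> 0) by now apply Cpow_nz.
      cfield.
    - apply (clim_eq _ ((lp - lm) / 2 * 1)); [ring|]. apply clim_mult; [|exact LT].
      apply clim_div; [apply C2_neq0 | now apply clim_minus | apply clim_const]. }
  destruct (peval_lim_inv (fun x => RtoC x) _ _ clim_inv_infty infty_neq0 (dA w) HA) as [A1 A2].
  set (l := firstn (d - n + 1) (dA w ++ repeat (RtoC 0) (d - n + 1))).
  assert (Nl : forall k, nth k (dA w ++ repeat (RtoC 0) (d - n + 1)) 0 = nth k (dA w) 0).
  { intros k. destruct (Nat.lt_ge_cases k (length (dA w))) as [K|K].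
    - now apply app_nth1.
    - rewrite app_nth2 by exact K. rewrite (nth_overflow (dA w)) by exact K. apply nth_repeat. }
  assert (Pl : forall z, peval (dA w ++ repeat (RtoC 0) (d - n + 1)) z = peval (dA w) z).
  { intros z. generalize (d - n + 1)%nat. intros m. generalize (dA w). intros q. clear.
    induction q as [|a q IH]; simpl; [|now rewrite IH].
    induction m as [|m IH]; simpl; [reflexivity | rewrite IH; ring]. }
  exists l. split; [|split].
  - unfold l. rewrite length_firstn, length_app, repeat_length. lia.
  - unfold l. rewrite nth_firstn. destruct (Nat.ltb_spec (d - n) (d - n + 1)); [|lia]. now rewrite Nl.
  - intros p. unfold factor. rewrite HB. unfold l. rewrite peval_firstn, Pl; [ring|].
    intros k Hk. rewrite Nl. apply A1. lia.
Qed.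

Lemma holomorphic_poly w : (2 <= d)%nat -> holomorphic d c w ->
  exists l : list C, length l = (d - 1)%nat /\ forall p, factor w p = peval l (fst p).
Proof.
  intros Hd Hw.
  destruct (Hw 1%R (or_introl eq_refl)) as [l1 H1]. destruct (Hw (-1)%R (or_intror eq_refl)) as [l2 H2].
  apply clim_filterlim in H1; [|apply at_infty_filter]. apply clim_filterlim in H2; [|apply at_infty_filter].
  assert (K1 := clim_comp _ _ _ (real_to_infty 1 (or_introl eq_refl)) H1).
  assert (K2 := clim_comp _ _ _ (real_to_infty (-1) (or_intror eq_refl)) H2).
  destruct (differential_at_infinity w 2 (- l1) (- l2) ltac:(lia) Hd) as [l [Ll [_ Hl]]].
  - apply (clim_ext (fun x => - dzinv_coef w (RtoC x, RtoC 1 * upper_root (RtoC x)))).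
    + intros x. unfold dzinv_coef. rewrite Cmult_1_l. simpl fst. simpl. ring.
    + now apply clim_opp.
  - apply (clim_ext (fun x => - dzinv_coef w (RtoC x, RtoC (-1) * upper_root (RtoC x)))).
    + intros x. unfold dzinv_coef. replace (RtoC (-1) * upper_root (RtoC x)) with (- upper_root (RtoC x)).
      * simpl fst. simpl. ring.
      * rewrite RtoC_m1. ring.
    + now apply clim_opp.
  - exists l. split; [lia | exact Hl].
Qed.

Lemma third_kind_poly w : (2 <= d)%nat -> third_kind d c w ->
  exists l : list C, length l = d /\ nth (d - 1) l 0 = - (1) /\ forall p, factor w p = peval l (fst p).
Proof.
  intros Hd Hw.
  assert (H1 := Hw 1%R (or_introl eq_refl)). assert (H2 := Hw (-1)%R (or_intror eq_refl)).
  apply clim_filterlim in H1; [|apply at_infty_filter]. apply clim_filterlim in H2; [|apply at_infty_filter].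
  assert (K1 := clim_comp _ _ _ (real_to_infty 1 (or_introl eq_refl)) H1).
  assert (K2 := clim_comp _ _ _ (real_to_infty (-1) (or_intror eq_refl)) H2).
  assert (EN : RtoC (-1) = - RtoC 1) by (rewrite <- RtoC_opp; reflexivity).
  destruct (differential_at_infinity w 1 (- (1)) (- (- (1))) ltac:(lia) Hd) as [l [Ll [Nl Hl]]].
  - apply (clim_ext_loc (fun x => - (dzinv_coef w (RtoC x, RtoC 1 * upper_root (RtoC x)) * / RtoC x))).
    + generalize infty_neq0. apply filter_imp. intros x Nx. unfold dzinv_coef. rewrite Cmult_1_l. simpl fst. simpl. cfield.
    + now apply clim_opp.
  - apply (clim_ext_loc (fun x => - (dzinv_coef w (RtoC x, RtoC (-1) * upper_root (RtoC x)) * / RtoC x))).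
    + generalize infty_neq0. apply filter_imp. intros x Nx. unfold dzinv_coef. 
      replace (RtoC (-1) * upper_root (RtoC x)) with (- upper_root (RtoC x)) by (rewrite EN; ring). simpl fst. simpl. cfield.
    + rewrite <- EN. now apply clim_opp.
  - exists l. split; [lia|]. split; [|exact Hl]. rewrite Nl. cfield.
Qed.

Lemma poly_holomorphic l : (2 <= d)%nat -> (length l <= d - 1)%nat ->
  holomorphic d c (AbelianDifferential l nil).
Proof.
  intros Hd Hl eps He. exists (- (nth (d - 2) l 0 / RtoC eps)).
  assert (Ne : RtoC eps <> 0) by (intros E; apply RtoC_inj in E; destruct He; lra).
  apply clim_filterlim; [apply at_infty_filter|].
  assert (Nm : at_infty d c eps (fun p => snd p <> 0)).
  { generalize (clim_neq0 _ _ Ne (at_infty_mu eps)). apply filter_imp. intros p H E. apply H. rewrite E. unfold Cdiv. ring. }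
  apply (clim_ext_loc (fun p => - ((peval l (fst p) / fst p ^ (d - 2)) / (snd p / fst p ^ d)))).
  - generalize (filter_and _ _ Nm (at_infty_neq0 eps)). apply filter_imp. intros p [N1 N2].
    unfold dzinv_coef, dz_coef, factor. simpl dA. simpl dB. simpl peval at 3.
    replace (fst p ^ d) with (fst p ^ (d - 2) * (fst p * fst p)).
    + assert (fst p ^ (d - 2) <> 0) by now apply Cpow_nz. cfield.
    + transitivity (fst p ^ (d - 2) * fst p ^ 2); [simpl; ring|]. rewrite <- Cpow_add_r. f_equal. lia.
  - apply clim_opp, clim_div; [exact Ne | | apply at_infty_mu].
    apply (peval_lim (fun p => fst p)); [apply at_infty_inv | apply at_infty_neq0 | lia].
Qed.

(** * Large arcs in the upper half-plane *)

Definition arc (x t : R) : C := RtoC x * (RtoC (cos t) + Ci * RtoC (sin t)).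

Lemma arc_mod x t : (0 <= x)%R -> Cmod (arc x t) = x.
Proof.
  intros Hx. unfold arc. rewrite Cmod_mult, Cmod_R, Rabs_right by lra.
  replace (Cmod (RtoC (cos t) + Ci * RtoC (sin t))) with 1%R; [ring|].
  unfold Cmod, Cplus, Cmult, Ci, RtoC; simpl.
  replace ((cos t + (0 * sin t - 1 * 0)) * ((cos t + (0 * sin t - 1 * 0)) * 1) +
    (0 + (0 * 0 + 1 * sin t)) * ((0 + (0 * 0 + 1 * sin t)) * 1))%R with (Rsqr (sin t) + Rsqr (cos t))%R by (unfold Rsqr; ring).
  now rewrite sin2_cos2, sqrt_1.
Qed.

Lemma arc_Im x t : Im (arc x t) = (x * sin t)%R.
Proof. unfold arc, Im, Cplus, Cmult, Ci, RtoC; simpl. ring. Qed.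

Lemma arc_deriv x t : is_derivC (arc x) t (Ci * arc x t).
Proof.
  unfold arc.
  apply (is_derivC_eq _ _ (0 * (RtoC (cos t) + Ci * RtoC (sin t)) +
     RtoC x * (RtoC (- sin t) + (0 * RtoC (sin t) + Ci * RtoC (cos t))))).
  - rewrite RtoC_opp. transitivity (RtoC x * ((Ci * Ci) * RtoC (sin t) + Ci * RtoC (cos t))); [rewrite Ci_sq|]; ring.
  - apply (is_derivC_mult (fun _ => RtoC x) (fun t => RtoC (cos t) + Ci * RtoC (sin t))); [apply is_derivC_const|].
    apply is_derivC_plus.
    + apply is_derivC_RtoC. auto_derive; [trivial | ring].
    + apply (is_derivC_mult (fun _ => Ci) (fun t => RtoC (sin t))); [apply is_derivC_const|].
      apply is_derivC_RtoC. auto_derive; [trivial | ring].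
Qed.

(** Neighbourhoods of infinity in the sector of arguments [t1, t2].  As they form
    a filter, limits along it are uniform with respect to the angle. *)
Definition large_arcs (t1 t2 : R) (P : C -> Prop) : Prop :=
  Rbar_locally p_infty (fun x => forall t, (t1 <= t <= t2)%R -> P (arc x t)).

#[local] Instance large_arcs_filter t1 t2 : Filter (large_arcs t1 t2).
Proof.
  constructor.
  - exists 0%R. auto.
  - unfold large_arcs. intros P Q HP HQ. generalize (filter_and _ _ HP HQ). apply filter_imp. intros x [A B] t Ht. auto.
  - unfold large_arcs. intros P Q H. apply filter_imp. intros x A t Ht. auto.
Qed.

Lemma large_arcs_at t1 t2 t0 P : (t1 <= t0 <= t2)%R -> large_arcs t1 t2 P -> Rbar_locally p_infty (fun x => P (arc x t0)).
Proof. unfold large_arcs. intros Ht. apply filter_imp. auto. Qed.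

Lemma large_arcs_clim_at t1 t2 t0 g L : (t1 <= t0 <= t2)%R -> clim (large_arcs t1 t2) g L ->
  clim (Rbar_locally p_infty) (fun x => g (arc x t0)) L.
Proof. intros Ht H e He. exact (large_arcs_at _ _ _ _ Ht (H e He)). Qed.

Lemma large_arcs_inv t1 t2 : clim (large_arcs t1 t2) (fun z => / z) 0.
Proof.
  intros e He. exists (/ e)%R. intros x Hx t _.
  assert (0 < / e)%R by now apply Rinv_0_lt_compat.
  assert (M : Cmod (arc x t) = x) by (apply arc_mod; lra).
  assert (N : arc x t <> 0) by (apply Cmod_gt_0; lra).
  replace (/ arc x t - 0) with (/ arc x t) by ring. rewrite Cmod_inv, M by exact N.
  rewrite <- (Rinv_inv e). apply Rinv_lt_contravar; [|exact Hx]. apply Rmult_lt_0_compat; lra.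
Qed.

Lemma large_arcs_neq0 t1 t2 : large_arcs t1 t2 (fun z => z <> 0).
Proof. exists 0%R. intros x Hx t _. apply Cmod_gt_0. rewrite arc_mod; lra. Qed.

Lemma large_arcs_Im t1 t2 : (0 <= t1)%R -> (t2 <= PI)%R -> large_arcs t1 t2 (fun z => (0 <= Im z)%R).
Proof.
  intros H1 H2. exists 0%R. intros x Hx t Ht. rewrite arc_Im.
  apply Rmult_le_pos; [lra | apply sin_ge_0; lra].
Qed.

(** Along the arc dz = i z dt, so psi(z) dz is close to i lam dt. *)
Lemma arc_increment t1 t2 phi psi lam : (t1 <= t2)%R ->
  large_arcs t1 t2 (fun z => cderiv phi z (psi z)) -> clim (large_arcs t1 t2) (fun z => psi z * z) lam ->
  clim (Rbar_locally p_infty) (fun x => phi (arc x t2) - phi (arc x t1)) (Ci * lam * RtoC (t2 - t1)).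
Proof.
  intros Ht HD HL e He.
  set (e' := (e / (2 * (t2 - t1) + 1))%R).
  assert (He' : (0 < e')%R) by (apply Rdiv_lt_0_compat; lra).
  assert (K0 := filter_and _ _ HD (HL e' He')). unfold large_arcs in K0. revert K0. apply filter_imp. intros x K.
  assert (K1 : forall t, (t1 <= t <= t2)%R -> cderiv phi (arc x t) (psi (arc x t))) by (intros t H; apply (K t H)).
  assert (K2 : forall t, (t1 <= t <= t2)%R -> (Cmod (psi (arc x t) * arc x t - lam) < e')%R) by (intros t H; apply (K t H)).
  set (g := fun t => phi (arc x t) - Ci * lam * RtoC t).
  assert (M := mean_value_C g (fun t => psi (arc x t) * (Ci * arc x t) - Ci * lam) t1 t2 e' Ht).
  replace (phi (arc x t2) - phi (arc x t1) - Ci * lam * RtoC (t2 - t1)) with (g t2 - g t1).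
  2:{ unfold g. rewrite RtoC_minus. ring. }
  eapply Rle_lt_trans; [apply M|].
  - intros t Htt. unfold g. apply is_derivC_minus.
    + apply (is_derivC_comp phi (arc x)); [now apply K1 | apply arc_deriv].
    + apply (is_derivC_eq _ _ (0 * RtoC t + Ci * lam * 1)); [ring|].
      apply (is_derivC_mult (fun _ => Ci * lam) (fun t => RtoC t)); [apply is_derivC_const | apply is_derivC_id].
  - intros t Htt. replace (psi (arc x t) * (Ci * arc x t) - Ci * lam) with (Ci * (psi (arc x t) * arc x t - lam)) by ring.
    rewrite Cmod_mult, Cmod_Ci, Rmult_1_l. left. now apply K2.
  - unfold e'. apply (Rmult_lt_reg_r (2 * (t2 - t1) + 1)); [lra|].
    replace (2 * (e / (2 * (t2 - t1) + 1)) * (t2 - t1) * (2 * (t2 - t1) + 1))%R with (e * (2 * (t2 - t1)))%R by (field; lra).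
    apply Rmult_lt_compat_l; lra.
Qed.

Lemma arc_uniform t1 t2 t0 phi psi L : (t1 <= t0 <= t2)%R ->
  large_arcs t1 t2 (fun z => cderiv phi z (psi z)) -> clim (large_arcs t1 t2) (fun z => psi z * z) 0 ->
  clim (Rbar_locally p_infty) (fun x => phi (arc x t0)) L -> clim (large_arcs t1 t2) phi L.
Proof.
  intros Ht HD HL H0 e He.
  set (e' := (e / (4 * (t2 - t1) + 2))%R).
  assert (He' : (0 < e')%R) by (apply Rdiv_lt_0_compat; lra).
  assert (He2 : (0 < e / 2)%R) by lra.
  assert (K0 := filter_and _ _ HD (HL e' He')). unfold large_arcs in K0 |- *.
  generalize (filter_and _ _ K0 (H0 _ He2)). apply filter_imp. intros x [K K3] t Htt.
  assert (K1 : forall t, (t1 <= t <= t2)%R -> cderiv phi (arc x t) (psi (arc x t))) by (intros r H; apply (K r H)).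
  assert (K2 : forall t, (t1 <= t <= t2)%R -> (Cmod (psi (arc x t) * arc x t - 0) < e')%R) by (intros r H; apply (K r H)).
  assert (B : (Cmod (phi (arc x t) - phi (arc x t0)) <= 2 * e' * (t2 - t1))%R).
  { assert (D : forall s, (t1 <= s <= t2)%R -> is_derivC (fun t => phi (arc x t)) s (psi (arc x s) * (Ci * arc x s))).
    { intros s Hs. apply (is_derivC_comp phi (arc x)); [now apply K1 | apply arc_deriv]. }
    assert (D' : forall s, (t1 <= s <= t2)%R -> (Cmod (psi (arc x s) * (Ci * arc x s)) <= e')%R).
    { intros s Hs. replace (psi (arc x s) * (Ci * arc x s)) with (Ci * (psi (arc x s) * arc x s - 0)) by ring.
      rewrite Cmod_mult, Cmod_Ci, Rmult_1_l. left. now apply K2. }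
    assert (W : forall s r, (s <= r)%R -> (t1 <= s)%R -> (r <= t2)%R ->
       (Cmod (phi (arc x r) - phi (arc x s)) <= 2 * e' * (t2 - t1))%R).
    { intros s r Hsr Hs Hr. eapply Rle_trans.
      - apply (mean_value_C (fun t => phi (arc x t)) (fun s => psi (arc x s) * (Ci * arc x s)) s r e' Hsr); intros q Hq; [apply D | apply D']; lra.
      - apply Rmult_le_compat_l; lra. }
    destruct (Rle_lt_dec t0 t) as [Q|Q].
    - apply W; lra.
    - replace (phi (arc x t) - phi (arc x t0)) with (- (phi (arc x t0) - phi (arc x t))) by ring.
      rewrite Cmod_opp. apply W; lra. }
  replace (phi (arc x t) - L) with ((phi (arc x t) - phi (arc x t0)) + (phi (arc x t0) - L)) by ring.
  eapply Rle_lt_trans; [apply Cmod_triangle|].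
  assert (2 * e' * (t2 - t1) < e / 2)%R; [|lra].
  unfold e'. apply (Rmult_lt_reg_r (4 * (t2 - t1) + 2)); [lra|].
  replace (2 * (e / (4 * (t2 - t1) + 2)) * (t2 - t1) * (4 * (t2 - t1) + 2))%R with (e * (2 * (t2 - t1)))%R by (field; lra).
  assert (e * (2 * (t2 - t1)) < e * (2 * (t2 - t1) + 1))%R; [apply Rmult_lt_compat_l|]; lra.
Qed.

Lemma arc_right_interval_slit : (1 <= d)%nat -> large_arcs 0 (PI / 2) (interval_slit 0).
Proof.
  intros Hd. exists (Rmax 0 (c 1%nat)). intros x Hx t Ht. assert (PP := PI_RGT_0).
  assert (X := Rmax_l 0 (c 1%nat)). assert (Y := Rmax_r 0 (c 1%nat)).
  destruct (Req_dec t 0) as [->|N].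
  - replace (arc x 0) with (RtoC x).
    + apply interval_slit_0_R; [exact Hd | lra].
    + unfold arc. rewrite cos_0, sin_0. ring.
  - apply rt_prod_dom_nonreal. rewrite arc_Im. assert (0 < sin t)%R by (apply sin_gt_0; lra).
    apply Rgt_not_eq, Rmult_lt_0_compat; lra.
Qed.

Lemma arc_left_interval_slit : (1 <= d)%nat -> large_arcs (PI / 2) PI (interval_slit (2 * d)).
Proof.
  intros Hd. exists (Rmax 0 (- c (2 * d)%nat)). intros x Hx t Ht. assert (PP := PI_RGT_0).
  assert (X := Rmax_l 0 (- c (2 * d)%nat)). assert (Y := Rmax_r 0 (- c (2 * d)%nat)).
  destruct (Req_dec t PI) as [->|N].
  - replace (arc x PI) with (RtoC (- x)).
    + apply interval_slit_R; intros; try lia. lra.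
    + unfold arc. rewrite cos_PI, sin_PI, RtoC_opp. rewrite RtoC_m1. ring.
  - apply rt_prod_dom_nonreal. rewrite arc_Im. assert (0 < sin t)%R by (apply sin_gt_0; lra).
    apply Rgt_not_eq, Rmult_lt_0_compat; lra.
Qed.

Lemma arc_interval_root_lim i t1 t2 l m : (0 <= t1)%R -> (t2 <= PI)%R -> large_arcs t1 t2 (interval_slit i) ->
  (length l <= S m)%nat -> (m <= d)%nat ->
  clim (large_arcs t1 t2) (fun z => peval l z / interval_root i z * z ^ (d - m)) (nth m l 0).
Proof.
  intros H1 H2 HD Hl Hm.
  apply (clim_ext_loc (fun z => peval l z / upper_root z * z ^ (d - m))).
  - generalize (filter_and _ _ HD (large_arcs_Im t1 t2 H1 H2)). apply filter_imp. intros z [A B]. now rewrite (interval_root_upper_root i).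
  - apply (peval_upper_root_lim (fun z => z)); auto; [apply large_arcs_inv | apply large_arcs_neq0 | now apply large_arcs_Im].
Qed.

(** * Iterated integrals of two differentials *)

Section Reciprocity.
Variables (f A : C -> C).
Hypotheses (Hf : entire f) (HA : entire A).

(** The chart primitive of the first differential times the second
    differential; its primitive [double_prim] plays the part of the boundary
    integral in Riemann's bilinear relations. *)
Definition double_form (j : nat) (w : C) : C := chart_prim j f w * chart_form j A w.
Definition double_prim (j : nat) : C -> C := prim (double_form j).

Lemma double_form_holo j : (1 <= j <= 2 * d)%nat -> holo (chart_dom j) (double_form j).
Proof. intros Hj. apply holo_mult; [now apply chart_prim_holo | now apply chart_form_holo]. Qed.

Lemma double_prim_deriv j w : (1 <= j <= 2 * d)%nat -> chart_dom j w -> cderiv (double_prim j) w (double_form j w).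
Proof.
  intros Hj Hw. apply (prim_deriv (chart_dom j)); auto; [apply chart_open | now apply chart_star | now apply double_form_holo].
Qed.

Lemma double_prim_rt_deriv b j i z : (1 <= j <= 2 * d)%nat ->
  (b = true /\ i = j) \/ (b = false /\ j = S i) -> interval_slit i z ->
  cderiv (fun u => double_prim j (rt b j u)) z (chart_prim j f (rt b j z) * (A z / interval_root i z)).
Proof.
  intros Hj Hb Hz. destruct (chart_form_rt b j i A z Hj Hb Hz) as [H1 [H2 H3]].
  apply (cderiv_eq _ _ (double_form j (rt b j z) * / (2 * rt b j z))).
  - unfold double_form. rewrite <- H3. ring.
  - apply (cderiv_comp (double_prim j) (rt b j)); [|now apply rt_deriv]. apply double_prim_deriv; [exact Hj | now apply chart_dom_rt].
Qed.

(** Changing charts replaces the primitive F of the first differential by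
    F - h, hence the iterated integral by itself minus h times the primitive of
    the second differential, up to this constant. *)
Definition double_const (j : nat) (z : C) : C :=
  double_prim j (rt true j z) - double_prim (S j) (rt false (S j) z) - half_period j f * chart_prim (S j) A (rt false (S j) z).

Lemma double_const_eq j z : (1 <= j < 2 * d)%nat -> interval_slit j z -> double_const j z = double_const j (RtoC (mid j)).
Proof.
  intros Hj Hz. apply (zero_deriv_const (interval_slit j) (double_const j) (RtoC (mid j)) z).
  - intros s Hs. apply rt_prod_dom_segment; [now apply interval_slit_mid | exact Hz | exact Hs].
  - intros u Hu. unfold double_const.
    apply (cderiv_eq _ _ (chart_prim j f (rt true j u) * (A u / interval_root j u) - chart_prim (S j) f (rt false (S j) u) * (A u / interval_root j u) -
      (0 * chart_prim (S j) A (rt false (S j) u) + half_period j f * (A u / interval_root j u)))).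
    + rewrite <- (half_period_eq j f u) by auto. ring.
    + apply cderiv_minus; [apply cderiv_minus|].
      * apply double_prim_rt_deriv; auto; lia.
      * apply double_prim_rt_deriv; auto; lia.
      * apply (cderiv_mult (fun _ => half_period j f) (fun u => chart_prim (S j) A (rt false (S j) u))); [apply cderiv_const|].
        apply chart_prim_rt_deriv; auto; lia.
Qed.

Hypotheses (Rf : real_on_R f) (RA : real_on_R A).

Lemma Ci_pow_sq_real n : exists s : R, (s = 1 \/ s = -1)%R /\ Ci ^ n * Ci ^ n = RtoC s.
Proof.
  exists ((-1) ^ n)%R. split; [apply pow_m1_sign|]. rewrite <- Cpow_add_r.
  replace (n + n)%nat with (2 * n)%nat by lia. apply Ci_pow_even.
Qed.

Lemma double_prim_axis j w : (1 <= j <= 2 * d)%nat -> axis w -> chart_dom j w -> Im (double_prim j w) = 0%R.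
Proof.
  intros Hj Hw HD.
  assert (N1 : RtoC 1 <> 0) by (apply RtoC_neq0; lra).
  destruct (prim_line j 1 (double_form j) w Hj (double_form_holo j Hj) HD N1) as [r Er].
  - intros s Hs. 
    assert (Hsw := axis_scal w s Hw). assert (Dsw : chart_dom j (RtoC s * w)) by now apply chart_star.
    destruct (chart_form_axis j A (RtoC s * w) Hj RA Hsw Dsw) as [r1 E1].
    destruct (chart_prim_axis j f (RtoC s * w) Hj Hf Rf Hsw Dsw) as [r2 E2].
    destruct (axis_sq w Hw) as [y Ey]. destruct (Ci_pow_sq_real (j - 1)) as [q [Hq Eq]].
    unfold double_form. rewrite E1, E2. assert (NC := Ci_pow_neq0 (j - 1)).
    assert (Nq : RtoC q <> 0) by (intros E; apply RtoC_inj in E; destruct Hq; lra).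
    replace (w * (RtoC s * w / Ci ^ (j - 1) * RtoC r2 * (RtoC r1 / Ci ^ (j - 1))) / 1)
      with (RtoC s * RtoC r2 * RtoC r1 * (w * w) / (Ci ^ (j - 1) * Ci ^ (j - 1))) by cfield.
    rewrite Eq, Ey. rewrite <- !RtoC_mult, <- RtoC_div; [reflexivity|]. intros E. subst q. destruct Hq; lra.
  - unfold double_prim. rewrite Er, Cmult_1_l. reflexivity.
Qed.

(** At the midpoint of a gap both differentials are real, at that of a band both
    are imaginary; in either case their products are real. *)
Lemma double_const_real j : (1 <= j < 2 * d)%nat -> Im (double_const j (RtoC (mid j))) = 0%R.
Proof.
  intros Hj. assert (M := mid_between j Hj). assert (DM := interval_slit_mid j Hj).
  unfold double_const.
  assert (I1 : Im (double_prim j (rt true j (RtoC (mid j)))) = 0%R).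
  { apply double_prim_axis; [lia | apply axis_rt_true; lra | now apply chart_dom_rt, interval_slit_chart_slit_left]. }
  assert (I2 : Im (double_prim (S j) (rt false (S j) (RtoC (mid j)))) = 0%R).
  { apply double_prim_axis; [lia | apply axis_rt_false; lra | now apply chart_dom_rt, interval_slit_chart_slit_right]. }
  assert (I3 : Im (half_period j f * chart_prim (S j) A (rt false (S j) (RtoC (mid j)))) = 0%R).
  { assert (E1 := half_period_real_period j f Hj Hf Rf).
    assert (E2 := real_eq _ (chart_prim_right_real j A (mid j) Hj HA RA M)).
    set (u := chart_prim (S j) A (rt false (S j) (RtoC (mid j)))) in *.
    destruct (Ci_pow_sq_real j) as [q [Hq Eq]].
    assert (NC := Ci_pow_neq0 j).
    replace (half_period j f * u) with ((Ci ^ j * half_period j f) * (Ci ^ j * u) / (Ci ^ j * Ci ^ j)) by cfield.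
    rewrite Eq, E1, E2. rewrite <- RtoC_mult, <- RtoC_div; [reflexivity|]. destruct Hq; lra. }
  unfold Im in *; simpl in *. lra.
Qed.

(** Over the upper half-plane the coordinates of all charts are principal
    roots, which gives one sheet common to all charts. *)
Definition upper_w (j : nat) (z : C) : C := csqrt (z - RtoC (c j)).

Lemma rt_upper_w b j z : (0 < Im z)%R -> rt b j z = upper_w j z.
Proof.
  intros HI. unfold rt, upper_w. destruct b; [|reflexivity].
  replace (RtoC (c j) - z) with (- (z - RtoC (c j))) by ring.
  apply csqrt_opp; [|left]; unfold Im in *; simpl in *; lra.
Qed.

Lemma upper_w_interval_slit i z : (0 < Im z)%R -> interval_slit i z.
Proof. intros H. apply rt_prod_dom_nonreal. lra. Qed.

Lemma telescope_F g z : entire g -> (0 < Im z)%R -> forall m j, (1 <= j)%nat -> (j + m <= 2 * d)%nat ->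
  chart_prim j g (upper_w j z) - chart_prim (j + m) g (upper_w (j + m) z) = csum (fun i => half_period i g) (seq j m).
Proof.
  intros Hg HI m. induction m as [|m IH]; intros j Hj Hm.
  - rewrite Nat.add_0_r. simpl. ring.
  - rewrite seq_S, csum_app. rewrite <- IH by lia.
    change (csum (fun i => half_period i g) ((j + m)%nat :: nil)) with (half_period (j + m) g + 0).
    rewrite <- (half_period_eq (j + m) g z) by (auto; try lia; now apply upper_w_interval_slit).
    rewrite !rt_upper_w by exact HI. replace (j + S m)%nat with (S (j + m)) by lia. ring.
Qed.

Lemma telescope_N z : (0 < Im z)%R -> forall m j, (1 <= j)%nat -> (j + m <= 2 * d)%nat ->
  double_prim j (upper_w j z) - double_prim (j + m) (upper_w (j + m) z) =
  csum (fun i => half_period i f * chart_prim (S i) A (upper_w (S i) z) + double_const i (RtoC (mid i))) (seq j m).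
Proof.
  intros HI m. induction m as [|m IH]; intros j Hj Hm.
  - rewrite Nat.add_0_r. simpl. ring.
  - rewrite seq_S, csum_app. rewrite <- IH by lia. cbn [csum].
    rewrite <- (double_const_eq (j + m) z) by (try lia; now apply upper_w_interval_slit). unfold double_const.
    rewrite !rt_upper_w by exact HI. replace (j + S m)%nat with (S (j + m)) by lia. ring.
Qed.

(** The integral of A dz/mu from c_{i+1} to c_{2d} over the upper half-plane. *)
Definition tail_period (i : nat) : C := csum (fun k => half_period k A) (seq (S i) (2 * d - 1 - i)).

Lemma Im_csum_0 g l : (forall k, In k l -> Im (g k) = 0%R) -> Im (csum g l) = 0%R.
Proof.
  induction l as [|a l IH]; intros H; [reflexivity|]. simpl csum.
  assert (A1 := H a (or_introl eq_refl)). assert (A2 := IH (fun k Hk => H k (or_intror Hk))).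
  unfold Im in *; simpl in *. lra.
Qed.

(** Sum of the relations between adjacent charts, from the rightmost branch
    point to the leftmost one; nu collects the real constants
    [double_const]. *)
Lemma upper_relation z : (0 < Im z)%R -> (1 <= d)%nat -> exists nu : R,
  double_prim 1 (upper_w 1 z) - double_prim (2 * d) (upper_w (2 * d) z) =
  csum (fun i => half_period i f) (seq 1 (2 * d - 1)) * chart_prim (2 * d) A (upper_w (2 * d) z) +
  csum (fun i => half_period i f * tail_period i) (seq 1 (2 * d - 1)) + RtoC nu.
Proof.
  intros HI Hd. 
  assert (INu : Im (csum (fun i => double_const i (RtoC (mid i))) (seq 1 (2 * d - 1))) = 0%R).
  { apply Im_csum_0. intros k Hk. apply in_seq in Hk. apply double_const_real. lia. }
  exists (Re (csum (fun i => double_const i (RtoC (mid i))) (seq 1 (2 * d - 1)))).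
  rewrite <- (real_eq _ INu).
  assert (E := telescope_N z HI (2 * d - 1) 1 (le_n 1) ltac:(lia)).
  replace (1 + (2 * d - 1))%nat with (2 * d)%nat in E by lia. rewrite E.
  rewrite csum_plus. f_equal.
  rewrite (Cmult_comm (csum _ _)), <- csum_scal, <- csum_plus. apply csum_ext. intros i Hi. apply in_seq in Hi.
  assert (E2 := telescope_F A z HA HI (2 * d - 1 - i) (S i) ltac:(lia) ltac:(lia)).
  replace (S i + (2 * d - 1 - i))%nat with (2 * d)%nat in E2 by lia.
  unfold tail_period. rewrite <- E2. ring.
Qed.
End Reciprocity.

(** * The reciprocity law *)

Lemma clim_Im_eq {T} {F : (T -> Prop) -> Prop} {FF : ProperFilter F} (g : T -> C) L (X : R) :
  clim F g L -> F (fun x => Im (g x) = X) -> Im L = X.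
Proof.
  intros H K. destruct (Req_dec (Im L) X) as [E|N]; [exact E|exfalso].
  assert (P : (0 < Rabs (Im L - X))%R) by (apply Rabs_pos_lt; lra).
  destruct (filter_ex _ (filter_and _ _ (H _ P) K)) as [x [H1 H2]].
  assert (Rabs (Im (g x - L)) <= Cmod (g x - L))%R by (eapply Rle_trans; [apply Rmax_r | apply Rmax_Cmod]).
  replace (Im (g x - L)) with (- (Im L - X))%R in H0 by (rewrite <- H2; unfold Im; simpl; ring).
  rewrite Rabs_Ropp in H0. lra.
Qed.

Lemma cauchy_infty (g : R -> C) (K R0 : R) : (0 < R0)%R -> (0 < K)%R ->
  (forall x y, (R0 <= x)%R -> (x <= y)%R -> (Cmod (g y - g x) <= K / x)%R) ->
  exists V, clim (Rbar_locally p_infty) g V.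
Proof.
  intros HR HK H.
  destruct (proj1 (filterlim_locally_cauchy (U := C_R_CompleteNormedModule) (F := Rbar_locally p_infty) g)) as [V HV].
  - intros eps. set (M := Rmax R0 (K / eps)). exists (fun x => (M < x)%R). split; [exists M; auto|].
    assert (W : forall u v, (M < u)%R -> (u <= v)%R -> (Cmod (g v - g u) < eps)%R).
    { intros u v Hu Huv. assert (A1 := Rmax_l R0 (K / eps)). assert (A2 := Rmax_r R0 (K / eps)). fold M in A1, A2.
      assert (P := cond_pos eps).
      eapply Rle_lt_trans; [apply H; lra|]. apply Rlt_div_l; [lra|].
      assert (E : (K / eps * eps = K)%R) by (field; lra). nra. }
    intros u v Hu Hv. apply C_NormedModule_mixin_compat1. change (Cmod (g v - g u) < eps)%R.
    destruct (Rle_lt_dec u v) as [L|L]; [now apply W|].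
    replace (g v - g u) with (- (g u - g v)) by ring. rewrite Cmod_opp. apply W; [exact Hv | lra].
  - exists V. apply clim_filterlim; [typeclasses eauto | exact HV].
Qed.

Section ReciprocityLaw.
Variables (lf lA : list C) (rho : R).
Hypotheses (Hd : (2 <= d)%nat) (Llf : (length lf <= d - 1)%nat) (LlA : (length lA <= d)%nat)
  (Nrho : nth (d - 1) lA 0 = RtoC rho).
Notation f := (peval lf).
Notation A := (peval lA).
Hypotheses (Rf : real_on_R f) (RA : real_on_R A).

(** In the variable s = 1/x the primitive has a bounded derivative near 0. *)
Lemma infinite_endpoint : exists V, clim (Rbar_locally p_infty) (fun x => chart_prim 1 f (rt false 1 (RtoC x))) V.
Proof.
  assert (L := peval_upper_root_lim (fun x => RtoC x) clim_inv_infty infty_neq0 infty_Im lf (d - 2) ltac:(lia) ltac:(lia)).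
  set (a := nth (d - 2) lf 0) in *.
  destruct (filter_and _ _ (L 1%R Rlt_0_1) (infty_pos (Rmax 1 (c 1%nat)))) as [R1 HR1].
  set (R0 := Rmax 1 (R1 + 1)).
  set (K := (Cmod a + 1)%R). assert (HK : (0 < K)%R) by (unfold K; generalize (Cmod_ge_0 a); lra).
  assert (HR0 : (1 <= R0)%R) by apply Rmax_l.
  assert (B : forall x, (R0 <= x)%R -> (c 1%nat < x)%R /\ (Cmod (f (RtoC x) / interval_root 0 (RtoC x)) <= K * (/ x * / x))%R).
  { intros x Hx. assert (R1 + 1 <= R0)%R by apply Rmax_r.
    destruct (HR1 x ltac:(lra)) as [B1 B2]. assert (M1 := Rmax_r 1 (c 1%nat)). split; [lra|].
    assert (HD : interval_slit 0 (RtoC x)) by (apply interval_slit_0_R; [lia | lra]).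
    rewrite (interval_root_upper_root 0) by (auto; unfold Im; simpl; lra).
    replace (d - (d - 2))%nat with 2%nat in B1 by lia.
    assert (Nx : RtoC x <> 0) by (apply RtoC_neq0; lra).
    assert (B3 : (Cmod (f (RtoC x) / upper_root (RtoC x) * RtoC x ^ 2) <= K)%R).
    { replace (f (RtoC x) / upper_root (RtoC x) * RtoC x ^ 2) with ((f (RtoC x) / upper_root (RtoC x) * RtoC x ^ 2 - a) + a) by ring.
      eapply Rle_trans; [apply Cmod_triangle|]. unfold K. lra. }
    rewrite Cmod_mult, Cmod_pow, Cmod_R, Rabs_right in B3 by lra.
    assert (P : (0 < / x)%R) by (apply Rinv_0_lt_compat; lra).
    set (u := Cmod (f (RtoC x) / upper_root (RtoC x))) in *.
    replace u with (u * x ^ 2 * (/ x * / x))%R by (field; lra).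
    apply Rmult_le_compat_r; [nra | exact B3]. }
  apply (cauchy_infty _ (2 * K) R0); [lra | lra|].
  intros x y Hx Hy.
  (* The sign makes the increment from 1/y to 1/x that of the primitive from x to y. *)
  set (g := fun s : R => - chart_prim 1 f (rt false 1 (RtoC (/ s)))).
  assert (Px : (0 < / x)%R) by (apply Rinv_0_lt_compat; lra). assert (Py : (0 < / y)%R) by (apply Rinv_0_lt_compat; lra).
  assert (Hxy : (/ y <= / x)%R) by (apply Rinv_le_contravar; lra).
  assert (S1 : forall s, (/ y <= s <= / x)%R -> (R0 <= / s)%R /\ (0 < s)%R).
  { intros s Hs. split; [|lra]. apply Rle_trans with x; [exact Hx|]. rewrite <- (Rinv_inv x). apply Rinv_le_contravar; lra. }
  assert (M := mean_value_C g (fun s => f (RtoC (/ s)) / interval_root 0 (RtoC (/ s)) * RtoC (/ s * / s)) (/ y) (/ x) K Hxy).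
  replace (chart_prim 1 f (rt false 1 (RtoC y)) - chart_prim 1 f (rt false 1 (RtoC x))) with (g (/ x)%R - g (/ y)%R).
  2:{ unfold g. rewrite !Rinv_inv. ring. }
  eapply Rle_trans; [apply M|].
  - intros s Hs. destruct (S1 s Hs) as [A1 A2]. destruct (B _ A1) as [B1 _].
    apply (is_derivC_eq _ _ (0 - f (RtoC (/ s)) / interval_root 0 (RtoC (/ s)) * RtoC (- (/ s * / s)))).
    { rewrite RtoC_opp. ring. }
    apply (is_derive_ext (V := C_R_NormedModule) (fun s => 0 - chart_prim 1 f (rt false 1 (RtoC (/ s))))).
    { intros r. unfold g. change (0 - chart_prim 1 f (rt false 1 (RtoC (/ r))) = - chart_prim 1 f (rt false 1 (RtoC (/ r)))). ring. }
    apply is_derivC_minus; [apply is_derivC_const|].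
    apply (is_derivC_comp (fun z => chart_prim 1 f (rt false 1 z)) (fun s => RtoC (/ s))).
    + apply chart_prim_rt_deriv; auto; [apply peval_entire | lia | now apply interval_slit_0_R; [lia|]].
    + apply is_derivC_RtoC. auto_derive; [lra | field; lra].
  - intros s Hs. destruct (S1 s Hs) as [A1 A2]. destruct (B _ A1) as [_ B2].
    rewrite Cmod_mult, Cmod_R, Rabs_right by nra. rewrite Rinv_inv in B2.
    apply Rle_trans with (K * (s * s) * (/ s * / s))%R.
    + apply Rmult_le_compat_r; [|exact B2]. assert (0 < / s)%R by now apply Rinv_0_lt_compat. nra.
    + right. field. lra.
  - unfold Rdiv. apply Rmult_le_compat_l; lra.
Qed.

Lemma chart_prim_right_end g x : entire g -> real_on_R g -> (c 1%nat < x)%R -> Im (chart_prim 1 g (rt false 1 (RtoC x))) = 0%R.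
Proof.
  intros Hg Rg Hx.
  destruct (chart_prim_axis 1 g (rt false 1 (RtoC x))) as [r Er]; auto; [lia | apply axis_rt_false; lra | |].
  { apply chart_dom_rt, interval_slit_chart_slit_right. apply interval_slit_0_R; [lia | exact Hx]. }
  rewrite Er, rt_R_false by lra. simpl Cpow.
  replace (RtoC (sqrt (x - c 1%nat)) / 1 * RtoC r) with (RtoC (sqrt (x - c 1%nat) * r)); [reflexivity|].
  rewrite RtoC_mult. field.
Qed.

Lemma chart_prim_left_end g x : entire g -> real_on_R g -> (x < c (2 * d)%nat)%R ->
  Im (chart_prim (2 * d) g (rt true (2 * d) (RtoC x))) = 0%R.
Proof.
  intros Hg Rg Hx.
  destruct (chart_prim_axis (2 * d) g (rt true (2 * d) (RtoC x))) as [r Er]; auto; [lia | apply axis_rt_true; lra | |].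
  { apply chart_dom_rt, interval_slit_chart_slit_left. apply interval_slit_R; intros; try lia. exact Hx. }
  rewrite Er, rt_R_true by lra.
  destruct (pow_m1_sign d) as [E|E]; assert (E2 := Ci_pow_even d); rewrite E in E2;
    (assert (E3 : Ci ^ (2 * d) = Ci * Ci ^ (2 * d - 1)) by (replace (2 * d)%nat with (S (2 * d - 1)) at 1 by lia; reflexivity));
    rewrite E2 in E3; assert (NC := Ci_pow_neq0 (2 * d - 1)).
  - replace (Ci * RtoC (sqrt (c (2 * d)%nat - x)) / Ci ^ (2 * d - 1) * RtoC r)
      with ((Ci * Ci) * RtoC (sqrt (c (2 * d)%nat - x)) * RtoC r / (Ci * Ci ^ (2 * d - 1))) by cfield.
    rewrite <- E3, Ci_sq. unfold Cdiv.
    replace (- (1) * RtoC (sqrt (c (2 * d)%nat - x)) * RtoC r * / 1) with (RtoC (- (sqrt (c (2 * d)%nat - x) * r))); [reflexivity|].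
    rewrite RtoC_opp, RtoC_mult. field.
  - replace (Ci * RtoC (sqrt (c (2 * d)%nat - x)) / Ci ^ (2 * d - 1) * RtoC r)
      with ((Ci * Ci) * RtoC (sqrt (c (2 * d)%nat - x)) * RtoC r / (Ci * Ci ^ (2 * d - 1))) by cfield.
    rewrite <- E3, Ci_sq. rewrite RtoC_m1. unfold Cdiv.
    replace (- (1) * RtoC (sqrt (c (2 * d)%nat - x)) * RtoC r * / - (1)) with (RtoC (sqrt (c (2 * d)%nat - x) * r)); [reflexivity|].
    rewrite RtoC_mult. field.
Qed.

Lemma arc_0 x : arc x 0 = RtoC x.
Proof. unfold arc. rewrite cos_0, sin_0. ring. Qed.

Lemma arc_PI x : arc x PI = RtoC (- x).
Proof.
  unfold arc. rewrite cos_PI, sin_PI, RtoC_opp.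
  rewrite RtoC_m1. ring.
Qed.

Lemma arc_PI2_Im x : (0 < x)%R -> (0 < Im (arc x (PI / 2)))%R.
Proof. intros Hx. rewrite arc_Im, sin_PI2. lra. Qed.

(** Cauchy's theorem on the upper half-plane for the product of the primitive
    F of f dz/mu, vanishing at c_1, and the differential A dz/mu.  The large
    half-circle contributes i pi rho V, where V = F(infinity); it is cut at its
    top, the right half being treated in the chart of c_1, the left half in that
    of c_{2d}.  The real axis contributes the half periods of
    [upper_relation].  The imaginary parts at both ends of the half-circle
    vanish, because everything is real on the outer half-lines. *)
Theorem reciprocity : exists V : R,
  clim (Rbar_locally p_infty) (fun x => chart_prim 1 f (rt false 1 (RtoC x))) (RtoC V) /\
  Im (csum (fun i => half_period i f) (seq 1 (2 * d - 1))) = 0%R /\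
  (V * rho * PI)%R = Im (csum (fun i => half_period i f * tail_period A i) (seq 1 (2 * d - 1))).
Proof.
  destruct infinite_endpoint as [V0 HV0].
  assert (PP := PI_RGT_0). assert (d1 : (1 <= d)%nat) by lia.
  assert (Ef := peval_entire lf). assert (EA := peval_entire lA).
  assert (IV : Im V0 = 0%R).
  { apply (clim_Im_eq _ _ _ HV0). exists (c 1%nat). intros x Hx. now apply chart_prim_right_end. }
  exists (Re V0). rewrite <- (real_eq _ IV). split; [exact HV0|].
  set (H := csum (fun i => half_period i f) (seq 1 (2 * d - 1))).
  set (X := csum (fun i => half_period i f * tail_period A i) (seq 1 (2 * d - 1))).
  set (phi1 := fun z => chart_prim 1 f (rt false 1 z)). set (phiL := fun z => chart_prim (2 * d) f (rt true (2 * d) z)).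
  set (eL := fun z => chart_prim (2 * d) A (rt true (2 * d) z)).
  set (n1 := fun z => double_prim f A 1 (rt false 1 z)). set (nL := fun z => double_prim f A (2 * d) (rt true (2 * d) z)).
  assert (DR := arc_right_interval_slit d1). assert (DL := arc_left_interval_slit d1).
  assert (Cf : forall i t1 t2, (0 <= t1)%R -> (t2 <= PI)%R -> large_arcs t1 t2 (interval_slit i) ->
     clim (large_arcs t1 t2) (fun z => f z / interval_root i z * z) 0).
  { intros i t1 t2 H1 H2 HD.
    apply (clim_ext_loc (fun z => (f z / interval_root i z * z ^ (d - (d - 2))) * / z)).
    - generalize (filter_and _ _ HD (large_arcs_neq0 t1 t2)). apply filter_imp. intros z [Dz Nz].
      replace (d - (d - 2))%nat with 2%nat by lia. simpl. assert (interval_root i z <> 0) by now apply rt_prod_neq0. cfield.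
    - apply (clim_eq _ (nth (d - 2) lf 0 * 0)); [ring|]. apply clim_mult; [|apply large_arcs_inv].
      apply arc_interval_root_lim; auto; lia. }
  assert (CA : forall i t1 t2, (0 <= t1)%R -> (t2 <= PI)%R -> large_arcs t1 t2 (interval_slit i) ->
     clim (large_arcs t1 t2) (fun z => A z / interval_root i z * z) (RtoC rho)).
  { intros i t1 t2 H1 H2 HD.
    apply (clim_ext (fun z => A z / interval_root i z * z ^ (d - (d - 1)))).
    - intros z. replace (d - (d - 1))%nat with 1%nat by lia. simpl. ring.
    - rewrite <- Nrho. apply arc_interval_root_lim; auto; lia. }
  (* The primitive of f dz/mu tends to V0 uniformly on the right quarter-circle. *)
  assert (U1 : clim (large_arcs 0 (PI / 2)) phi1 V0).
  { apply (arc_uniform 0 (PI / 2) 0 phi1 (fun z => f z / interval_root 0 z)); [lra| | |].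
    - revert DR. apply filter_imp. intros z Dz. apply (chart_prim_rt_deriv false 1 0 f z); [exact Ef | lia | now right | exact Dz].
    - apply Cf; [lra | lra | exact DR].
    - apply (clim_ext (fun x => chart_prim 1 f (rt false 1 (RtoC x)))); [|exact HV0]. intros x. now rewrite arc_0. }
  assert (E12 : Rbar_locally p_infty (fun x => phi1 (arc x (PI / 2)) - phiL (arc x (PI / 2)) = H)).
  { exists 0%R. intros x Hx. assert (HI := arc_PI2_Im x Hx). unfold phi1, phiL. rewrite !rt_upper_w by exact HI.
    assert (E := telescope_F f _ Ef HI (2 * d - 1) 1 (le_n 1) ltac:(lia)).
    now replace (1 + (2 * d - 1))%nat with (2 * d)%nat in E by lia. }
  assert (UL : clim (large_arcs (PI / 2) PI) phiL (V0 - H)).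
  { apply (arc_uniform (PI / 2) PI (PI / 2) phiL (fun z => f z / interval_root (2 * d) z)); [lra| | |].
    - revert DL. apply filter_imp. intros z Dz. apply (chart_prim_rt_deriv true (2 * d) (2 * d) f z); [exact Ef | lia | now left | exact Dz].
    - apply Cf; [lra | lra | exact DL].
    - apply (clim_ext_loc (fun x => phi1 (arc x (PI / 2)) - H)).
      + revert E12. apply filter_imp. intros x E. rewrite <- E. ring.
      + apply clim_minus; [|apply clim_const]. apply (large_arcs_clim_at 0 (PI / 2)); [lra | exact U1]. }
  assert (big : Rbar_locally p_infty (fun x => (0 < x)%R /\ (c 1%nat < x)%R /\ (- x < c (2 * d)%nat)%R)).
  { apply filter_and; [apply infty_pos|]. apply filter_and; [apply infty_pos|].
    exists (- c (2 * d)%nat)%R. intros x Hx. lra. }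
  (* The limit V0 - H is also the limit along the negative half-line, where the
     primitive starting at c_{2d} is real. *)
  assert (IH : Im (V0 - H) = 0%R).
  { assert (HPI : (PI / 2 <= PI <= PI)%R) by lra.
    apply (clim_Im_eq (fun x => phiL (arc x PI)) _ _ (large_arcs_clim_at (PI / 2) PI PI phiL _ HPI UL)).
    revert big. apply filter_imp. intros x [B1 [B2 B3]]. unfold phiL. rewrite arc_PI. now apply chart_prim_left_end. }
  assert (IH0 : Im H = 0%R) by (unfold Im in *; simpl in *; lra).
  split; [exact IH0|].
  assert (H0h : (0 <= PI / 2)%R) by lra. assert (Hh1 : (PI / 2 <= PI)%R) by lra.
  assert (K1 := arc_increment 0 (PI / 2) n1 (fun z => phi1 z * (A z / interval_root 0 z)) (V0 * RtoC rho) H0h).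
  assert (K2 := arc_increment (PI / 2) PI nL (fun z => phiL z * (A z / interval_root (2 * d) z)) ((V0 - H) * RtoC rho) Hh1).
  assert (K3 := arc_increment (PI / 2) PI eL (fun z => A z / interval_root (2 * d) z) (RtoC rho) Hh1).
  assert (K1' : clim (Rbar_locally p_infty) (fun x => n1 (arc x (PI / 2)) - n1 (arc x 0)) (Ci * (V0 * RtoC rho) * RtoC (PI / 2 - 0))).
  { apply K1.
    - revert DR. apply filter_imp. intros z Dz. apply (double_prim_rt_deriv f A Ef EA false 1 0 z); [lia | now right | exact Dz].
    - apply (clim_ext (fun z => phi1 z * (A z / interval_root 0 z * z))); [intros; ring|].
      apply clim_mult; [exact U1 | apply CA; [lra | lra | exact DR]]. }
  assert (K2' : clim (Rbar_locally p_infty) (fun x => nL (arc x PI) - nL (arc x (PI / 2))) (Ci * ((V0 - H) * RtoC rho) * RtoC (PI - PI / 2))).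
  { apply K2.
    - revert DL. apply filter_imp. intros z Dz. apply (double_prim_rt_deriv f A Ef EA true (2 * d) (2 * d) z); [lia | now left | exact Dz].
    - apply (clim_ext (fun z => phiL z * (A z / interval_root (2 * d) z * z))); [intros; ring|].
      apply clim_mult; [exact UL | apply CA; [lra | lra | exact DL]]. }
  assert (K3' : clim (Rbar_locally p_infty) (fun x => eL (arc x PI) - eL (arc x (PI / 2))) (Ci * RtoC rho * RtoC (PI - PI / 2))).
  { apply K3.
    - revert DL. apply filter_imp. intros z Dz. apply (chart_prim_rt_deriv true (2 * d) (2 * d) A z); [exact EA | lia | now left | exact Dz].
    - apply CA; [lra | lra | exact DL]. }
  (* In this combination the values at the top of the half-circle cancel by
     [upper_relation]. *)
  assert (K := clim_plus _ _ _ _ (clim_plus _ _ _ _ K1' K2') (clim_mult (fun _ => H) _ _ _ (clim_const H) K3')).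
  assert (IL : Im (Ci * (V0 * RtoC rho) * RtoC (PI / 2 - 0) + Ci * ((V0 - H) * RtoC rho) * RtoC (PI - PI / 2) +
     H * (Ci * RtoC rho * RtoC (PI - PI / 2))) = Im X).
  { apply (clim_Im_eq _ _ _ K). revert big. apply filter_imp. intros x [B1 [B2 B3]].
    assert (HI := arc_PI2_Im x B1).
    destruct (upper_relation f A Ef EA Rf RA (arc x (PI / 2)) HI d1) as [nu E].
    fold H X in E.
    assert (En : n1 (arc x (PI / 2)) - nL (arc x (PI / 2)) = H * eL (arc x (PI / 2)) + X + RtoC nu).
    { unfold n1, nL, eL. rewrite !rt_upper_w by exact HI. exact E. }
    replace (n1 (arc x (PI / 2)) - n1 (arc x 0) + (nL (arc x PI) - nL (arc x (PI / 2))) + H * (eL (arc x PI) - eL (arc x (PI / 2))))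
      with (X + RtoC nu - n1 (arc x 0) + nL (arc x PI) + H * eL (arc x PI)).
    2:{ transitivity ((n1 (arc x (PI / 2)) - nL (arc x (PI / 2))) - H * eL (arc x (PI / 2)) - n1 (arc x 0) + nL (arc x PI) + H * eL (arc x PI)); [rewrite En|]; ring. }
    assert (J1 : Im (n1 (arc x 0)) = 0%R).
    { unfold n1. rewrite arc_0. apply double_prim_axis; auto; [lia | apply axis_rt_false; lra |].
      apply chart_dom_rt, interval_slit_chart_slit_right. now apply interval_slit_0_R. }
    assert (J2 : Im (nL (arc x PI)) = 0%R).
    { unfold nL. rewrite arc_PI. apply double_prim_axis; auto; [lia | apply axis_rt_true; lra |].
      apply chart_dom_rt, interval_slit_chart_slit_left. apply interval_slit_R; intros; try lia. lra. }
    assert (J3 : Im (eL (arc x PI)) = 0%R).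
    { unfold eL. rewrite arc_PI. now apply chart_prim_left_end. }
    unfold Im in *; simpl in *. rewrite J1, J2, J3, IH0. ring. }
  rewrite <- IL. destruct V0 as [v v']. destruct H as [h h']. unfold Im, Re in *; simpl in *. subst v'. 
  replace h' with 0%R by lra. field.
Qed.
End ReciprocityLaw.

(** * Linear algebra *)

Fixpoint rsum (g : nat -> R) (n : nat) : R :=
  match n with 0%nat => 0%R | S n' => (rsum g n' + g n')%R end.

Lemma rsum_ext g h n : (forall k, (k < n)%nat -> g k = h k) -> rsum g n = rsum h n.
Proof. induction n as [|n IH]; intros H; simpl; [reflexivity|]. rewrite IH, H; auto. Qed.

Lemma rsum_plus g h n : rsum (fun k => g k + h k)%R n = (rsum g n + rsum h n)%R.
Proof. induction n as [|n IH]; simpl; [ring | rewrite IH; ring]. Qed.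

Lemma rsum_scal a g n : rsum (fun k => a * g k)%R n = (a * rsum g n)%R.
Proof. induction n as [|n IH]; simpl; [ring | rewrite IH; ring]. Qed.

Lemma rsum_0 n : rsum (fun _ => 0%R) n = 0%R.
Proof. induction n as [|n IH]; simpl; [ring | rewrite IH; ring]. Qed.

(** Renumbering of the indices different from p. *)
Definition skip_at (p k : nat) : nat := if Nat.ltb k p then k else S k.

Lemma rsum_skip g p n : (p <= n)%nat -> rsum g (S n) = (g p + rsum (fun k => g (skip_at p k)) n)%R.
Proof.
  intros Hp. induction n as [|n IH].
  - replace p with 0%nat by lia. simpl. ring.
  - destruct (Nat.eq_dec p (S n)) as [->|N].
    + change (rsum g (S (S n))) with (rsum g (S n) + g (S n))%R.
      rewrite (rsum_ext (fun k => g (skip_at (S n) k)) g); [ring|].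
      intros k Hk. unfold skip_at. destruct (Nat.ltb_spec k (S n)); [reflexivity | lia].
    + change (rsum g (S (S n))) with (rsum g (S n) + g (S n))%R. rewrite IH by lia.
      simpl rsum. unfold skip_at at 3. destruct (Nat.ltb_spec n p); [lia|]. ring.
Qed.

(** Gaussian elimination of the last equation, n equations in n + 1
    unknowns. *)
Lemma kernel_exists n : forall M : nat -> nat -> R, exists x : nat -> R,
  (exists k, (k <= n)%nat /\ x k <> 0%R) /\
  forall j, (j < n)%nat -> rsum (fun k => M j k * x k)%R (S n) = 0%R.
Proof.
  induction n as [|n IH]; intros M.
  - exists (fun _ => 1%R). split; [exists 0%nat; split; [lia | lra] | intros; lia].
  - destruct (classic (exists p, (p <= S n)%nat /\ M n p <> 0%R)) as [[p [Hp Np]]|N].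
    + destruct (IH (fun j k => M j (skip_at p k) - M n (skip_at p k) / M n p * M j p)%R) as [y [[k0 [Hk0 Ny]] Hy]].
      set (xp := (- rsum (fun k => M n (skip_at p k) * y k) (S n) / M n p)%R).
      set (x := fun k => if Nat.ltb k p then y k else if Nat.eqb k p then xp else y (pred k)).
      assert (Xs : forall k, x (skip_at p k) = y k).
      { intros k. unfold x, skip_at. destruct (Nat.ltb_spec k p).
        - destruct (Nat.ltb_spec k p); [reflexivity | lia].
        - destruct (Nat.ltb_spec (S k) p); [lia|]. destruct (Nat.eqb_spec (S k) p); [lia | reflexivity]. }
      assert (Xp : x p = xp).
      { unfold x. destruct (Nat.ltb_spec p p); [lia|]. now rewrite Nat.eqb_refl. }
      exists x. split.
      * exists (skip_at p k0). split; [unfold skip_at; destruct (Nat.ltb k0 p); lia | now rewrite Xs].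
      * intros j Hj. rewrite (rsum_skip _ p) by exact Hp. rewrite Xp.
        rewrite (rsum_ext _ (fun k => M j (skip_at p k) * y k)%R) by (intros k _; now rewrite Xs).
        destruct (Nat.eq_dec j n) as [->|Nj].
        -- unfold xp. field. exact Np.
        -- assert (E := Hy j ltac:(lia)).
           rewrite (rsum_ext _ (fun k => M j (skip_at p k) * y k + (- (M j p / M n p)) * (M n (skip_at p k) * y k))%R) in E
             by (intros; field; exact Np).
           rewrite rsum_plus, rsum_scal in E. unfold xp.
           replace (rsum (fun k => M j (skip_at p k) * y k)%R (S n)) with (M j p / M n p * rsum (fun k => M n (skip_at p k) * y k) (S n))%R by lra.
           field. exact Np.
    + destruct (IH M) as [y [[k0 [Hk0 Ny]] Hy]].
      exists (fun k => if Nat.leb k n then y k else 0%R). split.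
      * exists k0. split; [lia|]. destruct (Nat.leb_spec k0 n); [exact Ny | lia].
      * intros j Hj. change (rsum ?g (S (S n))) with (rsum g (S n) + g (S n))%R.
        cbv beta. destruct (Nat.leb_spec (S n) n); [lia|]. rewrite Rmult_0_r, Rplus_0_r.
        destruct (Nat.eq_dec j n) as [->|Nj].
        -- rewrite (rsum_ext _ (fun _ => 0%R)); [apply rsum_0|]. intros k Hk.
           destruct (Req_dec (M n k) 0) as [->|E]; [ring|]. exfalso. apply N. exists k. split; [lia | exact E].
        -- rewrite <- (Hy j) by lia. apply rsum_ext. intros k Hk. destruct (Nat.leb_spec k n); [reflexivity | lia].
Qed.

Lemma injective_surjective n (M : nat -> nat -> R) :
  (forall x : nat -> R, (forall j, (j < n)%nat -> rsum (fun k => M j k * x k)%R n = 0%R) ->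
     forall k, (k < n)%nat -> x k = 0%R) ->
  forall e : nat -> R, exists x : nat -> R, forall j, (j < n)%nat -> rsum (fun k => M j k * x k)%R n = e j.
Proof.
  intros Inj e.
  destruct (kernel_exists n (fun j k => if Nat.ltb k n then M j k else (- e j)%R)) as [x [[k0 [Hk0 Nx]] Hx]].
  assert (E : forall j, (j < n)%nat -> rsum (fun k => M j k * x k)%R n = (e j * x n)%R).
  { intros j Hj. assert (K := Hx j Hj). simpl in K. destruct (Nat.ltb_spec n n); [lia|].
    rewrite (rsum_ext _ (fun k => M j k * x k)%R) in K; [lra|].
    intros k Hk. destruct (Nat.ltb_spec k n); [reflexivity | lia]. }
  destruct (Req_dec (x n) 0) as [Z|NZ].
  - exfalso. apply Nx. destruct (Nat.eq_dec k0 n) as [->|N0]; [exact Z|].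
    apply (Inj x); [|lia]. intros j Hj. rewrite E, Z by exact Hj. ring.
  - exists (fun k => x k / x n)%R. intros j Hj.
    rewrite (rsum_ext _ (fun k => / x n * (M j k * x k))%R) by (intros; field; exact NZ).
    rewrite rsum_scal, E by exact Hj. field. exact NZ.
Qed.

(** * Real polynomials with prescribed half periods *)

Definition rpoly (x : nat -> R) (n : nat) : C -> C := peval (map (fun k => RtoC (x k)) (seq 0 n)).

Lemma rpoly_S x n z : rpoly x (S n) z = RtoC (x n) * z ^ n + rpoly x n z.
Proof.
  unfold rpoly. rewrite seq_S, map_app. change (map ?g (?a :: nil)) with (g a :: nil).
  rewrite peval_app, length_map, length_seq. simpl. ring.
Qed.

Lemma rpoly_real x n : real_on_R (rpoly x n).
Proof.
  intros t. unfold rpoly. generalize (seq 0 n). induction l as [|a l IH]; [reflexivity|].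
  simpl. rewrite (real_eq _ IH). unfold Im; simpl. ring.
Qed.

Definition mono (n : nat) (z : C) : C := z ^ n.

Lemma entire_pow n : entire (mono n).
Proof.
  unfold mono. induction n as [|n IH]; simpl; [apply holo_const|].
  apply (holo_mult _ (fun z => z)); [apply holo_id | exact IH].
Qed.

Lemma real_period_linear i a f g : (1 <= i < 2 * d)%nat -> entire f -> entire g ->
  real_period i (fun z => RtoC a * f z + g z) = (a * real_period i f + real_period i g)%R.
Proof.
  intros Hi Hf Hg. unfold real_period. rewrite half_period_linear by auto.
  replace (Ci ^ i * (RtoC a * half_period i f + half_period i g)) with (RtoC a * (Ci ^ i * half_period i f) + Ci ^ i * half_period i g) by ring.
  unfold Re; simpl; ring.
Qed.

Lemma real_period_ext i f g : (forall z, f z = g z) -> real_period i f = real_period i g.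
Proof. intros H. unfold real_period. now rewrite (half_period_ext i f g H). Qed.

Lemma real_period_zero i (f : C -> C) : (1 <= i < 2 * d)%nat -> (forall z, f z = 0) -> half_period i f = 0.
Proof.
  intros Hi H. rewrite (half_period_ext i f (fun z => 0 * (fun _ => 0) z)) by (intros; rewrite H; ring).
  rewrite (half_period_scal i 0 (fun _ => 0)) by (auto; apply holo_const). ring.
Qed.

Lemma real_period_rpoly i x n : (1 <= i < 2 * d)%nat -> real_period i (rpoly x n) = rsum (fun k => real_period i (mono k) * x k)%R n.
Proof.
  intros Hi. induction n as [|n IH].
  - unfold real_period. rewrite (real_period_zero i (rpoly x 0)); [unfold Re; simpl; ring | exact Hi | reflexivity].
  - rewrite (real_period_ext i _ _ (rpoly_S x n)). 
    rewrite (real_period_linear i (x n) (mono n)); [|exact Hi | apply entire_pow | apply peval_entire].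
    rewrite IH. simpl. ring.
Qed.

Lemma rpoly_zero x n : (forall z, rpoly x n z = 0) -> forall k, (k < n)%nat -> x k = 0%R.
Proof.
  intros H k Hk. assert (E := peval_zero_coef _ H k).
  rewrite (nth_indep _ (RtoC 0) (RtoC (x 0%nat))) in E by (rewrite length_map, length_seq; exact Hk).
  rewrite (map_nth (fun k => RtoC (x k))), seq_nth in E by exact Hk. now apply RtoC_inj in E.
Qed.

(** Each vanishing half period gives a root in the corresponding interval, and
    n distinct roots kill a polynomial with n coefficients. *)
Lemma vanishing_half_periods (I : nat -> nat) n x :
  (forall j, (j < n)%nat -> (1 <= I j < 2 * d)%nat) ->
  (forall j k, (j < n)%nat -> (k < n)%nat -> I j = I k -> j = k) ->
  (forall j, (j < n)%nat -> real_period (I j) (rpoly x n) = 0%R) -> forall z, rpoly x n z = 0.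
Proof.
  intros HI Inj Hz.
  assert (Rt : forall m, (m <= n)%nat -> exists rs : list C, length rs = m /\ NoDup rs /\
     (forall r, In r rs -> rpoly x n r = 0) /\
     (forall r, In r rs -> exists j t, (j < m)%nat /\ (c (S (I j)) < t < c (I j))%R /\ r = RtoC t)).
  { induction m as [|m IH]; intros Hm.
    - exists nil. repeat split; try constructor; intros r [].
    - destruct IH as [rs [R1 [R2 [R3 R4]]]]; [lia|].
      destruct (real_period_0_root (I m) (rpoly x n) (HI m ltac:(lia)) (peval_entire _) (rpoly_real x n) (Hz m ltac:(lia))) as [t [Ht Et]].
      exists (RtoC t :: rs). split; [simpl; now rewrite R1|]. split; [|split].
      + constructor; [|exact R2]. intros HIn. destruct (R4 _ HIn) as [j [t' [Hj [Ht' E]]]].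
        apply RtoC_inj in E. subst t'.
        assert (HIm := HI m ltac:(lia)). assert (HIj := HI j ltac:(lia)).
        destruct (Nat.lt_trichotomy (I j) (I m)) as [L|[L|L]].
        * assert (c (I m) <= c (S (I j)))%R by (apply c_decr_le; lia). lra.
        * apply Inj in L; lia.
        * assert (c (I j) <= c (S (I m)))%R by (apply c_decr_le; lia). lra.
      + intros r [<-|Hr]; auto.
      + intros r [<-|Hr].
        * exists m, t. split; [lia|]. auto.
        * destruct (R4 r Hr) as [j [t' [Hj K]]]. exists j, t'. split; [lia | exact K]. }
  destruct (Rt n (le_n n)) as [rs [R1 [R2 [R3 R4]]]].
  apply (peval_roots rs); auto. rewrite R1, length_map, length_seq. lia.
Qed.

(** The map from coefficients to half periods is injective by
    [vanishing_half_periods], hence surjective. *)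
Lemma prescribed_half_periods (I : nat -> nat) n (e : nat -> R) :
  (forall j, (j < n)%nat -> (1 <= I j < 2 * d)%nat) ->
  (forall j k, (j < n)%nat -> (k < n)%nat -> I j = I k -> j = k) ->
  exists x, forall j, (j < n)%nat -> real_period (I j) (rpoly x n) = e j.
Proof.
  intros HI Inj.
  destruct (injective_surjective n (fun j k => real_period (I j) (mono k))) with (e := e) as [x Hx].
  - intros x Hx. apply rpoly_zero. apply (vanishing_half_periods I); auto.
    intros j Hj. rewrite real_period_rpoly by auto. now apply Hx.
  - exists x. intros j Hj. rewrite real_period_rpoly by auto. now apply Hx.
Qed.

Lemma gap_half_period m f : (1 <= m < d)%nat -> entire f -> real_on_R f ->
  half_period (2 * m) f = RtoC ((-1) ^ m * real_period (2 * m) f).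
Proof.
  intros Hm Hf HR. assert (E := half_period_real_period (2 * m) f ltac:(lia) Hf HR).
  rewrite Ci_pow_even in E. rewrite RtoC_mult, <- E, Cmult_assoc, <- RtoC_mult.
  replace ((-1) ^ m * (-1) ^ m)%R with 1%R by (destruct (pow_m1_sign m) as [-> | ->]; ring). ring.
Qed.

Lemma band_half_period l f : (1 <= l <= d)%nat -> entire f -> real_on_R f ->
  half_period (2 * l - 1) f = Ci * RtoC ((-1) ^ l * real_period (2 * l - 1) f).
Proof.
  intros Hl Hf HR. assert (E := half_period_real_period (2 * l - 1) f ltac:(lia) Hf HR).
  assert (E2 := Ci_pow_even l). replace (2 * l)%nat with (S (2 * l - 1)) in E2 at 1 by lia.
  change (Ci ^ S (2 * l - 1)) with (Ci * Ci ^ (2 * l - 1)) in E2.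
  rewrite RtoC_mult, <- E, <- E2.
  transitivity (((Ci ^ (2 * l - 1) * Ci) * (Ci * Ci ^ (2 * l - 1))) * half_period (2 * l - 1) f); [|ring].
  rewrite (Cmult_comm (Ci ^ (2 * l - 1)) Ci), E2, <- RtoC_mult.
  replace ((-1) ^ l * (-1) ^ l)%R with 1%R by (destruct (pow_m1_sign l) as [-> | ->]; ring). ring.
Qed.

Definition re_coef (l : list C) (k : nat) : R := Re (nth k l 0).
Definition im_coef (l : list C) (k : nat) : R := Im (nth k l 0).

Lemma peval_re_im l z : peval l z = Ci * rpoly (im_coef l) (length l) z + rpoly (re_coef l) (length l) z.
Proof.
  unfold rpoly. 
  revert z. induction l as [|a l IH]; intros z; [simpl; ring|].
  simpl length. cbn [seq map peval]. rewrite <- !seq_shift, !map_map.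
  rewrite IH. unfold re_coef at 2 3, im_coef at 2 3. cbn [nth].
  unfold re_coef, im_coef. cbn [nth].
  replace a with (RtoC (Re a) + Ci * RtoC (Im a)) at 1.
  - ring.
  - destruct a as [p q]. unfold RtoC, Ci, Cplus, Cmult, Re, Im; simpl. f_equal; ring.
Qed.

Lemma half_period_re_im i l : (1 <= i < 2 * d)%nat ->
  half_period i (peval l) = Ci * half_period i (rpoly (im_coef l) (length l)) + half_period i (rpoly (re_coef l) (length l)).
Proof.
  intros Hi. rewrite <- half_period_linear by (auto; apply peval_entire).
  apply half_period_ext. intros z. apply peval_re_im.
Qed.

(** * Sums over bands and gaps *)

Lemma csum_odd_even g q : forall p, csum g (seq (2 * p + 1) (2 * q + 1)) =
  csum (fun l => g (2 * l - 1)%nat) (seq (S p) (S q)) + csum (fun m => g (2 * m)%nat) (seq (S p) q).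
Proof.
  induction q as [|q IH]; intros p.
  - simpl. replace (p + S (p + 0) - 0)%nat with (p + (p + 0) + 1)%nat by lia. ring.
  - replace (2 * S q + 1)%nat with (S (S (2 * q + 1))) by lia.
    cbn [seq csum]. replace (S (S (2 * p + 1))) with (2 * S p + 1)%nat by lia. rewrite IH.
    replace (S (2 * p + 1)) with (2 * S p)%nat by lia. replace (2 * S p - 1)%nat with (2 * p + 1)%nat by lia.
    cbn [seq csum]. ring.
Qed.

Lemma band_sum_imaginary f s : entire f -> real_on_R f -> (forall l, In l s -> (1 <= l <= d)%nat) ->
  Re (csum (fun l => half_period (2 * l - 1) f) s) = 0%R.
Proof.
  intros Ef Rf. induction s as [|k s IH]; intros Hs; [reflexivity|]. simpl csum.
  assert (A1 := IH (fun k Hk => Hs k (or_intror Hk))).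
  rewrite (band_half_period k) by (auto; apply Hs; now left). unfold Re in *; simpl in *. rewrite A1. ring.
Qed.

(** The sum of all half periods is real by [reciprocity], and so are those over
    gaps; the ones over bands are imaginary, so their sum vanishes. *)
Lemma band_relation_real x : (2 <= d)%nat ->
  csum (fun l => half_period (2 * l - 1) (rpoly x (d - 1))) (seq 1 d) = 0.
Proof.
  intros Hd. set (f := rpoly x (d - 1)).
  assert (Ef : entire f) by apply peval_entire. assert (Rf : real_on_R f) by apply rpoly_real.
  destruct (reciprocity (map (fun k => RtoC (x k)) (seq 0 (d - 1))) nil 0 Hd) as [V [_ [HI _]]].
  - rewrite length_map, length_seq. lia.
  - simpl. lia.
  - destruct (d - 1)%nat; reflexivity.
  - exact Rf.
  - intros t. reflexivity.
  - fold (rpoly x (d - 1)) in HI. fold f in HI.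
    assert (E := csum_odd_even (fun i => half_period i f) (d - 1) 0).
    replace (2 * 0 + 1)%nat with 1%nat in E by lia. replace (2 * (d - 1) + 1)%nat with (2 * d - 1)%nat in E by lia.
    replace (S (d - 1)) with d in E by lia. rewrite E in HI.
    assert (G0 : Im (csum (fun m => half_period (2 * m) f) (seq 1 (d - 1))) = 0%R).
    { apply Im_csum_0. intros m Hm. apply in_seq in Hm. rewrite gap_half_period by (auto; lia). reflexivity. }
    assert (B1 := band_sum_imaginary f (seq 1 d) Ef Rf).
    set (u := csum (fun l => half_period (2 * l - 1) f) (seq 1 d)) in *.
    assert (B2 : Re u = 0%R) by (apply B1; intros k Hk; apply in_seq in Hk; lia).
    destruct u as [a b]. unfold Re, Im in *; simpl in *. unfold RtoC. f_equal; lra.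
Qed.

Lemma band_relation l : (2 <= d)%nat -> length l = (d - 1)%nat ->
  csum (fun k => half_period (2 * k - 1) (peval l)) (seq 1 d) = 0.
Proof.
  intros Hd Hl.
  rewrite (csum_ext _ (fun k => Ci * half_period (2 * k - 1) (rpoly (im_coef l) (d - 1)) + half_period (2 * k - 1) (rpoly (re_coef l) (d - 1)))).
  - rewrite csum_plus, csum_scal, !band_relation_real by exact Hd. ring.
  - intros k Hk. apply in_seq in Hk. rewrite half_period_re_im by lia. now rewrite Hl.
Qed.

(** * The canonical homology basis *)

Section Basis.
Variable L : nat -> loop d c.
Hypothesis HL : forall i, (1 <= i < 2 * d)%nat -> is_oval i (L i).
Hypothesis Hd : (2 <= d)%nat.

(** The oval over the gap separating the j leftmost bands from the others, and
    a cycle surrounding these j bands.  The sign of the latter is the one that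
    makes the intersection number of the two cycles + 1. *)
Definition a_cycle (j : nat) : cycle d c := (1%Z, L (2 * (d - j))) :: nil.
Definition b_cycle (j : nat) : cycle d c := map (fun l => ((-1)%Z, L (2 * l - 1))) (seq (d + 1 - j) j).

Lemma loop_intersection_far i k : (1 <= i < 2 * d)%nat -> (1 <= k < 2 * d)%nat ->
  i <> S k -> k <> S i -> loop_intersection (L i) (L k) 0.
Proof.
  intros Hi Hk N1 N2. destruct (Nat.lt_trichotomy i k) as [Q|[Q|Q]].
  - right. assert (I1 : (1 <= i)%nat) by lia. assert (I2 : (S i < k < 2 * d)%nat) by lia.
    exact (proj1 (oval_far i k _ _ I1 I2 (HL i Hi) (HL k Hk))).
  - left. now subst.
  - right. assert (I1 : (1 <= k)%nat) by lia. assert (I2 : (S k < i < 2 * d)%nat) by lia.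
    exact (proj2 (oval_far k i _ _ I1 I2 (HL k Hk) (HL i Hi))).
Qed.

Lemma intersection_zero (A B : cycle d c) :
  (forall x y, In x A -> In y B -> loop_intersection (snd x) (snd y) 0) -> intersection A B 0.
Proof.
  intros H. exists (fun _ _ => 0%Z). split; [exact H|].
  generalize (list_prod A B). induction l as [|x l IH]; [reflexivity|].
  simpl. rewrite <- IH. ring.
Qed.

Lemma in_b_cycle x j : (j <= d)%nat -> In x (b_cycle j) -> exists l, (d + 1 - j <= l <= d)%nat /\ x = ((-1)%Z, L (2 * l - 1)).
Proof.
  intros Hj H. apply in_map_iff in H. destruct H as [l [<- Hl]]. apply in_seq in Hl. exists l. split; [lia | reflexivity].
Qed.

Lemma zsum_indicator p v : forall m s, fold_right Z.add 0%Z (map (fun l => if Nat.eqb l p then v else 0%Z) (seq s m)) =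
  (if andb (Nat.leb s p) (Nat.ltb p (s + m)) then v else 0%Z).
Proof.
  induction m as [|m IH]; intros s.
  - simpl. destruct (Nat.leb_spec s p), (Nat.ltb_spec p (s + 0)); simpl; try reflexivity; lia.
  - cbn [seq map fold_right]. rewrite IH.
    destruct (Nat.eqb_spec s p), (Nat.leb_spec s p), (Nat.leb_spec (S s) p), (Nat.ltb_spec p (S s + m)), (Nat.ltb_spec p (s + S m));
      simpl; try lia.
Qed.

Lemma zsum_plus (g h : nat -> Z) l :
  fold_right Z.add 0%Z (map (fun k => (g k + h k)%Z) l) = (fold_right Z.add 0%Z (map g l) + fold_right Z.add 0%Z (map h l))%Z.
Proof. induction l as [|x l IH]; simpl; [reflexivity | rewrite IH; ring]. Qed.

(** The oval over the gap g meets those over the bands g + 1 and g - 1, with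
    opposite signs; both belong to [b_cycle j] when i < j, only the former when
    i = j, none when i > j. *)
Lemma intersection_ab i j : (1 <= i <= d - 1)%nat -> (1 <= j <= d - 1)%nat ->
  intersection (a_cycle i) (b_cycle j) (kronecker i j).
Proof.
  intros Hi Hj. set (g := (2 * (d - i))%nat).
  set (sg := fun l => (if Nat.eqb l (d - i + 1) then -1 else if Nat.eqb l (d - i) then 1 else 0)%Z).
  (* The second loop is recognized by its starting point, the right end of its band. *)
  set (N := fun (_ h : loop d c) => let x := Re (fst (point h 0)) in
     (if Req_EM_T x (c (g + 1)%nat) then -1 else if Req_EM_T x (c (g - 1)%nat) then 1 else 0)%Z).
  assert (NE : forall l, (1 <= l <= d)%nat -> N (L g) (L (2 * l - 1)) = sg l).
  { intros l Hl. unfold N. destruct (HL (2 * l - 1) ltac:(lia)) as [HP _]. rewrite HP. cbn [fst].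
    assert (E : oval_x (2 * l - 1) 0 = c (2 * l - 1)%nat).
    { unfold oval_x, mid, rad. rewrite Rmult_0_r, cos_0. field. }
    rewrite E. cbn [Re RtoC fst]. unfold sg.
    assert (CI : forall p q, (1 <= p <= 2 * d)%nat -> (1 <= q <= 2 * d)%nat -> c p = c q -> p = q).
    { intros p q Hp Hq Epq. destruct (Nat.lt_trichotomy p q) as [Q|[Q|Q]]; [|exact Q|].
      - assert (c q < c p)%R by (apply c_decr; lia). lra.
      - assert (c p < c q)%R by (apply c_decr; lia). lra. }
    destruct (Req_EM_T (c (2 * l - 1)%nat) (c (g + 1)%nat)) as [E1|E1], (Nat.eqb_spec l (d - i + 1)) as [F1|F1].
    - reflexivity.
    - apply CI in E1; unfold g in *; lia.
    - exfalso. apply E1. f_equal. unfold g. lia.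
    - destruct (Req_EM_T (c (2 * l - 1)%nat) (c (g - 1)%nat)) as [E2|E2], (Nat.eqb_spec l (d - i)) as [F2|F2].
      + reflexivity.
      + apply CI in E2; unfold g in *; lia.
      + exfalso. apply E2. f_equal. unfold g. lia.
      + reflexivity. }
  exists N. split.
  - intros x y [<-|[]] Hy. apply in_b_cycle in Hy; [|lia]. destruct Hy as [l [Hl ->]]. cbn [snd]. fold g.
    rewrite NE by lia. unfold sg.
    destruct (Nat.eqb_spec l (d - i + 1)) as [F1|F1]; [|destruct (Nat.eqb_spec l (d - i)) as [F2|F2]].
    + right. replace (2 * l - 1)%nat with (S g) by (unfold g; lia).
      assert (I1 : (1 <= g)%nat) by (unfold g; lia). assert (I2 : (S (S g) <= 2 * d)%nat) by (unfold g; lia).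
      apply (oval_next g _ _ I1 I2); apply HL; unfold g; lia.
    + right. assert (Eg : g = S (2 * l - 1)) by (unfold g; lia). rewrite Eg.
      assert (I1 : (1 <= 2 * l - 1)%nat) by lia. assert (I2 : (S (S (2 * l - 1)) <= 2 * d)%nat) by (unfold g in *; lia).
      apply (oval_next (2 * l - 1) _ _ I1 I2); apply HL; unfold g in *; lia.
    + apply loop_intersection_far; unfold g; lia.
  - unfold a_cycle. fold g. cbn [list_prod]. rewrite app_nil_r. unfold b_cycle. rewrite !map_map. cbn [fst snd].
    rewrite (map_ext_in _ (fun l => ((if Nat.eqb l (d - i + 1) then 1 else 0) + (if Nat.eqb l (d - i) then -1 else 0))%Z)).
    + rewrite zsum_plus, !zsum_indicator. unfold kronecker.
      destruct (Nat.leb_spec (d + 1 - j) (d - i + 1)), (Nat.ltb_spec (d - i + 1) (d + 1 - j + j)),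
        (Nat.leb_spec (d + 1 - j) (d - i)), (Nat.ltb_spec (d - i) (d + 1 - j + j)), (Nat.eqb_spec i j); simpl; try lia.
    + intros l Hl. apply in_seq in Hl. rewrite NE by lia. unfold sg.
      destruct (Nat.eqb_spec l (d - i + 1)), (Nat.eqb_spec l (d - i)); lia.
Qed.

Lemma intersections_ok i j : (1 <= i <= d - 1)%nat -> (1 <= j <= d - 1)%nat ->
  intersection (a_cycle i) (a_cycle j) 0 /\ intersection (b_cycle i) (b_cycle j) 0 /\
  intersection (a_cycle i) (b_cycle j) (kronecker i j).
Proof.
  intros Hi Hj. split; [|split; [|now apply intersection_ab]]; apply intersection_zero.
  - intros x y [<-|[]] [<-|[]]. apply loop_intersection_far; lia.
  - intros x y Hx Hy. apply in_b_cycle in Hx; [|lia]. apply in_b_cycle in Hy; [|lia].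
    destruct Hx as [l [Hl ->]], Hy as [l' [Hl' ->]]. apply loop_intersection_far; lia.
Qed.

Lemma cycle_int_app w (A B : cycle d c) : cycle_int w (A ++ B) = cycle_int w A + cycle_int w B.
Proof. unfold cycle_int. induction A as [|x A IH]; simpl; [ring | rewrite IH; ring]. Qed.

Lemma cycle_int_scale w k (A : cycle d c) : cycle_int w (cycle_scale k A) = RtoC (IZR k) * cycle_int w A.
Proof.
  unfold cycle_int, cycle_scale. induction A as [|x A IH]; simpl; [ring|]. rewrite IH, mult_IZR, RtoC_mult. ring.
Qed.

Lemma cycle_int_comb w (a b : nat -> cycle d c) m n g : cycle_int w (cycle_comb g a b m n) =
  csum (fun j => RtoC (IZR (m j)) * cycle_int w (a j) + RtoC (IZR (n j)) * cycle_int w (b j)) (seq 1 g).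
Proof.
  unfold cycle_comb. induction (seq 1 g) as [|j l IH]; [reflexivity|].
  cbn [flat_map csum]. rewrite !cycle_int_app, !cycle_int_scale, IH. reflexivity.
Qed.

Section Periods.
Variables (w : abelian_differential) (f : C -> C).
Hypotheses (Ef : entire f) (Hw : forall p, factor w p = f (fst p)).

Lemma a_period j : (1 <= j <= d - 1)%nat -> cycle_int w (a_cycle j) = 2 * half_period (2 * (d - j)) f.
Proof.
  intros Hj. unfold a_cycle, cycle_int. cbn [fold_right fst snd].
  rewrite (oval_integral (2 * (d - j)) _ w f) by (auto; try apply HL; lia). ring.
Qed.

Lemma b_period j : (1 <= j <= d - 1)%nat -> cycle_int w (b_cycle j) =
  - (2) * csum (fun l => half_period (2 * l - 1) f) (seq (d + 1 - j) j).
Proof.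
  intros Hj. unfold b_cycle, cycle_int.
  assert (Hin : forall l, In l (seq (d + 1 - j) j) -> (1 <= l <= d)%nat) by (intros l Hl; apply in_seq in Hl; lia).
  revert Hin. induction (seq (d + 1 - j) j) as [|l s IH]; intros Hin; [simpl; ring|].
  cbn [map fold_right csum fst snd]. rewrite IH by (intros; apply Hin; now right).
  rewrite (oval_integral (2 * l - 1) _ w f); auto.
  - rewrite RtoC_m1. ring.
  - specialize (Hin l (or_introl eq_refl)). lia.
  - apply HL. specialize (Hin l (or_introl eq_refl)). lia.
Qed.
End Periods.

Lemma cycle_lattice (A : cycle d c) : exists n : nat -> Z, forall w f, entire f -> (forall p, factor w p = f (fst p)) ->
  cycle_int w A = 2 * lattice_sum n f.
Proof.
  induction A as [|[k g] A [n Hn]].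
  - exists (fun _ => 0%Z). intros w f Ef Hw. unfold lattice_sum.
    rewrite (csum_ext _ (fun _ => 0)), csum_0; [unfold cycle_int; simpl; ring|]. intros; ring.
  - destruct (loop_integral g ltac:(lia)) as [m Hm].
    exists (fun i => (k * m i + n i)%Z). intros w f Ef Hw.
    change (cycle_int w ((k, g) :: A)) with (RtoC (IZR k) * loop_int w g + cycle_int w A).
    rewrite (Hm w f Ef Hw), (Hn w f Ef Hw), lattice_sum_plus.
    replace (lattice_sum (fun i => (k * m i)%Z) f) with (RtoC (IZR k) * lattice_sum m f); [ring|].
    unfold lattice_sum. rewrite <- csum_scal. apply csum_ext. intros i _. rewrite mult_IZR, RtoC_mult. ring.
Qed.

Lemma csum_rev n : forall g s, csum (fun j => g (2 * s + n - 1 - j)%nat) (seq s n) = csum g (seq s n).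
Proof.
  induction n as [|n IH]; intros g s; [reflexivity|].
  rewrite seq_S at 2. rewrite csum_app. cbn [seq csum].
  rewrite (csum_ext _ (fun j => (fun i => g (i - 1)%nat) (2 * S s + n - 1 - j)%nat)).
  - rewrite (IH (fun i => g (i - 1)%nat)). rewrite <- seq_shift. replace (2 * s + S n - 1 - s)%nat with (s + n)%nat by lia.
    assert (E : csum (fun i => g (i - 1)%nat) (map S (seq s n)) = csum g (seq s n)).
    { generalize (seq s n). induction l as [|a l IHl]; [reflexivity|]. cbn [map csum]. rewrite IHl.
      now replace (S a - 1)%nat with a by lia. }
    rewrite E. ring.
  - intros j Hj. apply in_seq in Hj. f_equal. lia.
Qed.

(** Summation by parts; it expresses a combination of single bands through the
    tails of bands that the b-cycles surround. *)
Lemma abel_sum (Y B : nat -> C) n :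
  csum (fun p => (Y (S p) - Y p) * csum B (seq (S p) (S n - p))) (seq 1 n) =
  csum (fun l => (Y l - Y 1%nat) * B l) (seq 1 (S n)).
Proof.
  induction n as [|n IH].
  - simpl. ring.
  - rewrite (seq_S (S n)), csum_app, <- IH. rewrite (seq_S n) at 1. rewrite csum_app.
    rewrite (csum_ext _ (fun p => (Y (S p) - Y p) * csum B (seq (S p) (S n - p)) + B (S (S n)) * (Y (S p) - Y p))).
    + rewrite csum_plus, csum_scal.
      assert (T : csum (fun p => Y (S p) - Y p) (seq 1 n) = Y (S n) - Y 1%nat).
      { clear IH. induction n as [|n IH]; [simpl; ring|]. rewrite seq_S, csum_app, IH. simpl. ring. }
      rewrite T. replace (1 + n)%nat with (S n) by lia. replace (1 + S n)%nat with (S (S n)) by lia.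
      cbn [csum]. replace (S (S n) - S n)%nat with 1%nat by lia. cbn [seq csum]. ring.
    + intros p Hp. apply in_seq in Hp. replace (S (S n) - p)%nat with (S (S n - p)) by lia.
      rewrite seq_S, csum_app. replace (S p + (S n - p))%nat with (S (S n)) by lia. cbn [csum]. ring.
Qed.

(** The coefficients are the intersection numbers of A with the dual cycles.  The
    rightmost band does not occur in any b-cycle; [band_relation] accounts for
    it. *)
Lemma generating (A : cycle d c) : exists m n : nat -> Z,
  homologous A (cycle_comb (d - 1) a_cycle b_cycle m n).
Proof.
  destruct (cycle_lattice A) as [N HN].
  exists (fun j => N (2 * (d - j))%nat), (fun j => (N (2 * (d - j) - 1)%nat - N (2 * (d - j) + 1)%nat)%Z).
  intros w Hw. destruct (holomorphic_poly w Hd Hw) as [l [Ll Hl]].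
  assert (Ef := peval_entire l). set (f := peval l) in *.
  rewrite (HN w f Ef Hl), cycle_int_comb.
  set (B := fun k => half_period (2 * k - 1) f).
  rewrite (csum_ext _ (fun j => 2 * (RtoC (IZR (N (2 * (d - j))%nat)) * half_period (2 * (d - j)) f) +
     2 * ((RtoC (IZR (N (2 * (d - j) + 1)%nat)) - RtoC (IZR (N (2 * (d - j) - 1)%nat))) * csum B (seq (d + 1 - j) j)))).
  2:{ intros j Hj. apply in_seq in Hj. rewrite (a_period w f Ef Hl) by lia. rewrite (b_period w f Ef Hl) by lia.
      rewrite minus_IZR, RtoC_minus. fold B. ring. }
  rewrite csum_plus, !csum_scal.
  unfold lattice_sum.
  assert (E := csum_odd_even (fun i => RtoC (IZR (N i)) * half_period i f) (d - 1) 0).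
  replace (2 * 0 + 1)%nat with 1%nat in E by lia. replace (2 * (d - 1) + 1)%nat with (2 * d - 1)%nat in E by lia.
  replace (S (d - 1)) with d in E by lia. rewrite E.
  assert (EG : csum (fun j => RtoC (IZR (N (2 * (d - j))%nat)) * half_period (2 * (d - j)) f) (seq 1 (d - 1)) =
     csum (fun m => RtoC (IZR (N (2 * m)%nat)) * half_period (2 * m) f) (seq 1 (d - 1))).
  { rewrite <- (csum_rev (d - 1) (fun m => RtoC (IZR (N (2 * m)%nat)) * half_period (2 * m) f) 1).
    apply csum_ext. intros j Hj. now replace (2 * 1 + (d - 1) - 1 - j)%nat with (d - j)%nat by lia. }
  rewrite EG.
  set (Y := fun k => RtoC (IZR (N (2 * k - 1)%nat))).
  assert (EB : csum (fun j => (RtoC (IZR (N (2 * (d - j) + 1)%nat)) - RtoC (IZR (N (2 * (d - j) - 1)%nat))) * csum B (seq (d + 1 - j) j)) (seq 1 (d - 1)) =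
     csum (fun k => Y k * B k) (seq 1 d)).
  { rewrite (csum_ext _ (fun j => (fun p => (Y (S p) - Y p) * csum B (seq (S p) (S (d - 1) - p))) (2 * 1 + (d - 1) - 1 - j)%nat)).
    - rewrite (csum_rev (d - 1) (fun p => (Y (S p) - Y p) * csum B (seq (S p) (S (d - 1) - p)))), abel_sum. replace (S (d - 1)) with d by lia.
      rewrite (csum_ext _ (fun k => Y k * B k + - Y 1%nat * B k)) by (intros; ring).
      rewrite csum_plus, csum_scal. unfold B at 2. unfold f. rewrite (band_relation l Hd Ll). ring.
    - intros j Hj. apply in_seq in Hj. cbv beta. replace (2 * 1 + (d - 1) - 1 - j)%nat with (d - j)%nat by lia.
      unfold Y. replace (2 * S (d - j) - 1)%nat with (2 * (d - j) + 1)%nat by lia.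
      replace (S (d - j)) with (d + 1 - j)%nat by lia. now replace (S (d - 1) - (d - j))%nat with j by lia. }
  rewrite EB. unfold Y, B. ring.
Qed.

Definition real_differential (x : nat -> R) : abelian_differential :=
  AbelianDifferential (map (fun k => RtoC (x k)) (seq 0 (d - 1))) nil.

Lemma real_differential_factor x p : factor (real_differential x) p = rpoly x (d - 1) (fst p).
Proof. unfold factor, real_differential. simpl. unfold rpoly. ring. Qed.

Lemma real_differential_holomorphic x : holomorphic d c (real_differential x).
Proof. apply poly_holomorphic; [exact Hd|]. rewrite length_map, length_seq. lia. Qed.

Lemma csum_Re g l : Re (csum g l) = fold_right Rplus 0%R (map (fun k => Re (g k)) l).
Proof. induction l as [|a l IH]; [reflexivity|]. simpl. rewrite <- IH. unfold Re; simpl. reflexivity. Qed.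

Lemma Re_csum_single g l i : NoDup l -> In i l -> (forall k, In k l -> k <> i -> Re (g k) = 0%R) -> Re (csum g l) = Re (g i).
Proof.
  intros ND HI H0. rewrite csum_Re.
  induction l as [|a l IH]; [destruct HI|]. inversion ND as [|? ? N ND']; subst. cbn [map fold_right].
  assert (Z0 : forall l', (forall k, In k l' -> Re (g k) = 0%R) -> fold_right Rplus 0%R (map (fun k => Re (g k)) l') = 0%R).
  { induction l' as [|b l' IHl]; intros Hz; [reflexivity|]. cbn [map fold_right]. rewrite Hz by now left.
    rewrite IHl; [ring|]. intros; apply Hz; now right. }
  destruct (Nat.eq_dec a i) as [->|Na].
  - rewrite Z0; [ring|]. intros k Hk. apply H0; [now right|]. intros ->. contradiction.
  - destruct HI as [E|HI]; [contradiction|]. rewrite H0 by (auto; now left). rewrite IH; auto; [ring|].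
    intros; apply H0; auto. now right.
Qed.

Lemma csum_indicator (v : C) p : forall m s, csum (fun l => if Nat.eqb l p then v else 0) (seq s m) =
  (if andb (Nat.leb s p) (Nat.ltb p (s + m)) then v else 0).
Proof.
  induction m as [|m IH]; intros s.
  - simpl. destruct (Nat.leb_spec s p), (Nat.ltb_spec p (s + 0)); simpl; try reflexivity; lia.
  - cbn [seq csum]. rewrite IH.
    destruct (Nat.eqb_spec s p), (Nat.leb_spec s p), (Nat.leb_spec (S s) p), (Nat.ltb_spec p (S s + m)), (Nat.ltb_spec p (s + S m));
      cbn [andb]; try lia; ring.
Qed.

Lemma sgn_sq n : ((-1) ^ n * (-1) ^ n = 1)%R.
Proof. destruct (pow_m1_sign n) as [-> | ->]; ring. Qed.

Lemma prescribed_gaps (e : nat -> R) : exists x, forall m, (1 <= m <= d - 1)%nat ->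
  half_period (2 * m) (rpoly x (d - 1)) = RtoC (e m).
Proof.
  destruct (prescribed_half_periods (fun j => 2 * (j + 1))%nat (d - 1) (fun j => (-1) ^ (j + 1) * e (j + 1)%nat)%R) as [x Hx].
  - intros; lia.
  - intros; lia.
  - exists x. intros m Hm. rewrite gap_half_period by (try apply peval_entire; try apply rpoly_real; lia).
    assert (E := Hx (m - 1)%nat ltac:(lia)). cbv beta in E. replace (m - 1 + 1)%nat with m in E by lia.
    rewrite E. f_equal. rewrite <- Rmult_assoc, sgn_sq. ring.
Qed.

Lemma prescribed_bands (e : nat -> R) : exists x, forall l, (2 <= l <= d)%nat ->
  half_period (2 * l - 1) (rpoly x (d - 1)) = Ci * RtoC (e l).
Proof.
  destruct (prescribed_half_periods (fun j => 2 * (j + 2) - 1)%nat (d - 1) (fun j => (-1) ^ (j + 2) * e (j + 2)%nat)%R) as [x Hx].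
  - intros; lia.
  - intros; lia.
  - exists x. intros l Hl. rewrite band_half_period by (try apply peval_entire; try apply rpoly_real; lia).
    assert (E := Hx (l - 2)%nat ltac:(lia)). cbv beta in E. replace (l - 2 + 2)%nat with l in E by lia.
    rewrite E. do 2 f_equal. rewrite <- Rmult_assoc, sgn_sq. ring.
Qed.

(** Real differentials separate the two kinds of cycles, gaps having real and
    bands imaginary periods; each coefficient is then isolated by a differential
    with suitable prescribed periods. *)
Lemma independent (m n : nat -> Z) : homologous (cycle_comb (d - 1) a_cycle b_cycle m n) nil ->
  forall j, (1 <= j <= d - 1)%nat -> m j = 0%Z /\ n j = 0%Z.
Proof.
  intros H.
  set (P := fun x i => half_period i (rpoly x (d - 1))).
  assert (K : forall x, csum (fun j => RtoC (IZR (m j)) * P x (2 * (d - j))%nat -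
      RtoC (IZR (n j)) * csum (fun l => P x (2 * l - 1)%nat) (seq (d + 1 - j) j)) (seq 1 (d - 1)) = 0).
  { intros x. assert (E := H _ (real_differential_holomorphic x)). rewrite cycle_int_comb in E.
    change (cycle_int (real_differential x) nil) with (RtoC 0) in E.
    assert (Ef : entire (rpoly x (d - 1))) by apply peval_entire.
    rewrite (csum_ext _ (fun j => 2 * (RtoC (IZR (m j)) * P x (2 * (d - j))%nat -
      RtoC (IZR (n j)) * csum (fun l => P x (2 * l - 1)%nat) (seq (d + 1 - j) j)))) in E.
    - rewrite csum_scal in E.
      match goal with |- ?u = RtoC 0 => replace u with (2 * u / 2) by cfield end. rewrite E. unfold Cdiv. ring.
    - intros j Hj. apply in_seq in Hj.
      rewrite (a_period _ _ Ef (real_differential_factor x)) by lia.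
      rewrite (b_period _ _ Ef (real_differential_factor x)) by lia. unfold P. ring. }
  intros j0 Hj0. split.
  - destruct (prescribed_gaps (fun k => if Nat.eqb k (d - j0) then 1%R else 0%R)) as [x Hx].
    assert (E := f_equal Re (K x)).
    rewrite (Re_csum_single _ _ j0 (seq_NoDup _ _)) in E.
    + assert (BR : Re (csum (fun l => P x (2 * l - 1)%nat) (seq (d + 1 - j0) j0)) = 0%R).
      { apply band_sum_imaginary; [apply peval_entire | apply rpoly_real|].
        intros l Hl. apply in_seq in Hl. lia. }
      set (u := csum (fun l => P x (2 * l - 1)%nat) (seq (d + 1 - j0) j0)) in *. clearbody u.
      unfold P in E. rewrite Hx in E by lia. rewrite Nat.eqb_refl in E.
      unfold Re in *; simpl in *. rewrite BR in E. apply eq_IZR. lra.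
    + apply in_seq. lia.
    + intros k Hk Nk. apply in_seq in Hk.
      assert (BR : Re (csum (fun l => P x (2 * l - 1)%nat) (seq (d + 1 - k) k)) = 0%R).
      { apply band_sum_imaginary; [apply peval_entire | apply rpoly_real|].
        intros l Hl. apply in_seq in Hl. lia. }
      set (u := csum (fun l => P x (2 * l - 1)%nat) (seq (d + 1 - k) k)) in *. clearbody u.
      unfold P. rewrite Hx by lia. destruct (Nat.eqb_spec (d - k) (d - j0)); [lia|].
      unfold Re in *; simpl in *. rewrite BR. ring.
  - destruct (prescribed_bands (fun l => (if Nat.eqb l (d + 1 - j0) then 1 else 0) - (if Nat.eqb l (d - j0) then 1 else 0))%R) as [x Hx].
    assert (BS : forall j, (1 <= j <= d - 1)%nat -> csum (fun l => P x (2 * l - 1)%nat) (seq (d + 1 - j) j) =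
       Ci * (if Nat.eqb j j0 then 1 else 0)).
    { intros j Hj. rewrite (csum_ext _ (fun l => Ci * ((if Nat.eqb l (d + 1 - j0) then 1 else 0) + - (1) * (if Nat.eqb l (d - j0) then 1 else 0)))).
      - rewrite csum_scal, csum_plus, csum_scal, !csum_indicator. f_equal.
        destruct (Nat.leb_spec (d + 1 - j) (d + 1 - j0)), (Nat.ltb_spec (d + 1 - j0) (d + 1 - j + j)),
          (Nat.leb_spec (d + 1 - j) (d - j0)), (Nat.ltb_spec (d - j0) (d + 1 - j + j)), (Nat.eqb_spec j j0); cbn [andb]; try lia; ring.
      - intros l Hl. apply in_seq in Hl. unfold P. rewrite Hx by lia. rewrite RtoC_minus. f_equal.
        destruct (Nat.eqb l (d + 1 - j0)), (Nat.eqb l (d - j0)); ring. }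
    assert (E := f_equal (fun u => Re (Ci * u)) (K x)). cbv beta in E. rewrite <- csum_scal in E.
    rewrite (Re_csum_single _ _ j0 (seq_NoDup _ _)) in E.
    + rewrite BS in E by lia. rewrite Nat.eqb_refl in E. unfold P in E.
      rewrite gap_half_period in E by (try apply peval_entire; try apply rpoly_real; lia).
      unfold Re in E; simpl in E. apply eq_IZR. lra.
    + apply in_seq. lia.
    + intros k Hk Nk. apply in_seq in Hk. rewrite BS by lia.
      destruct (Nat.eqb_spec k j0); [contradiction|]. unfold P.
      rewrite gap_half_period by (try apply peval_entire; try apply rpoly_real; lia).
      unfold Re; simpl. ring.
Qed.

Theorem ovals_canonical : canonical_homology_basis a_cycle b_cycle.
Proof.
  split; [split|].
  - exact generating.
  - exact independent.
  - exact intersections_ok.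
Qed.

Lemma normalized_exists : exists omega, normalized a_cycle omega.
Proof.
  assert (E : forall k, exists x, forall m, (1 <= m <= d - 1)%nat ->
    half_period (2 * m) (rpoly x (d - 1)) = RtoC (if Nat.eqb m (d - k) then / 2 else 0)%R).
  { intros k. apply prescribed_gaps. }
  apply functional_choice in E. destruct E as [x Hx].
  exists (fun k => real_differential (x k)). intros k Hk. split; [apply real_differential_holomorphic|].
  intros j Hj. rewrite (a_period _ (rpoly (x k) (d - 1)) (peval_entire _) (real_differential_factor (x k))) by lia.
  rewrite Hx by lia. unfold kronecker.
  destruct (Nat.eqb_spec (d - j) (d - k)), (Nat.eqb_spec j k); try lia.
  - rewrite <- RtoC_mult. f_equal. field.
  - rewrite <- RtoC_mult. f_equal. simpl. ring.
Qed.

Lemma gap_uniqueness x : (forall m, (1 <= m <= d - 1)%nat -> half_period (2 * m) (rpoly x (d - 1)) = 0) ->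
  forall z, rpoly x (d - 1) z = 0.
Proof.
  intros H. apply (vanishing_half_periods (fun j => 2 * (j + 1))%nat); [intros; lia | intros; lia|].
  intros j Hj. unfold real_period. rewrite H by lia. unfold Re; simpl. ring.
Qed.

(** The imaginary part of the polynomial has zero periods over all gaps, so it
    vanishes. *)
Lemma normalized_real omega k : normalized a_cycle omega -> (1 <= k <= d - 1)%nat ->
  exists x, (forall p, factor (omega k) p = rpoly x (d - 1) (fst p)) /\
    forall m, (1 <= m <= d - 1)%nat ->
      half_period (2 * m) (rpoly x (d - 1)) = RtoC (if Nat.eqb m (d - k) then / 2 else 0)%R.
Proof.
  intros HN Hk. destruct (HN k Hk) as [Hh HP].
  destruct (holomorphic_poly _ Hd Hh) as [l [Ll Hl]].
  assert (Q : forall m, (1 <= m <= d - 1)%nat -> half_period (2 * m) (rpoly (im_coef l) (d - 1)) = 0 /\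
     half_period (2 * m) (rpoly (re_coef l) (d - 1)) = RtoC (if Nat.eqb m (d - k) then / 2 else 0)%R).
  { intros m Hm. assert (E := HP (d - m)%nat ltac:(lia)).
    rewrite (a_period _ _ (peval_entire l) Hl) in E by lia. replace (d - (d - m))%nat with m in E by lia.
    rewrite half_period_re_im, Ll in E by lia. 
    rewrite !gap_half_period in * by (try apply peval_entire; try apply rpoly_real; lia).
    set (u := ((-1) ^ m * real_period (2 * m) (rpoly (im_coef l) (d - 1)))%R) in *.
    set (v := ((-1) ^ m * real_period (2 * m) (rpoly (re_coef l) (d - 1)))%R) in *.
    unfold kronecker in E.
    assert (E1 := f_equal Re E). assert (E2 := f_equal Im E). unfold Re, Im in E1, E2. simpl in E1, E2.
    split; [f_equal; lra|]. f_equal.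
    destruct (Nat.eqb_spec (d - m) k), (Nat.eqb_spec m (d - k)); try lia; lra. }
  exists (re_coef l). split; [|intros m Hm; exact (proj2 (Q m Hm))].
  intros p. rewrite Hl, peval_re_im, Ll. rewrite (gap_uniqueness (im_coef l)); [ring|].
  intros m Hm. exact (proj1 (Q m Hm)).
Qed.
End Basis.

(** * A path from infinity minus to infinity plus *)

(** The part of the curve over [c_1, + infinity), run through with the
    coordinate w = t of the chart of c_1: it enters on the sheet of infinity
    minus, turns at the branch point and leaves on the other sheet. *)
Definition path_pt (t : R) : C * C := (RtoC (c 1%nat + t * t), RtoC t * chart_root 1 (RtoC (c 1%nat + t * t))).

Lemma chart_slit_1_R x : (1 <= d)%nat -> (c 1%nat <= x)%R -> chart_slit 1 (RtoC x).
Proof.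
  intros Hd Hx. apply chart_slit_R; [lia | lia|]. intros. assert (c 2%nat < c 1%nat)%R by (apply hc; lia). lra.
Qed.

Lemma path_exists : (1 <= d)%nat -> exists g : curve d c, forall t, point g t = path_pt t.
Proof.
  intros Hd. destruct (rt_prod_holo (skip_one 1) 1) as [S' HS]. fold (chart_root 1) in HS.
  set (zz := fun t : R => RtoC (c 1%nat + t * t)).
  assert (HU : forall t, chart_slit 1 (zz t)) by (intros t; apply chart_slit_1_R; [exact Hd | nra]).
  set (vz := fun t : R => RtoC (2 * t)).
  set (vm := fun t : R => 1 * chart_root 1 (zz t) + RtoC t * (S' (zz t) * vz t)).
  assert (Dz : forall t, is_derivC zz t (vz t)) by (intros t; apply is_derivC_RtoC; auto_derive; [trivial | ring]).
  assert (Cz : forall t, clim (locally t) zz (zz t)) by (intros t; exact (is_derivC_cont _ _ _ (Dz t))).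
  assert (Cv : forall t, clim (locally t) vz (vz t)).
  { intros t. apply (clim_deriv_R (fun t => (2 * t)%R) t 2%R). auto_derive; [trivial | ring]. }
  assert (Dm : forall t, is_derivC (fun t => RtoC t * chart_root 1 (zz t)) t (vm t)).
  { intros t. apply (is_derivC_mult (fun t => RtoC t) (fun t => chart_root 1 (zz t))); [apply is_derivC_id|].
    apply (is_derivC_comp (chart_root 1) zz); [apply HS, HU | apply Dz]. }
  assert (Cm : forall t, clim (locally t) vm (vm t)).
  { intros t. apply clim_plus; apply clim_mult; try apply clim_const; try apply clim_RtoC.
    - apply (clim_ccont zz (chart_root 1) _ (Cz t)). apply (holo_cont (chart_slit 1)); [apply rt_prod_holo | apply HU].
    - apply clim_mult; [|apply Cv]. apply (clim_ccont zz S' _ (Cz t)). apply HS, HU. }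
  assert (OC : forall t, on_curve d c (path_pt t)).
  { intros t. unfold on_curve, path_pt. cbn [fst snd]. rewrite (branch_poly_chart_root 1) by lia.
    rewrite RtoC_plus, RtoC_mult. ring. }
  exists (@Curve d c path_pt (fun t => (vz t, vm t)) OC Dz Dm
    (fun t => proj2 (continuousC _ _) (Cv t)) (fun t => proj2 (continuousC _ _) (Cm t))).
  reflexivity.
Qed.

Lemma square_infty : filterlim (fun t => (c 1%nat + t * t)%R) (Rbar_locally p_infty) (Rbar_locally p_infty).
Proof.
  intros P [M HM]. exists (Rmax 1 (M - c 1%nat)). intros t Ht. apply HM.
  generalize (Rmax_l 1 (M - c 1%nat)) (Rmax_r 1 (M - c 1%nat)). intros. nra.
Qed.

Lemma square_minfty : filterlim (fun t => (c 1%nat + t * t)%R) (Rbar_locally m_infty) (Rbar_locally p_infty).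
Proof.
  intros P [M HM]. exists (- Rmax 1 (M - c 1%nat))%R. intros t Ht. apply HM.
  generalize (Rmax_l 1 (M - c 1%nat)) (Rmax_r 1 (M - c 1%nat)). intros. nra.
Qed.

Lemma upper_root_chart_1 t : (1 <= d)%nat -> (0 < t)%R -> upper_root (RtoC (c 1%nat + t * t)) = RtoC t * chart_root 1 (RtoC (c 1%nat + t * t)).
Proof.
  intros Hd Ht. rewrite <- (interval_root_upper_root 0), (interval_root_right 0) by (try (apply interval_slit_0_R; [lia | nra]); unfold Im; simpl; lra || lia).
  rewrite rt_R_false by nra. do 2 f_equal. replace (c 1%nat + t * t - c 1%nat)%R with (t * t)%R by ring. apply sqrt_square. lra.
Qed.

Lemma path_infinity (g : curve d c) : (1 <= d)%nat -> (forall t, point g t = path_pt t) -> from_infty_minus_to_infty_plus g.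
Proof.
  intros Hd Hg. split.
  - apply (filterlim_ext_loc (fun t => (RtoC (c 1%nat + t * t), RtoC (-1) * upper_root (RtoC (c 1%nat + t * t))))).
    + exists 0%R. intros t Ht. rewrite Hg. unfold path_pt. f_equal.
      replace (t * t)%R with ((- t) * (- t))%R by ring. rewrite upper_root_chart_1 by (auto; lra).
      rewrite Cmult_assoc, <- RtoC_mult. do 2 f_equal. ring.
    + apply (filterlim_comp _ _ _ (fun t => (c 1%nat + t * t)%R) (fun x => (RtoC x, RtoC (-1) * upper_root (RtoC x))) _ (Rbar_locally p_infty)).
      * apply square_minfty.
      * apply real_to_infty. now right.
  - apply (filterlim_ext_loc (fun t => (RtoC (c 1%nat + t * t), RtoC 1 * upper_root (RtoC (c 1%nat + t * t))))).
    + exists 0%R. intros t Ht. rewrite Hg. unfold path_pt. f_equal.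
      rewrite upper_root_chart_1 by (auto; lra). ring.
    + apply (filterlim_comp _ _ _ (fun t => (c 1%nat + t * t)%R) (fun x => (RtoC x, RtoC 1 * upper_root (RtoC x))) _ (Rbar_locally p_infty)).
      * apply square_infty.
      * apply real_to_infty. now left.
Qed.

Lemma chart_pt_path t : (1 <= d)%nat -> chart_pt 1 (path_pt t) = RtoC t.
Proof.
  intros Hd. unfold chart_pt, path_pt. cbn [fst snd].
  assert (N : chart_root 1 (RtoC (c 1%nat + t * t)) <> 0) by (apply rt_prod_neq0, chart_slit_1_R; [exact Hd | nra]).
  field. exact N.
Qed.

Lemma RInt_gen_line (F f : R -> C) (la lb : C) :
  (forall x, is_derivC F x (f x) /\ clim (locally x) f (f x)) ->
  clim (Rbar_locally m_infty) F la -> clim (Rbar_locally p_infty) F lb ->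
  is_RInt_gen (V := C_R_NormedModule) f (Rbar_locally m_infty) (Rbar_locally p_infty) (lb - la).
Proof.
  intros HF Ha Hb P HP.
  assert (HL : clim (filter_prod (Rbar_locally m_infty) (Rbar_locally p_infty)) (fun ab : R * R => F (snd ab) - F (fst ab)) (lb - la)).
  { apply clim_minus.
    - apply (clim_comp (G := Rbar_locally p_infty) snd F lb); [apply filterlim_snd | exact Hb].
    - apply (clim_comp (G := Rbar_locally m_infty) fst F la); [apply filterlim_fst | exact Ha]. }
  apply clim_filterlim in HL; [|typeclasses eauto]. specialize (HL P HP). unfold filtermap in HL. unfold filtermapi.
  revert HL. apply filter_imp. intros [x y] K. exists (F y - F x). split; [|exact K].
  apply (RInt_C_derive_gen F f); intros t _; apply HF.
Qed.

(** The chart primitive is odd, so both halves of the path contribute V. *)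
Lemma path_integral_value (g : curve d c) w f V : (1 <= d)%nat -> (forall t, point g t = path_pt t) -> entire f ->
  (forall p, factor w p = f (fst p)) ->
  clim (Rbar_locally p_infty) (fun x => chart_prim 1 f (rt false 1 (RtoC x))) V ->
  is_RInt_gen (V := C_R_NormedModule) (pullback w g) (Rbar_locally m_infty) (Rbar_locally p_infty) (2 * V).
Proof.
  intros Hd Hg Ef Hw HV.
  assert (CP : clim (Rbar_locally p_infty) (fun t => chart_prim 1 f (RtoC t)) V).
  { apply (clim_ext_loc (fun t => chart_prim 1 f (rt false 1 (RtoC (c 1%nat + t * t))))).
    - exists 0%R. intros t Ht. f_equal. rewrite rt_R_false by nra.
      f_equal. replace (c 1%nat + t * t - c 1%nat)%R with (t * t)%R by ring. apply sqrt_square. lra.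
    - apply (clim_comp (fun t => (c 1%nat + t * t)%R) (fun x => chart_prim 1 f (rt false 1 (RtoC x))) V square_infty HV). }
  assert (CM : clim (Rbar_locally m_infty) (fun t => chart_prim 1 f (RtoC t)) (- V)).
  { apply (clim_ext (fun t => - chart_prim 1 f (RtoC (- t)))).
    - intros t. rewrite RtoC_opp. rewrite chart_prim_odd; [ring | lia | exact Ef|].
      unfold chart_dom, chart_z. rewrite <- RtoC_mult, <- RtoC_plus. apply chart_slit_1_R; [exact Hd | nra].
    - apply clim_opp. apply (clim_comp (G := Rbar_locally p_infty) (fun t : R => (- t)%R) (fun t => chart_prim 1 f (RtoC t)) V); [|exact CP].
      intros P [M HM]. exists (- M)%R. intros t Ht. apply HM. lra. }
  replace (2 * V) with (V - - V) by ring.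
  apply (RInt_gen_line (fun t => chart_prim 1 f (RtoC t))); [|exact CM | exact CP].
  intros t. assert (HU : chart_slit 1 (fst (point g t))) by (rewrite Hg; apply chart_slit_1_R; [exact Hd | nra]).
  destruct (curve_chart g w f Ef Hw 1 t ltac:(lia) HU) as [K1 K2]. split; [|exact K2].
  apply (is_derive_ext (V := C_R_NormedModule) (fun s => chart_prim 1 f (chart_pt 1 (point g s)))); [|exact K1].
  intros s. now rewrite Hg, chart_pt_path.
Qed.

(** * The differential of the third kind and the frequencies *)

Section ThirdKind.
Variable eta : abelian_differential.
Hypotheses (Hd : (2 <= d)%nat) (heta : third_kind d c eta) (hgap : gap_normalized d c eta).

Lemma over_real_even m x : (1 <= m <= d - 1)%nat -> (c (2 * m + 1)%nat < x < c (2 * m)%nat)%R ->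
  over_real d c x = (RtoC x, RtoC (abs_root x)).
Proof.
  intros Hm Hx. replace (2 * m + 1)%nat with (S (2 * m)) in Hx by lia.
  assert (HD : interval_slit (2 * m) (RtoC x)) by (apply interval_slit_interval; [lia | exact Hx]).
  destruct (branch_poly_R (2 * m) x ltac:(lia) HD) as [P [_ E]].
  unfold over_real. rewrite E, pow_1_even, Rmult_1_l, sqrt_square by lra.
  rewrite sqrt_neg_0 by nra. reflexivity.
Qed.

Lemma over_real_odd l x : (1 <= l <= d)%nat -> (c (2 * l)%nat < x < c (2 * l - 1)%nat)%R ->
  over_real d c x = (RtoC x, (0%R, abs_root x)).
Proof.
  intros Hl Hx. replace (2 * l)%nat with (S (2 * l - 1)) in Hx at 1 by lia.
  assert (HD : interval_slit (2 * l - 1) (RtoC x)) by (apply interval_slit_interval; [lia | exact Hx]).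
  destruct (branch_poly_R (2 * l - 1) x ltac:(lia) HD) as [P [_ E]].
  replace ((-1) ^ (2 * l - 1))%R with (-1)%R in E.
  - unfold over_real. rewrite E. rewrite sqrt_neg_0 by nra.
    replace (- (-1 * (abs_root x * abs_root x)))%R with (abs_root x * abs_root x)%R by ring. rewrite sqrt_square by lra. reflexivity.
  - replace (2 * l - 1)%nat with (S (2 * (l - 1))) by lia. now rewrite pow_1_odd.
Qed.

Lemma filter_prod_interval (a b : R) : (a < b)%R ->
  filter_prod (at_right a) (at_left b) (fun xy => (a < fst xy < b /\ a < snd xy < b)%R).
Proof.
  intros Hab. apply (Filter_prod _ _ _ (fun x => (a < x < b)%R) (fun x => (a < x < b)%R)); [| |auto].
  - now apply (at_right_imp a b).
  - now apply (at_left_imp a b).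
Qed.

Lemma is_RInt_gen_ext_interval {V : NormedModule R_AbsRing} (f g : R -> V) (a b : R) l : (a < b)%R ->
  (forall x, (a < x < b)%R -> f x = g x) ->
  is_RInt_gen f (at_right a) (at_left b) l -> is_RInt_gen g (at_right a) (at_left b) l.
Proof.
  intros Hab H. apply is_RInt_gen_ext.
  generalize (filter_prod_interval a b Hab). apply filter_imp. intros [u v] [Hu Hv] x Hx. simpl in *.
  apply H. unfold Rmin, Rmax in Hx. destruct (Rle_dec u v); lra.
Qed.

Lemma gaps_vanish q : entire q -> (forall p, factor eta p = q (fst p)) ->
  forall m, (1 <= m <= d - 1)%nat -> half_period (2 * m) q = 0.
Proof.
  intros Eq Hq m Hm.
  assert (I1 := interval_integral_C (2 * m) q ltac:(lia) Eq).
  assert (I2 := hgap m Hm).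
  assert (Hlt : (c (2 * m + 1)%nat < c (2 * m)%nat)%R) by (replace (2 * m + 1)%nat with (S (2 * m)) by lia; apply hc; lia).
  apply (is_RInt_gen_ext_interval _ (fun x => q (RtoC x) / RtoC (abs_root x))) in I2; [|exact Hlt|].
  - replace (2 * m + 1)%nat with (S (2 * m)) in I2 by lia.
    apply (is_RInt_gen_unique (V := C_R_CompleteNormedModule)) in I1; try typeclasses eauto.
    apply (is_RInt_gen_unique (V := C_R_CompleteNormedModule)) in I2; try typeclasses eauto.
    assert (E : - (Ci ^ (2 * m) * half_period (2 * m) q) = RtoC 0) by (transitivity (RInt_gen (V := C_R_CompleteNormedModule)
       (fun x => q (RtoC x) / RtoC (abs_root x)) (at_right (c (S (2 * m)))) (at_left (c (2 * m)%nat))); [symmetry; exact I1 | exact I2]).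
    assert (NC := Ci_pow_neq0 (2 * m)).
    replace (half_period (2 * m) q) with (- (- (Ci ^ (2 * m) * half_period (2 * m) q)) / Ci ^ (2 * m)) by cfield.
    rewrite E. cfield.
  - intros x Hx. unfold dz_coef. rewrite Hq, (over_real_even m) by (auto; lia). reflexivity.
Qed.

(** The leading coefficient is real, so the imaginary part of the polynomial
    gives a holomorphic differential; it has zero periods over all gaps. *)
Lemma third_kind_real : exists x : nat -> R,
  (forall p, factor eta p = rpoly x d (fst p)) /\ x (d - 1)%nat = (-1)%R.
Proof.
  destruct (third_kind_poly eta Hd heta) as [l [Ll [Nl Hl]]].
  assert (G := gaps_vanish (peval l) (peval_entire l) Hl).
  exists (re_coef l). split.
  - intros p. rewrite Hl, peval_re_im, Ll.
    assert (Top : im_coef l (d - 1) = 0%R) by (unfold im_coef; rewrite Nl; unfold Im; simpl; ring).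
    assert (ED : forall z, rpoly (im_coef l) d z = rpoly (im_coef l) (d - 1) z).
    { intros z. replace d with (S (d - 1)) at 1 by lia. rewrite rpoly_S, Top. ring. }
    assert (Z0 : forall z, rpoly (im_coef l) (d - 1) z = 0).
    { apply gap_uniqueness; try exact Hd. intros m Hm. rewrite <- (half_period_ext _ _ _ ED).
      assert (E := G m Hm). rewrite half_period_re_im, Ll in E by lia.
      rewrite !gap_half_period in * by (try apply peval_entire; try apply rpoly_real; lia).
      set (u := ((-1) ^ m * real_period (2 * m) (rpoly (im_coef l) d))%R) in *.
      set (v := ((-1) ^ m * real_period (2 * m) (rpoly (re_coef l) d))%R) in *. clearbody u v.
      apply (f_equal Im) in E. unfold Im in E. simpl in E. f_equal. lra. }
    rewrite ED, Z0. ring.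
  - unfold re_coef. rewrite Nl. unfold Re; simpl. ring.
Qed.

Variable x : nat -> R.
Hypotheses (Hx : forall p, factor eta p = rpoly x d (fst p)) (Hlead : x (d - 1)%nat = (-1)%R).
Notation A := (rpoly x d).

Lemma third_kind_gaps m : (1 <= m <= d - 1)%nat -> half_period (2 * m) A = 0.
Proof. apply gaps_vanish; [apply peval_entire | exact Hx]. Qed.

(** The vanishing integral over each gap yields a zero there.  These are all the
    zeros, so the sign alternates from band to band. *)
Lemma band_sign l t : (1 <= l <= d)%nat -> (c (2 * l)%nat < t < c (2 * l - 1)%nat)%R ->
  exists s : R, (0 < s)%R /\ A (RtoC t) = RtoC ((-1) ^ l * s).
Proof.
  assert (R1 : forall m, exists r, (1 <= m <= d - 1)%nat -> (c (S (2 * m)) < r < c (2 * m)%nat)%R /\ A (RtoC r) = 0).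
  { intros m. destruct (classic (1 <= m <= d - 1)%nat) as [Hm|N]; [|exists 0%R; tauto].
    destruct (real_period_0_root (2 * m) A ltac:(lia) (peval_entire _) (rpoly_real x d)) as [r Hr].
    - unfold real_period. rewrite third_kind_gaps by exact Hm. unfold Re; simpl. ring.
    - exists r. auto. }
  apply functional_choice in R1. destruct R1 as [xi Hxi].
  intros Hl Ht.
  assert (ND : NoDup (map xi (seq 1 (d - 1)))).
  { assert (Q : forall n s, (1 <= s)%nat -> (s + n <= d)%nat -> NoDup (map xi (seq s n)) ).
    { induction n as [|n IH]; intros s Hs Hn; [constructor|]. cbn [seq map]. constructor; [|apply IH; lia].
      intros HIn. apply in_map_iff in HIn. destruct HIn as [k [E Hk]]. apply in_seq in Hk.
      destruct (Hxi s ltac:(lia)) as [A1 _]. destruct (Hxi k ltac:(lia)) as [A2 _].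
      assert (c (2 * k)%nat <= c (S (2 * s)))%R by (apply c_decr_le; lia). lra. }
    apply Q; lia. }
  assert (EA := peval_factor (map xi (seq 1 (d - 1))) (map (fun k => RtoC (x k)) (seq 0 d)) ND).
  rewrite !length_map, !length_seq in EA.
  assert (EA' := EA ltac:(lia) ltac:(intros r Hr; apply in_map_iff in Hr; destruct Hr as [k [<- Hk]]; apply in_seq in Hk; exact (proj2 (Hxi k ltac:(lia))))).
  assert (Lead : nth (d - 1) (map (fun k => RtoC (x k)) (seq 0 d)) (RtoC 0) = - (1)).
  { rewrite (nth_indep _ (RtoC 0) (RtoC (x 0%nat))) by (rewrite length_map, length_seq; lia).
    rewrite (map_nth (fun k => RtoC (x k))), seq_nth by lia. simpl. rewrite Hlead, <- RtoC_opp. reflexivity. }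
  rewrite Lead in EA'.
  destruct (cprod_phase (- (1)) (fun k => RtoC t - RtoC (xi k)) (l - 1) (d - 1)) as [s [Hs Es]].
  - intros k Hk. destruct (Hxi k Hk) as [A1 _]. exists (Rabs (t - xi k)). rewrite <- RtoC_minus.
    destruct (Nat.leb_spec k (l - 1)) as [Q|Q].
    + assert (c (2 * l - 1)%nat <= c (S (2 * k)))%R by (apply c_decr_le; lia).
      rewrite Rabs_left by lra. split; [lra|]. rewrite RtoC_opp. ring.
    + assert (c (2 * k)%nat <= c (2 * l)%nat)%R by (apply c_decr_le; lia).
      rewrite Rabs_right by lra. split; [lra|]. ring.
  - exists s. split; [exact Hs|]. unfold rpoly. rewrite EA', monic_cprod, Es. rewrite Nat.min_l by lia.
    replace (- RtoC 1) with (RtoC (-1)) by (rewrite <- RtoC_opp; reflexivity).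
    rewrite <- RtoC_pow, <- !RtoC_mult. f_equal. replace l with (S (l - 1)) at 2 by lia. simpl. ring.
Qed.

Lemma equilibrium_measure_real_period l : (1 <= l <= d)%nat ->
  equilibrium_measure d c eta l = (- ((-1) ^ l * real_period (2 * l - 1) A) / PI)%R.
Proof.
  intros Hl. unfold equilibrium_measure.
  assert (Hlt : (c (2 * l)%nat < c (2 * l - 1)%nat)%R) by (apply c_decr; lia).
  assert (I := interval_integral_R (2 * l - 1) A ltac:(lia) (peval_entire _) (rpoly_real x d)).
  replace (S (2 * l - 1)) with (2 * l)%nat in I by lia.
  apply (is_RInt_gen_scal (V := R_NormedModule) _ ((-1) ^ l)%R) in I.
  apply (is_RInt_gen_ext_interval _ (fun t => Cmod (dz_coef eta (over_real d c t)))) in I; [|exact Hlt|].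
  - apply (is_RInt_gen_unique (V := R_CompleteNormedModule)) in I; try typeclasses eauto.
    match goal with |- (/ PI * ?u)%R = _ => replace u with ((-1) ^ l * - real_period (2 * l - 1) A)%R by (symmetry; exact I) end.
    field. apply PI_neq0.
  - intros t Ht. unfold dz_coef. rewrite Hx, (over_real_odd l) by auto. cbn [fst snd].
    destruct (band_sign l t Hl Ht) as [s [Hs Es]]. rewrite Es.
    assert (P : (0 < abs_root t)%R).
    { apply (abs_root_cont_pos (2 * l - 1)); [lia|]. apply interval_slit_interval; [lia|]. replace (S (2 * l - 1)) with (2 * l)%nat by lia. exact Ht. }
    assert (NZ : ((0%R, abs_root t) : C) <> 0) by (intros E; apply (f_equal snd) in E; simpl in E; lra).
    rewrite Cmod_div by exact NZ. rewrite Cmod_R.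
    replace (Cmod (0%R, abs_root t)) with (abs_root t).
    + change (scal ((-1) ^ l)%R (Re (RtoC ((-1) ^ l * s)) / abs_root t)%R) with ((-1) ^ l * (((-1) ^ l * s) / abs_root t))%R.
      unfold Rdiv. rewrite <- Rmult_assoc. f_equal. rewrite <- Rmult_assoc, sgn_sq, Rmult_1_l.
      rewrite Rabs_mult, (Rabs_right s) by lra. destruct (pow_m1_sign l) as [-> | ->]; unfold Rabs; destruct Rcase_abs; lra.
    + unfold Cmod. cbn [fst snd]. replace (0 ^ 2 + abs_root t ^ 2)%R with (abs_root t * abs_root t)%R by ring. symmetry. apply sqrt_square. lra.
Qed.

Lemma csum_Im g l : Im (csum g l) = fold_right Rplus 0%R (map (fun k => Im (g k)) l).
Proof. induction l as [|a l IH]; [reflexivity|]. simpl. rewrite <- IH. unfold Im; simpl. reflexivity. Qed.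

Lemma sum_n_m_fold (M : nat -> R) q : forall p, 
  sum_n_m (G := R_AbelianMonoid) M p (p + q) = fold_right Rplus 0%R (map M (seq p (S q))).
Proof.
  induction q as [|q IH]; intros p.
  - rewrite Nat.add_0_r, sum_n_n. simpl. ring.
  - rewrite sum_Sn_m by lia. replace (p + S q)%nat with (S p + q)%nat by lia. rewrite IH. reflexivity.
Qed.

(** On each band A dz/mu is - i times the density of pi times the equilibrium
    measure, when the band is run through from right to left: the alternating
    signs of A compensate those of [interval_root]. *)
Lemma tail_frequency k : (1 <= k <= d - 1)%nat ->
  Im (tail_period A (2 * (d - k))) = (- PI * frequency d c eta k)%R.
Proof.
  intros Hk. unfold tail_period, frequency.
  replace (S (2 * (d - k))) with (2 * (d - k) + 1)%nat by lia.
  replace (2 * d - 1 - 2 * (d - k))%nat with (2 * (k - 1) + 1)%nat by lia.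
  rewrite csum_odd_even. replace (S (k - 1)) with k by lia. replace (S (d - k)) with (d + 1 - k)%nat by lia.
  rewrite (csum_ext (fun m => half_period (2 * m) A) (fun _ => 0)), csum_0.
  2:{ intros m Hm. apply in_seq in Hm. apply third_kind_gaps. lia. }
  rewrite Cplus_0_r, csum_Im.
  replace (sum_n_m (G := R_AbelianMonoid) (equilibrium_measure d c eta) (d + 1 - k) d)
    with (sum_n_m (G := R_AbelianMonoid) (equilibrium_measure d c eta) (d + 1 - k) (d + 1 - k + (k - 1))) by (f_equal; lia).
  rewrite sum_n_m_fold. replace (S (k - 1)) with k by lia.
  assert (HS : forall l, In l (seq (d + 1 - k) k) -> (1 <= l <= d)%nat) by (intros l Hl; apply in_seq in Hl; lia).
  induction (seq (d + 1 - k) k) as [|l s IH]; [simpl; ring|]. cbn [map fold_right].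
  rewrite IH by (intros; apply HS; now right).
  assert (Hl : (1 <= l <= d)%nat) by (apply HS; now left).
  rewrite equilibrium_measure_real_period, (band_half_period l) by (try apply peval_entire; try apply rpoly_real; exact Hl).
  replace (Im (Ci * RtoC ((-1) ^ l * real_period (2 * l - 1) A))) with ((-1) ^ l * real_period (2 * l - 1) A)%R by (unfold Im; simpl; ring).
  field. apply PI_neq0.
Qed.

Lemma tail_imaginary i : (1 <= i)%nat -> Re (tail_period A i) = 0%R.
Proof.
  intros Hi. unfold tail_period. rewrite csum_Re.
  assert (HS : forall k, In k (seq (S i) (2 * d - 1 - i)) -> (1 <= k < 2 * d)%nat) by (intros k Hk; apply in_seq in Hk; lia).
  induction (seq (S i) (2 * d - 1 - i)) as [|k s IH]; [reflexivity|]. cbn [map fold_right].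
  rewrite IH by (intros; apply HS; now right). assert (Hk := HS k (or_introl eq_refl)).
  destruct (Nat.Even_or_Odd k) as [[m Em]|[m Em]]; subst k.
  - rewrite third_kind_gaps by lia. unfold Re; simpl. ring.
  - replace (2 * m + 1)%nat with (2 * S m - 1)%nat by lia.
    rewrite (band_half_period (S m)) by (try apply peval_entire; try apply rpoly_real; lia).
    unfold Re. simpl. ring.
Qed.

(** In the reciprocity law, with rho = -1, bands contribute real products of
    imaginary numbers, and all gaps but one have zero half periods. *)
Lemma endpoint_value y k : (1 <= k <= d - 1)%nat ->
  (forall m, (1 <= m <= d - 1)%nat -> half_period (2 * m) (rpoly y (d - 1)) = RtoC (if Nat.eqb m (d - k) then / 2 else 0)%R) ->
  clim (Rbar_locally p_infty) (fun t => chart_prim 1 (rpoly y (d - 1)) (rt false 1 (RtoC t))) (RtoC (frequency d c eta k / 2)).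
Proof.
  intros Hk Hy. set (f := rpoly y (d - 1)) in *.
  destruct (reciprocity (map (fun k => RtoC (y k)) (seq 0 (d - 1))) (map (fun k => RtoC (x k)) (seq 0 d)) (-1) Hd) as [V [HV [_ HR]]].
  - rewrite length_map, length_seq. lia.
  - rewrite length_map, length_seq. lia.
  - rewrite (nth_indep _ (RtoC 0) (RtoC (x 0%nat))) by (rewrite length_map, length_seq; lia).
    rewrite (map_nth (fun k => RtoC (x k))), seq_nth by lia. simpl. now rewrite Hlead.
  - exact (rpoly_real y (d - 1)).
  - exact (rpoly_real x d).
  - change (peval (map (fun k => RtoC (y k)) (seq 0 (d - 1)))) with f in *.
    change (peval (map (fun k => RtoC (x k)) (seq 0 d))) with A in HR.
    replace (frequency d c eta k / 2)%R with V; [exact HV|].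
    assert (E := csum_odd_even (fun i => half_period i f * tail_period A i) (d - 1) 0).
    replace (2 * 0 + 1)%nat with 1%nat in E by lia. replace (2 * (d - 1) + 1)%nat with (2 * d - 1)%nat in E by lia.
    replace (S (d - 1)) with d in E by lia. rewrite E in HR. clear E.
    assert (B0 : Im (csum (fun l => half_period (2 * l - 1) f * tail_period A (2 * l - 1)) (seq 1 d)) = 0%R).
    { apply Im_csum_0. intros l Hl. apply in_seq in Hl.
      assert (T := tail_imaginary (2 * l - 1) ltac:(lia)).
      rewrite (band_half_period l f) by (first [apply peval_entire | apply rpoly_real | lia]).
      set (u := tail_period A (2 * l - 1)) in *. unfold Re, Im in *. simpl. rewrite T. ring. }
    rewrite (csum_ext (fun m => half_period (2 * m) f * tail_period A (2 * m)) (fun m => if Nat.eqb m (d - k) then RtoC (/ 2) * tail_period A (2 * m) else 0)) in HR.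
    2:{ intros m Hm. apply in_seq in Hm. rewrite Hy by lia. destruct (Nat.eqb m (d - k)); ring. }
    rewrite (csum_single (fun m => RtoC (/ 2) * tail_period A (2 * m)) (seq 1 (d - 1)) (d - k)) in HR
      by (first [apply seq_NoDup | apply in_seq; lia]).
    assert (T := tail_frequency k Hk).
    set (u := tail_period A (2 * (d - k))) in *.
    set (b := csum (fun l => half_period (2 * l - 1) f * tail_period A (2 * l - 1)) (seq 1 d)) in *.
    assert (HR2 : (V * -1 * PI)%R = (/ 2 * Im u)%R) by (rewrite HR; unfold Im in *; simpl; rewrite B0; ring).
    rewrite T in HR2. assert (PP := PI_RGT_0). 
    apply (Rmult_eq_reg_r (- PI)); [|lra]. lra.
Qed.
End ThirdKind.

End Charts.

Theorem lemma2 (d : nat) (c : nat -> R) (eta : abelian_differential)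
  (hd : (3 <= d)%nat)
  (hc : forall j : nat, (1 <= j < 2 * d)%nat -> (c (S j) < c j)%R)
  (heta : third_kind d c eta)
  (hgap : gap_normalized d c eta) :
  exists (a b : nat -> cycle d c) (gamma : curve d c) (s : R),
    canonical_homology_basis a b /\
    from_infty_minus_to_infty_plus gamma /\
    (s = 1%R \/ s = (-1)%R) /\
    (exists omega : nat -> abelian_differential, normalized a omega) /\
    forall omega : nat -> abelian_differential, normalized a omega ->
      exists v : nat -> C,
        is_abel_image omega gamma v /\
        forall j : nat, (1 <= j <= d - 1)%nat ->
          Cmult (RtoC s) (v j) = RtoC (frequency d c eta j).
Proof.
  assert (Hd : (2 <= d)%nat) by lia. assert (Hd1 : (1 <= d)%nat) by lia.
  destruct (oval_exists d c hc 1 ltac:(lia)) as [L1 _].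
  assert (HL : forall i, exists L : loop d c, (1 <= i < 2 * d)%nat -> is_oval d c i L).
  { intros i. destruct (classic (1 <= i < 2 * d)%nat) as [Hi|N].
    - destruct (oval_exists d c hc i Hi) as [L H]. exists L. auto.
    - exists L1. tauto. }
  apply functional_choice in HL. destruct HL as [L HL].
  destruct (path_exists d c hc Hd1) as [g Hg].
  destruct (third_kind_real d c hc eta Hd heta hgap) as [x [Hx Hlead]].
  exists (a_cycle d c L), (b_cycle d c L), g, 1%R.
  split; [now apply ovals_canonical|]. split; [now apply path_infinity|]. split; [now left|].
  split; [now apply normalized_exists|].
  intros omega Homega. exists (fun j => RtoC (frequency d c eta j)). split; [|intros; ring].
  intros k Hk. destruct (normalized_real d c hc L HL Hd omega k Homega Hk) as [y [Hy Hper]].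
  replace (RtoC (frequency d c eta k)) with (2 * RtoC (frequency d c eta k / 2)).
  - apply (path_integral_value d c hc g (omega k) (rpoly y (d - 1))); auto; [apply peval_entire|].
    apply (endpoint_value d c hc eta Hd hgap x Hx Hlead y k Hk Hper).
  - rewrite <- RtoC_mult. f_equal. field.
Qed.
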